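(* If $\{u_\varepsilon\}_{\varepsilon>0}\subset\mathcal{A}_\alpha$ satisfies $$E_\varepsilon(u_\varepsilon)\le C_0<\infty,$$ then there exists a function $u\in H^1((0,1)\setminus J';S^1)$, where $J'$ is a finite, perhaps empty, set of points in $(0,1)$, such that along a subsequence $\varepsilon_\ell\to0$ one has $$u_{\varepsilon_\ell}\to u\quad\text{in }L^2\big((0,1);\mathbb{R}^2\big).$$ Furthermore, writing $u(x)=e^{i\theta(x)}$ for $\theta\in H^1((0,1)\setminus J')$, we have that for every compact set $K\subset\subset(0,1)\setminus J'$ there exists an $\varepsilon_0(K)>0$ such that for every $\varepsilon_\ell<\varepsilon_0$ one has $|u_{\varepsilon_\ell}|>0$ on $K$ and there is a lifting whereby $u_{\varepsilon_\ell}(x)=\rho_{\varepsilon_\ell}(x)e^{i\theta_{\varepsilon_\ell}(x)}$ on $K$, with $$\theta_{\varepsilon_\ell}\rightharpoonup\theta\quad\text{weakly in }H^1_{loc}\big((0,1)\setminus J'\big).$$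
   Context: Fix a constant $L>0$, a positive integer $N$ and $\alpha\in[0,2\pi)$. Identify $\mathbb{R}^2$ with $\mathbb{C}$ when convenient. Let $$\mathcal{A}_\alpha=\{u\in H^1((0,1);\mathbb{R}^2): u(0)=1,\ u(1)=e^{i\alpha}\},$$ and for $\varepsilon>0$, $u=(u_1,u_2)\in\mathcal{A}_\alpha$ set $$E_\varepsilon(u)=\int_0^1 \frac{\varepsilon}{2}|u'|^2+\frac{1}{4\varepsilon}(|u|^2-1)^2+\frac{L}{2}(u_1u_2'-u_2u_1'-2\pi N)^2\,dx.$$ Here $\rho_{\varepsilon_\ell}=|u_{\varepsilon_\ell}|$ and the constant $C_0$ is independent of $\varepsilon$. *)

(* Defs.v *)
From HB Require Import structures.
From mathcomp Require Import all_boot all_order all_algebra.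
From mathcomp Require Import all_classical all_reals all_analysis.
Set Implicit Arguments.
Unset Strict Implicit.
Unset Printing Implicit Defensive.
Import Order.TTheory GRing.Theory Num.Theory.
Import numFieldNormedType.Exports.
Local Open Scope classical_set_scope.
Local Open Scope ring_scope.

(* Points of R^2 = C are pairs.  The library norm on R * R is the sup norm, so
   the Euclidean one is spelled out. *)
Definition enorm {R : realType} (z : R * R) : R :=
  Num.sqrt (z.1 ^+ 2 + z.2 ^+ 2).

Definition expi {R : realType} (t : R) : R * R := (cos t, sin t).

Definition L2 {R : realType} (U : set R) (f : R -> R) : Prop :=
  (f \_ U : measurableTypeR R -> R) \in Lfun (@lebesgue_measure R) 2%:E.

(* C^1_c(U).  In one dimension these test functions and the smooth ones define
   the same weak derivatives. *)
Definition test_function {R : realType} (U : set R) (phi : R -> R) : Prop :=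
  [/\ forall x, derivable phi x 1,
      continuous (derive1 phi)
    & exists K : set R,
        [/\ compact K, K `<=` U & forall x, ~ K x -> phi x = 0]].

Definition is_weak_derivative {R : realType} (U : set R) (f g : R -> R) :
    Prop :=
  forall phi : R -> R, test_function U phi ->
    Rintegral (@lebesgue_measure R) U (fun x => f x * derive1 phi x) =
    - Rintegral (@lebesgue_measure R) U (fun x => g x * phi x).

(* The Sobolev space H^1(U), for U open. *)
Definition H1 {R : realType} (U : set R) (f : R -> R) : Prop :=
  L2 U f /\ exists g : R -> R, L2 U g /\ is_weak_derivative U f g.

(* A chosen square-integrable weak derivative, unique up to a null set; it is
   only meaningful when f is in H^1(U). *)
Definition wderiv {R : realType} (U : set R) (f : R -> R) : R -> R :=
  xget (fun _ : R => 0) [set g : R -> R | L2 U g /\ is_weak_derivative U f g].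

Definition H1norm {R : realType} (U : set R) (f : R -> R) : R :=
  Num.sqrt (Rintegral (@lebesgue_measure R) U
    (fun x => f x ^+ 2 + wderiv U f x ^+ 2)).

(* Continuous linear functionals on H^1(U).  The bound forces F to agree on
   functions that are equal almost everywhere on U. *)
Definition H1_dual {R : realType} (U : set R) (F : (R -> R) -> R) : Prop :=
  (forall (a : R) (f g : R -> R), H1 U f -> H1 U g ->
     F (fun x => a * f x + g x) = a * F f + F g) /\
  (exists C : R, forall f : R -> R, H1 U f -> `|F f| <= C * H1norm U f).

Definition H1_weak_cvg {R : realType} (U : set R) (f_ : nat -> R -> R)
    (f : R -> R) : Prop :=
  [/\ \forall l \near \oo, H1 U (f_ l),
      H1 U f
    & forall F : (R -> R) -> R, H1_dual U F -> (fun l => F (f_ l)) @ \oo --> F f].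

(* Weak convergence in H^1(V) for every open V compactly contained in U; each
   f_ l needs to be in H^1(V) only for l large, depending on V. *)
Definition H1loc_weak_cvg {R : realType} (U : set R) (f_ : nat -> R -> R)
    (f : R -> R) : Prop :=
  forall V : set R, open V -> compact (closure V) -> closure V `<=` U ->
    H1_weak_cvg V f_ f.

Definition H1_vec {R : realType} (U : set R) (u : R -> R * R) : Prop :=
  H1 U (fun x => (u x).1) /\ H1 U (fun x => (u x).2).

Definition H1_S1 {R : realType} (U : set R) (u : R -> R * R) : Prop :=
  H1_vec U u /\ forall x, U x -> enorm (u x) = 1.

(* The class A_alpha.  An element of H^1((0,1); R^2) is given by its
   representative that is continuous on [0,1], so that the boundary conditions
   are pointwise. *)
Definition admissible {R : realType} (alpha : R) (u : R -> R * R) : Prop :=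
  [/\ H1_vec `]0, 1[ u,
      {within `[0, 1], continuous u},
      u 0 = (1, 0)
    & u 1 = expi alpha].

Definition energy {R : realType} (L : R) (N : nat) (eps : R)
    (u : R -> R * R) : \bar R :=
  let u1 := fun x => (u x).1 in
  let u2 := fun x => (u x).2 in
  let du1 := wderiv `]0, 1[ u1 in
  let du2 := wderiv `]0, 1[ u2 in
  (\int[@lebesgue_measure R]_(x in `]0%R, 1%R[)
    (eps / 2 * (du1 x ^+ 2 + du2 x ^+ 2)
     + (4 * eps)^-1 * (enorm (u x) ^+ 2 - 1) ^+ 2
     + L / 2 * (u1 x * du2 x - u2 x * du1 x - 2 * pi * N%:R) ^+ 2)%R%:E)%E.

Definition L2_cvg01 {R : realType} (u_ : nat -> R -> R * R)
    (u : R -> R * R) : Prop :=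
  (fun l => \int[@lebesgue_measure R]_(x in `]0%R, 1%R[)
     (enorm (u_ l x - u x) ^+ 2)%:E)%E @ \oo --> 0%E.

(* Main.v *)
Require Import Defs.
From HB Require Import structures.
From mathcomp Require Import all_boot all_order all_algebra.
From mathcomp Require Import all_classical all_reals all_analysis.
From mathcomp Require Import measurable_realfun ring lra.
Import Order.TTheory GRing.Theory Num.Theory.
Import numFieldNormedType.Exports.
Local Open Scope classical_set_scope.
Local Open Scope ring_scope.

(** Write [s = |u_eps|^2].  The energy bound says three things: the potential term
forces [s -> 1] in [L^2]; the Modica-Mortola inequality bounds the variation of
a function of [s] by the energy; and the last term bounds the momentum
[u1 u2' - u2 u1'] in [L^2] uniformly in [eps].

Consequently a segment on which [|u_eps|] comes down to 1/2 carries at least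
1/32 of energy once [eps] is small ([modulus_gap]).  Along a sequence for which
the energies of all rational intervals converge ([diagonal_extraction]), only
finitely many points see at least 1/32 of limit energy in each of their
neighbourhoods ([finite_concentration]); these points are the set [J].  Every
other point has a neighbourhood on which [|u_eps| > 1/2] eventually
([gap_near]).

Where [|u_eps|] stays above 1/2, the phase of [u_eps] is a primitive of
[omega = (u1 u2' - u2 u1') / |u|^2] ([polar_transport], [lift_near]).  Truncating
the denominator from below gives an [omega] that is defined on all of (0, 1) and
bounded in [L^2] uniformly in [eps], so its primitives are equibounded and
equicontinuous and converge everywhere as soon as they converge at the rationals
([cumul_cvg]).  The constants of integration, one for each component of the
complement of [J], are phases of [u_eps] at rational points; they converge along
the same sequence.  This gives phases [theta_l] on all of the complement of
[J], which lift [u_eps] on each compact set from some rank on, and converge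
pointwise to a limit [theta].

It remains to see that [theta] is in [H^1] and that the convergence is weak in
[H^1].  Both follow from one fact about bounded sequences in [L^2]: midpoints of
midpoints of their tails converge strongly ([L2_midpoint_compact],
[strongly_convergent_means]).  Applied to the [omega_l] it produces a
density of [theta]; applied to a subsequence on which a functional [F] misses
its expected limit by [e], it produces means that converge strongly in [H^1]
while [F] still misses its limit by [e], which continuity of [F] forbids
([H1_weak_cvg_bounded]).  Strong convergence of [u_eps] in [L^2] follows by
dominated convergence away from [J] ([L2_limit]).

Sobolev functions of one variable are handled through the fundamental theorem
of calculus: [primitive_on V F f] says that [F] is a primitive of the integrable
function [f] on each segment contained in [V].  Continuous functions
with weak derivative [f] are exactly these ([weak_derivative_primitive],
[primitive_weak_derivative]), and the calculus of primitives needs only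
one chain rule ([primitive_on_comp]). *)

Notation lebesgue := (@lebesgue_measure _).
Notation measurable_set D := (@measurable _ (measurableTypeR _) D).
Notation measurable_on D f := (@measurable_fun _ _ (measurableTypeR _) _ D f).
Notation integrable_on D f := (lebesgue.-integrable D (EFin \o f)).

(** * Integration on the line *)

Lemma integrable_onD {R : realType} (D : set R) (f g : R -> R) :
  measurable_set D -> integrable_on D f -> integrable_on D g ->
  integrable_on D (fun x => f x + g x).
Proof. move=> mD fi gi; have := integrableD mD fi gi; apply: eq_integrable => //. Qed.

Lemma integrable_onZ {R : realType} (D : set R) (k : R) (f : R -> R) :
  measurable_set D -> integrable_on D f -> integrable_on D (fun x => k * f x).
Proof. move=> mD fi; have := integrableZl mD k fi; apply: eq_integrable => //. Qed.

Lemma integrable_onB {R : realType} (D : set R) (f g : R -> R) :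
  measurable_set D -> integrable_on D f -> integrable_on D g ->
  integrable_on D (fun x => f x - g x).
Proof. move=> mD fi gi; have := integrableB mD fi gi; apply: eq_integrable => //. Qed.

Lemma le_integrable_on {R : realType} (D : set R) (f g : R -> R) :
  measurable_set D -> measurable_on D f -> (forall x, D x -> `|f x| <= g x) ->
  integrable_on D g -> integrable_on D f.
Proof.
move=> mD mf fg; apply: le_integrable => //; first exact/measurable_EFinP.
by move=> x Dx /=; rewrite lee_fin (le_trans (fg x Dx))// ler_norm.
Qed.

Lemma integrable_onS {R : realType} (A B : set R) (f : R -> R) :
  measurable_set A -> measurable_set B -> A `<=` B ->
  integrable_on B f -> integrable_on A f.
Proof. by move=> mA mB AB; exact: integrableS. Qed.

Lemma measurable_set_itv {R : realType} (i : interval R) :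
  measurable_set [set` i].
Proof. exact: measurable_itv. Qed.

Lemma integrable_on_measurable {R : realType} (D : set R) (f : R -> R) :
  integrable_on D f -> measurable_on D f.
Proof. by move=> /measurable_int/measurable_EFinP. Qed.

Lemma eq_integrable_on {R : realType} (D : set R) (f g : R -> R) :
  measurable_set D -> (forall x, D x -> f x = g x) ->
  integrable_on D f -> integrable_on D g.
Proof.
move=> mD fg; apply: eq_integrable => // x; rewrite inE => Dx.
by rewrite /= fg.
Qed.

Lemma eq_Rintegral_on {R : realType} (D : set R) (f g : R -> R) :
  (forall x, D x -> f x = g x) ->
  \int[lebesgue]_(x in D) f x = \int[lebesgue]_(x in D) g x.
Proof. by move=> fg; apply: eq_Rintegral => x; rewrite inE; exact: fg. Qed.

Lemma Rintegral_subset_le {R : realType} (A B : set R) (f : R -> R) :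
  measurable_set A -> measurable_set B -> A `<=` B -> integrable_on B f ->
  (forall x, B x -> 0 <= f x) ->
  \int[lebesgue]_(x in A) f x <= \int[lebesgue]_(x in B) f x.
Proof.
move=> mA mB AB fi f0; have fiA := integrable_onS _ _ _ mA mB AB fi.
rewrite /Rintegral fine_le//; try exact: integrable_fin_num.
apply: ge0_subset_integral => //.
by apply/measurable_EFinP; exact: integrable_on_measurable.
Qed.

Lemma integrable_onM_bounded {R : realType} (D : set R) (M : R) (h f : R -> R) :
  measurable_set D -> measurable_on D h -> (forall x, D x -> `|h x| <= M) ->
  integrable_on D f -> integrable_on D (fun x => h x * f x).
Proof.
move=> mD mh hM fi.
have mf : measurable_on D f by have /measurable_int/measurable_EFinP := fi.
apply: (le_integrable_on _ _ (fun x => M * `|f x|)) => //.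
- exact: measurable_funM.
- by move=> x Dx; rewrite normrM ler_wpM2r// hM.
- by apply: integrable_onZ => //; exact: integrable_norm.
Qed.

Lemma segment_bounded {R : realType} (a b : R) (F : R -> R) :
  {within `[a, b], continuous F} ->
  exists2 M : R, 0 <= M & forall x, a <= x -> x <= b -> `|F x| <= M.
Proof.
move=> cF.
have : compact (F @` `[a, b]).
  by apply: continuous_compact => //; exact: segment_compact.
move=> /compact_bounded[M [_ HM]].
exists (Num.max 0 (M + 1)); first by rewrite le_max lexx.
move=> x ax xb; apply: HM; last by exists x => //; rewrite /= in_itv/= ax.
by rewrite lt_max ltrDl ltr01 orbT.
Qed.

Lemma subset_itvcc {R : realType} (a b x y : R) :
  a <= x -> y <= b -> `[x, y] `<=` `[a, b].
Proof.
move=> ax yb t /=; rewrite !in_itv/= => /andP[xt ty].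
by rewrite (le_trans ax xt) (le_trans ty yb).
Qed.

Lemma integrable_itvS {R : realType} (a b x y : R) (f : R -> R) :
  a <= x -> y <= b -> integrable_on `[a, b] f -> integrable_on `[x, y] f.
Proof. by move=> ax yb; apply: integrableS => //; exact: subset_itvcc. Qed.

Lemma Rintegral_itv_cat {R : realType} (x y z : R) (f : R -> R) :
  x <= y -> y <= z -> integrable_on `[x, z] f ->
  \int[lebesgue]_(t in `[x, z]) f t =
  \int[lebesgue]_(t in `[x, y]) f t + \int[lebesgue]_(t in `[y, z]) f t.
Proof.
move=> xy yz fi.
have := @Rintegral_itvB R f (BLeft x) (BRight z) y fi.
rewrite !bnd_simp => /(_ xy yz) E.
rewrite -[X in _ + X]Rintegral_itv_obnd_cbnd; last first.
  apply: integrableS fi => //; apply: subset_itvr; rewrite bnd_simp//.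
by rewrite -E addrC subrK.
Qed.

(** * Primitives and their calculus *)

(** Compactness of a segment in the form that suits additive interval
functions.  Only intervals that contain the point [z] are tested near [z], which
is what lets differentiability at [z] be used below without any uniformity.
The supremum of the points reached from [a] has to be [b]. *)
Lemma cousin {R : realType} (a b : R) (P : R -> R -> Prop) :
  a <= b ->
  (forall x y z, a <= x -> x <= y -> y <= z -> z <= b ->
    P x y -> P y z -> P x z) ->
  (forall z, a <= z <= b -> exists2 d : R, 0 < d &
    forall x y, a <= x -> x <= z -> z <= y -> y <= b -> y - x < d -> P x y) ->
  P a b.
Proof.
move=> ab Padd Ploc.
pose S := [set y | a <= y <= b /\ P a y].
have Sa : S a.
  split; first by rewrite lexx.
  have [|d d0 Pd] := Ploc a; first by rewrite lexx.
  by apply: Pd => //; rewrite subrr.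
have Sub : ubound S b by move=> y [/andP[]].
have hS : has_sup S by split; [exists a | exists b].
have as_ : a <= sup S by apply: (sup_upper_bound hS).
have sb : sup S <= b by apply: ge_sup => //; exists a.
have [|d d0 Pd] := Ploc (sup S); first by rewrite as_ sb.
have d2 : 0 < d / 2 by rewrite divr_gt0.
have [y [/andP[ay yb] Pay] sy] := sup_adherent d2 hS.
have ys : y <= sup S by apply: (sup_upper_bound hS) => //; split=> //; rewrite ay.
pose z := Num.min b (sup S + d / 4).
have zb : z <= b by rewrite ge_min lexx.
have sz : sup S <= z by rewrite le_min sb/= lerDl divr_ge0// ltW.
have zd : z <= sup S + d / 4 by rewrite ge_min lexx orbT.
have Paz : P a z.
  apply: (Padd a y z) => //; first exact: le_trans ys sz.
  apply: Pd => //; lra.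
have : z <= sup S.
  by apply: (sup_upper_bound hS); split=> //; rewrite zb andbT (le_trans as_).
move=> zs; suff -> : b = z by [].
apply/eqP; rewrite eq_le zb andbT /z le_min lexx/=.
move: zs; rewrite /z ge_min => /orP[bs|]; lra.
Qed.

(** Quantifying over the segments of [V] makes sense for any set [V] and avoids
a choice of base points in its components. *)
Definition primitive_on {R : realType} (V : set R) (F f : R -> R) :=
  forall x y, x <= y -> `[x, y] `<=` V ->
    integrable_on `[x, y] f /\ F y - F x = \int[lebesgue]_(t in `[x, y]) f t.

Lemma primitive_onS {R : realType} (V W : set R) (F f : R -> R) :
  W `<=` V -> primitive_on V F f -> primitive_on W F f.
Proof. by move=> WV Ff x y xy xyW; apply: Ff => //; exact: subset_trans WV. Qed.

Lemma primitive_on_eq {R : realType} (V : set R) (F G f g : R -> R) :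
  (forall x, V x -> F x = G x) -> (forall x, V x -> f x = g x) ->
  primitive_on V F f -> primitive_on V G g.
Proof.
move=> FG fg Ff x y xy xyV.
have Vx : V x by apply: xyV; rewrite /= in_itv/= lexx.
have Vy : V y by apply: xyV; rewrite /= in_itv/= lexx andbT.
have [fi E] := Ff x y xy xyV; split.
  apply: eq_integrable fi => // t; rewrite inE => xt /=.
  by rewrite fg//; exact: xyV.
rewrite -!FG// E; apply: eq_Rintegral => t; rewrite inE => xt.
by rewrite fg//; exact: xyV.
Qed.

Lemma primitive_onD {R : realType} (V : set R) (F G f g : R -> R) :
  primitive_on V F f -> primitive_on V G g ->
  primitive_on V (fun x => F x + G x) (fun x => f x + g x).
Proof.
move=> Ff Gg x y xy xyV.
have [fi EF] := Ff x y xy xyV; have [gi EG] := Gg x y xy xyV; split.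
  exact: integrable_onD.
by rewrite RintegralD// -EF -EG; ring.
Qed.

Lemma primitive_onZ {R : realType} (V : set R) (k : R) (F f : R -> R) :
  primitive_on V F f -> primitive_on V (fun x => k * F x) (fun x => k * f x).
Proof.
move=> Ff x y xy xyV; have [fi EF] := Ff x y xy xyV; split.
  exact: integrable_onZ.
by rewrite RintegralZl// -EF; ring.
Qed.

Lemma primitive_onB {R : realType} (V : set R) (F G f g : R -> R) :
  primitive_on V F f -> primitive_on V G g ->
  primitive_on V (fun x => F x - G x) (fun x => f x - g x).
Proof.
move=> Ff Gg.
have := primitive_onD _ _ _ _ _ Ff (primitive_onZ _ (-1) _ _ Gg).
by apply: primitive_on_eq => x _; rewrite mulN1r.
Qed.

Lemma primitive_on_continuous {R : realType} (a b : R) (F f : R -> R) :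
  a <= b -> primitive_on `[a, b] F f -> {within `[a, b], continuous F}.
Proof.
move=> ab Ff; have [fi _] := Ff a b ab (fun _ => id).
have c1 := parameterized_integral_continuous ab fi.
have c2 : {within `[a, b],
    continuous (fun x => F a + parameterized_integral lebesgue a x f)}.
  by move=> x; apply: cvgD; [exact: cvg_cst | exact: c1].
apply: subspace_eq_continuous c2 => x; rewrite inE/= in_itv/= => /andP[ax xb].
have [] := Ff a x ax; first exact: subset_itvcc.
move=> _ E.
by rewrite /from_subspace /parameterized_integral -E addrC subrK.
Qed.

Lemma primitive_on_continuous_at {R : realType} (V : set R) (F f : R -> R) x :
  open V -> primitive_on V F f -> V x -> {for x, continuous F}.
Proof.
move=> oV Ff Vx.
have /nbhs_ballP[d /= d0 xd] : nbhs x V by apply: open_nbhs_nbhs.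
have sub : `[x - d / 2, x + d / 2] `<=` V.
  move=> t /=; rewrite in_itv/= => /andP[t1 t2]; apply: xd.
  by rewrite /ball/= ltr_distlC; apply/andP; split; lra.
have le1 : x - d / 2 <= x + d / 2 by lra.
have := primitive_on_continuous _ _ _ _ le1 (primitive_onS _ _ _ _ sub Ff).
have lt1 : x - d / 2 < x + d / 2 by lra.
move=> /(continuous_within_itvP _ lt1)[+ _ _]; apply.
by rewrite in_itv/=; apply/andP; split; lra.
Qed.

Lemma primitive_on_measurable {R : realType} (V : set R) (F f : R -> R) :
  open V -> primitive_on V F f -> measurable_on V F.
Proof.
move=> oV Ff; apply: open_continuous_measurable_fun => // x.
by rewrite inE => Vx; exact: (primitive_on_continuous_at _ _ _ _ oV Ff Vx).
Qed.

Lemma within_continuous_dist {R : realType} (a b : R) (F : R -> R) (z e : R) :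
  {within `[a, b], continuous F} -> a <= z <= b -> 0 < e ->
  exists2 d : R, 0 < d &
    forall x, a <= x -> x <= b -> `|x - z| < d -> `|F x - F z| <= e.
Proof.
move=> cF zab e0.
have zab' : `[a, b]%classic z by rewrite /= in_itv.
have /subspace_continuousP/(_ z zab')/cvgrPdist_le/(_ _ e0) := cF.
rewrite near_withinE => /nbhs_ballP[d /= d0 dP].
exists d => // x ax xb xz; rewrite distrC; apply: dP; first by rewrite /ball/= distrC.
by rewrite /= in_itv/= ax xb.
Qed.

Lemma is_derive_expansion {R : realType} (f : R -> R) (c d e : R) :
  is_derive c 1 f d -> 0 < e ->
  \forall y \near c, `|f y - f c - d * (y - c)| <= e * `|y - c|.
Proof.
move=> [df <-] e0.
have /cvgrPdist_le /(_ _ e0) : (fun h => h^-1 *: ((f \o shift c) (h *: 1) - f c)) @ 0^'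
  --> 'D_1 f c by exact: df.
rewrite near_withinE => /nbhs_ballP[r /= r0 rP].
apply/nbhs_ballP; exists r => //= y yr.
have [->|yc] := eqVneq y c; first by rewrite !subrr mulr0 subrr normr0 mulr0.
have yc0 : y - c != 0 by rewrite subr_eq0.
have byc : ball 0 r (y - c) by rewrite /ball/= sub0r opprB.
have := rP (y - c) byc yc0.
rewrite [_ *: 1]mulr1 => H.
have {H} : `|'D_1 f c - (y - c)^-1 * (f y - f c)| <= e by rewrite -[X in f X](subrK c).
rewrite -(ler_pM2r (x := `|y - c|)) ?normr_gt0// -normrM mulrBl => H.
by rewrite -normrN opprB (le_trans _ H)// [_^-1 * _]mulrC divfK.
Qed.

(** The defect [D] of the chain rule is an additive interval function, and near
a point [z] it is at most [e] times the integral of [|f|]: the term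
[Phi (F y) - Phi (F z)] is handled by differentiability of [Phi] at the single
point [F z].  By [cousin] this bound holds on the whole interval. *)
Lemma primitive_on_comp {R : realType} (V : set R) (F f Phi phi : R -> R) :
  (forall t : R, is_derive t 1 Phi (phi t)) -> continuous phi ->
  primitive_on V F f ->
  primitive_on V (fun x => Phi (F x)) (fun x => phi (F x) * f x).
Proof.
move=> dPhi cphi Ff a b ab abV.
have Fab := primitive_onS _ _ _ _ abV Ff.
have [fi _] := Ff a b ab abV.
have cF := primitive_on_continuous _ _ _ _ ab Fab.
have cphiF : {within `[a, b], continuous (phi \o F)}.
  apply/subspace_continuousP => x abx.
  have /subspace_continuousP/(_ x abx) cx := cF.
  exact: cvg_comp cx (cphi _).
have gi : integrable_on `[a, b] (fun x => phi (F x) * f x).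
  have [M _ HM] := segment_bounded _ _ _ cphiF.
  apply: (integrable_onM_bounded _ M) => //.
    exact: subspace_continuous_measurable_fun.
  by move=> x /=; rewrite in_itv/= => /andP[]; exact: HM.
split=> //.
pose D x y := Phi (F y) - Phi (F x) -
  \int[lebesgue]_(t in `[x, y]) (phi (F t) * f t).
pose M x y := \int[lebesgue]_(t in `[x, y]) `|f t|.
have nfi : integrable_on `[a, b] (fun t => `|f t|) by exact: integrable_norm.
suff bound e : 0 < e -> `|D a b| <= e * M a b.
  apply/eqP; rewrite -subr_eq0 -normr_le0; apply/ler_addgt0Pr => e e0.
  have M0 : 0 <= M a b by apply: Rintegral_ge0.
  have := bound (e / (M a b + 1)).
  rewrite divr_gt0 ?ltr_wpDl// => /(_ isT)/le_trans; apply.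
  rewrite add0r -mulrA ler_piMr//; first exact: ltW.
  by rewrite mulrC ler_pdivrMr ?ltr_wpDl// mul1r lerDl.
move=> e0; apply: (cousin a b (fun x y => `|D x y| <= e * M x y) ab).
  move=> x y z ax xy yz zb Dxy Dyz.
  have gi' := integrable_itvS _ _ _ _ _ ax zb gi.
  have nfi' := integrable_itvS _ _ _ _ _ ax zb nfi.
  have -> : D x z = D x y + D y z.
    by rewrite /D (Rintegral_itv_cat x y z)//; ring.
  rewrite /M (Rintegral_itv_cat x y z)// mulrDr.
  by rewrite (le_trans (ler_normD _ _))// lerD.
move=> z /andP[az zb].
have e2 : 0 < e / 2 by rewrite divr_gt0.
have /nbhs_ballP[r /= r0 dz] := is_derive_expansion _ _ _ _ (dPhi (F z)) e2.
have zab : a <= z <= b by rewrite az zb.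
have r2 : 0 < r / 2 by rewrite divr_gt0.
have [d1 d10 Fd1] := within_continuous_dist _ _ _ _ _ cF zab r2.
have [d2 d20 Fd2] := within_continuous_dist _ _ _ _ _ cphiF zab e2.
exists (Num.min d1 d2); first by rewrite lt_min d10 d20.
move=> x y ax xz zy yb; rewrite lt_min => /andP[xyd1 xyd2].
have lin t : x <= t -> t <= y ->
    `|Phi (F t) - Phi (F z) - phi (F z) * (F t - F z)| <= e / 2 * `|F t - F z|.
  move=> xt ty; apply: dz; rewrite /ball/= distrC.
  have : `|F t - F z| <= r / 2.
    apply: Fd1; [exact: le_trans xt | exact: le_trans yb |].
    rewrite ltr_distlC; apply/andP; split; lra.
  by move=> /le_lt_trans; apply; lra.
have xy := le_trans xz zy.
have xb := le_trans xz zb.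
have fi' := integrable_itvS _ _ _ _ _ ax yb fi.
have gi' := integrable_itvS _ _ _ _ _ ax yb gi.
have nfi' := integrable_itvS _ _ _ _ _ ax yb nfi.
have Fle p q : x <= p -> p <= q -> q <= y ->
    `|F q - F p| <= \int[lebesgue]_(t in `[p, q]) `|f t|.
  move=> xp pq qy.
  have [|fpq ->] := Fab p q pq.
    by apply: subset_itvcc; [exact: le_trans xp | exact: le_trans qy yb].
  exact: le_normr_Rintegral.
have E : D x y = (Phi (F y) - Phi (F z) - phi (F z) * (F y - F z)) -
    (Phi (F x) - Phi (F z) - phi (F z) * (F x - F z)) -
    \int[lebesgue]_(t in `[x, y]) ((phi (F t) - phi (F z)) * f t).
  have -> : \int[lebesgue]_(t in `[x, y]) ((phi (F t) - phi (F z)) * f t) =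
      \int[lebesgue]_(t in `[x, y]) (phi (F t) * f t) - phi (F z) * (F y - F x).
    have [|_ ->] := Fab x y xy; first exact: subset_itvcc.
    rewrite -RintegralZl// -RintegralB//; last exact: integrable_onZ.
    by apply: eq_Rintegral => t _; rewrite mulrBl.
  by rewrite /D; ring.
rewrite E.
have h1 := lin y xy (lexx y).
have h2 := lin x (lexx x) xy.
have k1 := Fle z y xz zy (lexx y).
have k2 := Fle x z (lexx x) xz zy.
have h3 : `|\int[lebesgue]_(t in `[x, y]) ((phi (F t) - phi (F z)) * f t)| <=
    e / 2 * M x y.
  have hi : integrable_on `[x, y] (fun t => (phi (F t) - phi (F z)) * f t).
    apply: (eq_integrable_on _ (fun t => phi (F t) * f t - phi (F z) * f t)) => //.
      by move=> t _; rewrite /= mulrBl.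
    by apply: integrable_onB => //; exact: integrable_onZ.
  apply: le_trans (le_normr_Rintegral _ hi) _ => //.
  rewrite /M -RintegralZl//; apply: le_Rintegral => //.
  - exact: integrable_norm.
  - exact: integrable_onZ.
  move=> t /=; rewrite in_itv/= => /andP[xt ty].
  rewrite normrM ler_wpM2r//; apply: Fd2; [exact: le_trans xt | exact: le_trans yb |].
  rewrite ltr_distlC; apply/andP; split; lra.
have Mcat : M x y = M x z + M z y by exact: Rintegral_itv_cat.
have {}h1 : `|Phi (F y) - Phi (F z) - phi (F z) * (F y - F z)| <= e / 2 * M z y.
  by apply: (le_trans h1); rewrite ler_wpM2l// ltW.
have {}h2 : `|Phi (F x) - Phi (F z) - phi (F z) * (F x - F z)| <= e / 2 * M x z.
  by apply: (le_trans h2); rewrite distrC ler_wpM2l// ltW.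
rewrite (le_trans (ler_normB _ _))// (le_trans (lerD (ler_normB _ _) h3))//.
by rewrite (le_trans (lerD (lerD h1 h2) (lexx _)))// Mcat; lra.
Qed.

Lemma primitive_onM {R : realType} (V : set R) (F G f g : R -> R) :
  primitive_on V F f -> primitive_on V G g ->
  primitive_on V (fun x => F x * G x) (fun x => f x * G x + F x * g x).
Proof.
(* Polarization reduces the product to the chain rule for the square. *)
move=> Ff Gg.
have dsqr (t : R) : is_derive t 1 (fun x : R => x ^+ 2) (2 * t).
  by apply: is_derive_eq; rewrite /GRing.scale/=; ring.
have csqr : continuous (fun t : R => 2 * t).
  by move=> t; apply: cvgM; [exact: cvg_cst | exact: cvg_id].
have S := primitive_on_comp _ _ _ _ _ dsqr csqr (primitive_onD _ _ _ _ _ Ff Gg).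
have SB := primitive_on_comp _ _ _ _ _ dsqr csqr (primitive_onB _ _ _ _ _ Ff Gg).
have := primitive_onZ _ 4^-1 _ _ (primitive_onB _ _ _ _ _ S SB).
by apply: primitive_on_eq => x _; field.
Qed.

(** * Weak derivatives on the line *)

Lemma primitive_on_id {R : realType} (V : set R) :
  primitive_on V id (fun=> 1).
Proof.
move=> x y xy _; split.
  apply: continuous_compact_integrable; first exact: segment_compact.
  by apply: continuous_subspaceT => z; exact: cvg_cst.
rewrite Rintegral_cst//= lebesgue_measure_itv/= lte_fin mul1r.
by move: xy; rewrite le_eqVlt => /predU1P[->|->//]; rewrite ltxx subrr.
Qed.

Lemma primitive_on_C1 {R : realType} (V : set R) (Phi phi : R -> R) :
  (forall t : R, is_derive t 1 Phi (phi t)) -> continuous phi ->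
  primitive_on V Phi phi.
Proof.
move=> dPhi cphi.
have := primitive_on_comp V _ _ _ _ dPhi cphi (primitive_on_id V).
by apply: primitive_on_eq => x _ //; rewrite mulr1.
Qed.

(** A remainder estimate that treats [t |-> t |t|] at 0 and away from 0 alike. *)
Lemma is_derive_quadratic {R : realType} (f : R -> R) (c d C : R) :
  0 < C -> (forall y, `|f y - f c - d * (y - c)| <= C * (y - c) ^+ 2) ->
  is_derive c 1 f d.
Proof.
move=> C0 fP.
have H : (fun h => h^-1 *: ((f \o shift c) (h *: (1 : R)) - f c)) @ 0^' --> d.
  apply/cvgrPdist_le => e e0; rewrite near_withinE; apply/nbhs_ballP.
  exists (e / C) => /=; first by rewrite divr_gt0.
  move=> h; rewrite /ball/= sub0r normrN ltr_pdivlMr// => hr h0.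
  have := fP (h + c); rewrite addrK => H.
  rewrite [_ *: 1]mulr1 /shift/= /GRing.scale/=.
  rewrite -(ler_pM2r (x := `|h|)) ?normr_gt0// -normrM mulrBl.
  rewrite [h^-1 * _]mulrC divfK// distrC (le_trans H)//.
  rewrite -normr_id -[h ^+ 2]ger0_norm ?sqr_ge0// normrX expr2 mulrA normr_id.
  by rewrite ler_wpM2r// mulrC ltW.
split; first by apply/cvg_ex; exists d.
by apply/cvg_lim => //.
Qed.

Lemma is_derive_mul_norm {R : realType} (c : R) :
  is_derive c 1 (fun t : R => t * `|t|) (2 * `|c|).
Proof.
apply: (is_derive_quadratic _ _ _ 1) => // y; rewrite mul1r ler_norml.
have sq := sqr_ge0 (y - c).
have [c0|c0] := leP 0 c; have [y0|y0] := leP 0 y.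
- by rewrite !ger0_norm//; apply/andP; split; nra.
- rewrite (ger0_norm c0) (ltr0_norm y0).
  have := mulr_ge0_le0 c0 (ltW y0) => cy.
  by apply/andP; split; nra.
- rewrite (ltr0_norm c0) (ger0_norm y0).
  have := mulr_le0_ge0 (ltW c0) y0 => cy.
  by apply/andP; split; nra.
- by rewrite !ltr0_norm//; apply/andP; split; nra.
Qed.

(** A [C^1] step from 0 on the left of 0 to 1 on the right of 2: the second
difference of [t |-> t |t|], whose derivative is a second difference of [|t|]
and hence a tent. *)
Definition step {R : realType} (t : R) : R :=
  2^-1 + (t * `|t| - 2 * ((t - 1) * `|t - 1|) + (t - 2) * `|t - 2|) / 4.

Definition tent {R : realType} (t : R) : R :=
  (`|t| - 2 * `|t - 1| + `|t - 2|) / 2.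

Lemma is_derive_affine {R : realType} (k c t d : R) (f : R -> R) :
  is_derive (k * t + c) 1 f d -> is_derive t 1 (fun x => f (k * x + c)) (k * d).
Proof.
move=> df.
have da : is_derive t 1 (fun x : R => k * x + c) k.
  by apply: is_derive_eq; rewrite /GRing.scale/=; ring.
have := @is_derive1_comp _ f (fun x => k * x + c) t _ _ df da.
by rewrite mulrC.
Qed.

Lemma is_derive_step {R : realType} (t : R) : is_derive t 1 step (tent t).
Proof.
have d0 := is_derive_mul_norm t.
have aff (c : R) : is_derive t 1 (fun x => (x - c) * `|x - c|) (2 * `|t - c|).
  have := is_derive_affine 1 (- c) t _ _ (is_derive_mul_norm (1 * t - c)).
  by rewrite !mul1r; under eq_fun do rewrite mul1r.
pose q (c : R) : R -> R := fun x => (x - c) * `|x - c|.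
have dq : is_derive t 1 ((fun x : R => x * `|x|) - 2 *: q 1 + q 2)
    (2 * `|t| - 2 *: (2 * `|t - 1|) + 2 * `|t - 2|).
  have a1 : is_derive t 1 (q 1) (2 * `|t - 1|) := aff 1.
  have a2 : is_derive t 1 (q 2) (2 * `|t - 2|) := aff 2.
  exact: is_deriveD.
have -> : step = cst (2^-1 : R) + 4^-1 *: ((fun x : R => x * `|x|) - 2 *: q 1 + q 2).
  by apply/funext => x; rewrite /step !fctE /GRing.scale/= mulrC.
have -> : tent t = 0 + 4^-1 *: (2 * `|t| - 2 *: (2 * `|t - 1|) + 2 * `|t - 2|).
  by rewrite /GRing.scale/= /tent; field.
exact: is_deriveD.
Qed.

Lemma continuous_tent {R : realType} : continuous (@tent R).
Proof.
move=> t; apply: cvgM; last exact: cvg_cst.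
apply: cvgD; first apply: cvgB; first exact: cvg_norm.
  by apply: cvgM; [exact: cvg_cst | apply: cvg_norm; apply: cvgB; [exact: cvg_id | exact: cvg_cst]].
by apply: cvg_norm; apply: cvgB; [exact: cvg_id | exact: cvg_cst].
Qed.

Lemma step0 {R : realType} (t : R) : t <= 0 -> step t = 0.
Proof.
by move=> t0; rewrite /step !ler0_norm; [field | lra..].
Qed.

Lemma step1 {R : realType} (t : R) : 2 <= t -> step t = 1.
Proof.
by move=> t0; rewrite /step !ger0_norm; [field | lra..].
Qed.

Lemma step_itv {R : realType} (t : R) : 0 <= step t <= 1.
Proof.
have [t0|t0] := leP t 0; first by rewrite step0// lexx ler01.
have [t2|t2] := leP 2 t; first by rewrite step1// lexx ler01.
have [t1|t1] := leP t 1.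
  have -> : step t = t ^+ 2 / 2.
    rewrite /step (gtr0_norm t0) (@ler0_norm _ (t - 1)) ?subr_le0//.
    by rewrite (@ltr0_norm _ (t - 2)) ?subr_lt0//; field.
  by apply/andP; split; nra.
have -> : step t = 1 - (2 - t) ^+ 2 / 2.
  rewrite /step (gtr0_norm t0) (@gtr0_norm _ (t - 1)) ?subr_gt0//.
  by rewrite (@ltr0_norm _ (t - 2)) ?subr_lt0//; field.
by apply/andP; split; nra.
Qed.

Lemma tent_ge0 {R : realType} (t : R) : 0 <= tent t.
Proof.
have := ler_normD t (t - 2).
rewrite /tent => H; rewrite divr_ge0// -addrA [- _ + _]addrC addrA subr_ge0.
move: H.
have -> : t + (t - 2) = 2 * (t - 1) by ring.
by rewrite normrM ger0_norm.
Qed.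

Lemma tent_eq0 {R : realType} (t : R) : (t <= 0) || (2 <= t) -> tent t = 0.
Proof.
move=> /orP[t0|t0]; rewrite /tent.
  by rewrite !ler0_norm; [field | lra..].
by rewrite !ger0_norm; [field | lra..].
Qed.

Lemma Rintegral_dominated_cvg {R : realType} (D : set R) (f_ : nat -> R -> R)
    (f g : R -> R) :
  measurable_set D -> (forall n, measurable_on D (f_ n)) ->
  (forall x, D x -> f_ ^~ x @ \oo --> f x) ->
  integrable_on D g -> (forall n x, D x -> `|f_ n x| <= g x) ->
  (fun n => \int[lebesgue]_(x in D) f_ n x) @ \oo -->
  \int[lebesgue]_(x in D) f x.
Proof.
move=> mD mf_ f_f gi f_g.
have mf : measurable_on D f by exact: measurable_fun_cvg mf_ f_f.
have mE (h : R -> R) : measurable_on D h -> measurable_on D (EFin \o h).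
  by move=> mh; exact/measurable_EFinP.
have := @dominated_convergence _ _ R lebesgue D mD (fun n => EFin \o f_ n)
  (EFin \o f) (EFin \o g) (fun n => mE _ (mf_ n)) (mE _ mf) _ gi _.
case=> [||fi _ H].
- by apply: aeW => x Dx; apply/fine_cvgP; split; [exact: nearW | exact: f_f].
- by apply: aeW => x n Dx /=; rewrite lee_fin f_g.
apply: fine_cvg; rewrite fineK; first exact: H.
exact: integrable_fin_num.
Qed.

Lemma Rintegral_eq_support {R : realType} (A B : set R) (h : R -> R) :
  (forall x, A x -> ~ B x -> h x = 0) -> (forall x, B x -> ~ A x -> h x = 0) ->
  \int[lebesgue]_(x in A) h x = \int[lebesgue]_(x in B) h x.
Proof.
move=> AB BA; rewrite Rintegral_mkcond [RHS]Rintegral_mkcond.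
congr Rintegral; apply/funext => x; rewrite !patchE.
case: ifPn; case: ifPn => //; rewrite ?inE ?notin_setE.
- by move=> ? ?; rewrite AB.
- by move=> ? ?; rewrite BA.
Qed.

(** Both ramps of length [2 / k] lie inside [`[x, y]], so that the cut-off is
supported in the segment itself, whatever open set contains it. *)
Definition cutoff {R : realType} (k x y t : R) : R :=
  step (k * t + - (k * x)) - step (k * t + (2 - k * y)).

Definition cutoff' {R : realType} (k x y t : R) : R :=
  k * tent (k * t + - (k * x)) - k * tent (k * t + (2 - k * y)).

Lemma is_derive_cutoff {R : realType} (k x y t : R) :
  is_derive t 1 (cutoff k x y) (cutoff' k x y t).
Proof.
have d1 := is_derive_affine k (- (k * x)) t _ _ (is_derive_step _).
have d2 := is_derive_affine k (2 - k * y) t _ _ (is_derive_step _).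
exact: is_deriveB.
Qed.

Lemma continuous_tent_affine {R : realType} (k c : R) :
  continuous (fun t => k * tent (k * t + c)).
Proof.
move=> t; apply: cvgM; first exact: cvg_cst.
apply: (@continuous_comp _ _ _ (fun t => k * t + c) tent); last exact: continuous_tent.
by apply: cvgD; [apply: cvgM; [exact: cvg_cst | exact: cvg_id] | exact: cvg_cst].
Qed.

Lemma continuous_cutoff' {R : realType} (k x y : R) : continuous (cutoff' k x y).
Proof. by move=> t; apply: cvgB; exact: continuous_tent_affine. Qed.

Lemma derive1_cutoff {R : realType} (k x y : R) :
  derive1 (cutoff k x y) = cutoff' k x y.
Proof.
by apply/funext => t; rewrite derive1E; have [_ ->] := is_derive_cutoff k x y t.
Qed.

Lemma continuous_cutoff {R : realType} (k x y : R) : continuous (cutoff k x y).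
Proof.
move=> t; apply/differentiable_continuous/derivable1_diffP.
by have [] := is_derive_cutoff k x y t.
Qed.

Lemma cutoff_le1 {R : realType} (k x y t : R) : `|cutoff k x y t| <= 1.
Proof.
rewrite /cutoff; have /andP[a0 a1] := step_itv (k * t + - (k * x)).
have /andP[b0 b1] := step_itv (k * t + (2 - k * y)).
by rewrite ler_norml; apply/andP; split; lra.
Qed.

Lemma cutoff_out {R : realType} (k x y t : R) : 0 < k -> 2 <= k * (y - x) ->
  (t <= x) || (y <= t) -> cutoff k x y t = 0 /\ cutoff' k x y t = 0.
Proof.
move=> k0 kyx /orP[tx|yt].
  have h1 : k * t + - (k * x) <= 0 by nra.
  have h2 : k * t + (2 - k * y) <= 0 by nra.
  by rewrite /cutoff /cutoff' !step0// !tent_eq0 ?h1 ?h2// !mulr0 !subrr.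
have h1 : 2 <= k * t + - (k * x) by nra.
have h2 : 2 <= k * t + (2 - k * y) by nra.
by rewrite /cutoff /cutoff' !step1// !tent_eq0 ?h1 ?h2 ?orbT// !mulr0 !subrr.
Qed.

Lemma test_function_cutoff {R : realType} (V : set R) (k x y : R) :
  0 < k -> 2 <= k * (y - x) -> `[x, y] `<=` V -> test_function V (cutoff k x y).
Proof.
move=> k0 kyx xyV; split.
- by move=> t; have [] := is_derive_cutoff k x y t.
- by rewrite derive1_cutoff; exact: continuous_cutoff'.
- exists `[x, y]%classic; split=> //; first exact: segment_compact.
  move=> t; rewrite /= in_itv/= => /negP; rewrite negb_and -!ltNge => H.
  have [|-> //] := cutoff_out k x y t k0 kyx.
  by case/orP: H => /ltW ->; rewrite ?orbT.
Qed.

Lemma approximate_identity {R : realType} (a b c e : R) (f m : R -> R) :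
  {within `[a, b], continuous f} -> continuous m -> (forall t, 0 <= m t) ->
  \int[lebesgue]_(t in `[a, b]) m t = 1 ->
  (forall t, a <= t -> t <= b -> m t != 0 -> `|f t - f c| <= e) ->
  `|\int[lebesgue]_(t in `[a, b]) (f t * m t) - f c| <= e.
Proof.
move=> cf cm m0 m1 fe.
have mi : integrable_on `[a, b] m.
  apply: continuous_compact_integrable; first exact: segment_compact.
  exact: continuous_subspaceT.
have fmi : integrable_on `[a, b] (fun t => f t * m t).
  have [M _ HM] := segment_bounded _ _ _ cf.
  apply: (integrable_onM_bounded _ M) => //.
    exact: subspace_continuous_measurable_fun.
  by move=> x /=; rewrite in_itv/= => /andP[]; exact: HM.
have di : integrable_on `[a, b] (fun t => f t * m t - f c * m t).
  by apply: integrable_onB => //; exact: integrable_onZ.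
rewrite -[X in _ - X]mulr1 -m1 -RintegralZl// -RintegralB//; last exact: integrable_onZ.
apply: le_trans (le_normr_Rintegral _ di) _ => //.
rewrite -[leRHS]mulr1 -m1 -RintegralZl//; apply: le_Rintegral => //.
- exact: integrable_norm.
- exact: integrable_onZ.
move=> t /=; rewrite in_itv/= => /andP[at_ tb].
rewrite -mulrBl normrM (ger0_norm (m0 t)).
have [->|mt] := eqVneq (m t) 0; first by rewrite !mulr0.
by rewrite ler_wpM2r// fe.
Qed.

Lemma integrable_on_patch {R : realType} (D E : set R) (f : R -> R) :
  measurable_set D -> measurable_set E ->
  integrable_on D f -> integrable_on E (f \_ D).
Proof.
move=> mD mE fi; apply: (integrable_onS _ setT) => //.
have := (@integrable_mkcond _ (measurableTypeR R) R lebesgue D (EFin \o f) mD).1 fi.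
by rewrite restrict_EFin.
Qed.

Lemma Rintegral_itvcc_oo {R : realType} (x y : R) (f : R -> R) :
  integrable_on `[x, y] f ->
  \int[lebesgue]_(t in `[x, y]) f t = \int[lebesgue]_(t in `]x, y[) f t.
Proof.
move=> fi; rewrite Rintegral_itv_bndo_bndc; last first.
  by apply: integrableS fi => //; exact: subset_itv_oo_cc.
rewrite Rintegral_itv_obnd_cbnd//.
by apply: integrableS fi => //; exact: subset_itv_oc_cc.
Qed.

Lemma Rintegral_tent_affine {R : realType} (k c x y : R) : x <= y ->
  k * x + c <= 0 -> 2 <= k * y + c ->
  \int[lebesgue]_(t in `[x, y]) (k * tent (k * t + c)) = 1.
Proof.
move=> xy kx ky.
have d (t : R) : is_derive t 1 (fun u => step (k * u + c)) (k * tent (k * t + c)).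
  exact/is_derive_affine/is_derive_step.
have [] := primitive_on_C1 `[x, y] _ _ d (continuous_tent_affine k c) x y xy.
  by [].
by move=> _ <-; rewrite step1// step0// subr0.
Qed.

(** The cut-offs of [`[x, y]] are admissible test functions that converge to the
indicator function of the segment, while their derivatives converge to the
difference of the Dirac masses at [x] and [y].  A continuous function thus
satisfies the fundamental theorem of calculus with its weak derivative. *)
Lemma weak_derivative_primitive {R : realType} (V : set R) (f g : R -> R) :
  (forall x, V x -> {for x, continuous f}) ->
  (forall x y, `[x, y] `<=` V -> integrable_on `[x, y] g) ->
  is_weak_derivative V f g -> primitive_on V f g.
Proof.
move=> cf gi fg x y; rewrite le_eqVlt => /predU1P[<-|xy] xyV.
  split; first exact: gi.
  by rewrite set_itv1 Rintegral_set1 subrr.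
have gxy := gi _ _ xyV; split=> //.
have cfxy : {within `[x, y], continuous f}.
  by apply: continuous_in_subspaceT => t; rewrite inE => /xyV; exact: cf.
have xx : x <= x <= y by rewrite lexx ltW.
have yy : x <= y <= y by rewrite lexx ltW.
have yx0 : 0 < y - x by rewrite subr_gt0.
pose k n : R := 2 / (y - x) + n%:R.
have k0 n : 0 < k n by rewrite ltr_wpDr// divr_gt0.
have kn n : n%:R < k n by rewrite ltrDr divr_gt0.
have kyx n : 2 <= k n * (y - x).
  by rewrite mulrDl divfK ?gt_eqF// lerDl mulr_ge0// ltW.
have W n : \int[lebesgue]_(t in `[x, y]) (f t * cutoff' (k n) x y t) =
    - \int[lebesgue]_(t in `[x, y]) (g t * cutoff (k n) x y t).
  have := fg _ (test_function_cutoff V _ _ _ (k0 n) (kyx n) xyV).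
  rewrite derive1_cutoff.
  have out t : ~ `[x, y]%classic t -> cutoff (k n) x y t = 0 /\ cutoff' (k n) x y t = 0.
    rewrite /= in_itv/= => /negP; rewrite negb_and -!ltNge => H.
    by apply: cutoff_out => //; case/orP: H => /ltW ->; rewrite ?orbT.
  rewrite (Rintegral_eq_support V `[x, y]); last 2 first.
  - by move=> t _ /out[_ ->]; rewrite mulr0.
  - by move=> t /xyV.
  rewrite (Rintegral_eq_support V `[x, y])//.
  - by move=> t _ /out[-> _]; rewrite mulr0.
  - by move=> t /xyV.
have gci n : integrable_on `[x, y] (fun t => g t * cutoff (k n) x y t).
  apply: (eq_integrable_on _ (fun t => cutoff (k n) x y t * g t)) => //.
    by move=> t _; rewrite mulrC.
  apply: (integrable_onM_bounded _ 1) => //.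
    apply: subspace_continuous_measurable_fun => //.
    exact/continuous_subspaceT/continuous_cutoff.
  by move=> t _; exact: cutoff_le1.
have C1 : (fun n => \int[lebesgue]_(t in `[x, y]) (g t * cutoff (k n) x y t)) @ \oo
    --> \int[lebesgue]_(t in `[x, y]) g t.
  rewrite Rintegral_itvcc_oo//; under eq_fun do rewrite Rintegral_itvcc_oo//.
  have sub : `]x, y[ `<=` `[x, y] by exact: subset_itv_oo_cc.
  apply: (Rintegral_dominated_cvg _ _ _ (fun t => `|g t|)) => //.
  - move=> n; apply: integrable_on_measurable.
    by apply: integrable_onS sub (gci n); exact: measurable_set_itv.
  - move=> t /=; rewrite in_itv/= => /andP[xt ty].
    apply: cvg_near_cst; near=> n.
    have h1 : 2 / (t - x) < n%:R by near: n; exact: nbhs_infty_gtr.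
    have h2 : 2 / (y - t) < n%:R by near: n; exact: nbhs_infty_gtr.
    have := lt_trans h1 (kn n); rewrite ltr_pdivrMr ?subr_gt0// => {}h1.
    have := lt_trans h2 (kn n); rewrite ltr_pdivrMr ?subr_gt0// => {}h2.
    rewrite /cutoff step1 ?step0 ?subr0 ?mulr1//; lra.
  - apply: integrable_norm; apply: integrable_onS sub gxy => //; exact: measurable_set_itv.
  - by move=> n t _; rewrite normrM ler_piMr// cutoff_le1.
have C2 : (fun n => \int[lebesgue]_(t in `[x, y]) (f t * cutoff' (k n) x y t)) @ \oo
    --> f x - f y.
  apply/cvgrPdist_le => e e0.
  have e2 : 0 < e / 2 by rewrite divr_gt0.
  have [d1 d10 H1] := within_continuous_dist _ _ _ _ _ cfxy xx e2.
  have [d2 d20 H2] := within_continuous_dist _ _ _ _ _ cfxy yy e2.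
  near=> n.
  have h1 : 2 / d1 < n%:R by near: n; exact: nbhs_infty_gtr.
  have h2 : 2 / d2 < n%:R by near: n; exact: nbhs_infty_gtr.
  have := lt_trans h1 (kn n); rewrite ltr_pdivrMr// => {}h1.
  have := lt_trans h2 (kn n); rewrite ltr_pdivrMr// => {}h2.
  have kn0 := k0 n; have kyxn := kyx n.
  pose b c t := k n * tent (k n * t + c).
  have b0 c t : 0 <= b c t by rewrite mulr_ge0 ?tent_ge0// ltW.
  have fbi c : integrable_on `[x, y] (fun t => f t * b c t).
    have [M _ HM] := segment_bounded _ _ _ cfxy.
    apply: (integrable_onM_bounded _ M) => //.
    + exact: subspace_continuous_measurable_fun.
    + by move=> t /=; rewrite in_itv/= => /andP[]; exact: HM.
    + apply: continuous_compact_integrable; first exact: segment_compact.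
      exact/continuous_subspaceT/continuous_tent_affine.
  have bE c t : b c t != 0 -> 0 < k n * t + c < 2.
    apply: contraNT; rewrite negb_and -!leNgt => H.
    by rewrite /b tent_eq0// mulr0.
  have A1 : `|\int[lebesgue]_(t in `[x, y]) (f t * b (- (k n * x)) t) - f x| <= e / 2.
    apply: approximate_identity => //; first exact: continuous_tent_affine.
      by apply: Rintegral_tent_affine; [exact: ltW | lra | lra].
    move=> t xt ty /bE/andP[t1 t2]; apply: H1 => //.
    rewrite ger0_norm ?subr_ge0//; nra.
  have A2 : `|\int[lebesgue]_(t in `[x, y]) (f t * b (2 - k n * y) t) - f y| <= e / 2.
    apply: approximate_identity => //; first exact: continuous_tent_affine.
      by apply: Rintegral_tent_affine; [exact: ltW | lra | lra].
    move=> t xt ty /bE/andP[t1 t2]; apply: H2 => //.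
    rewrite ler0_norm ?subr_le0//; nra.
  have -> : \int[lebesgue]_(t in `[x, y]) (f t * cutoff' (k n) x y t) =
      \int[lebesgue]_(t in `[x, y]) (f t * b (- (k n * x)) t) -
      \int[lebesgue]_(t in `[x, y]) (f t * b (2 - k n * y) t).
    by rewrite -RintegralB//; apply: eq_Rintegral => t _; rewrite -mulrBr.
  move: A1 A2; rewrite !ler_norml => /andP[? ?] /andP[? ?].
  by apply/andP; split; lra.
rewrite (funext W) in C2.
have E1 := cvg_lim (@Rhausdorff R) C2.
have E2 := cvg_lim (@Rhausdorff R) (cvgN C1).
by apply: oppr_inj; rewrite opprB -E1 -E2.
Unshelve. all: by end_near. Qed.


(** The converse: the product of a primitive with a test function is, near every
point of the line, a primitive of the expected function, either because the
point lies in [V] and the product rule applies, or because the test function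
vanishes around it.  [cousin] glues this together without any knowledge of
the components of [V]. *)
Lemma primitive_weak_derivative {R : realType} (V : set R) (f g : R -> R) :
  open V -> integrable_on V g -> primitive_on V f g -> is_weak_derivative V f g.
Proof.
move=> oV gi fg phi [dphi cphi [K [cK KV phi0]]].
have mV : measurable_set V by exact: open_measurable.
have dphi' (t : R) : is_derive t 1 phi (derive1 phi t).
  by rewrite derive1E; exact/derivableP.
have oK : open (~` K) by apply: closed_openC; exact: compact_closed (@Rhausdorff R) cK.
have dphi0 t : ~ K t -> derive1 phi t = 0.
  move=> Kt; rewrite derive1E -(derive_cst (0 : R) t 1).
  apply: near_eq_derive.
  by have := open_nbhs_nbhs (conj oK Kt); apply: filterS => s Ks; rewrite phi0.
pose h t := f t * phi t.
pose w t := g t * phi t + f t * derive1 phi t.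
have cfphi' : continuous (fun t => f t * derive1 phi t).
  move=> t; have [Vt|Vt] := pselect (V t).
    apply: cvgM; last exact: cphi.
    exact: primitive_on_continuous_at oV fg Vt.
  have Kt : ~ K t by move=> /KV.
  rewrite /continuous_at dphi0// mulr0; apply: cvg_near_cst.
  by have := open_nbhs_nbhs (conj oK Kt); apply: filterS => s Ks; rewrite dphi0 ?mulr0.
have [M [_ KM]] := compact_bounded cK.
pose c := Num.max 0 (M + 1) + 1.
have Kc t : K t -> - c < t < c.
  move=> Kt; rewrite -ltr_norml; have : M < Num.max 0 (M + 1).
    by rewrite lt_max ltrDl ltr01 orbT.
  by move=> /KM/(_ t Kt)/le_lt_trans; apply; rewrite ltrDl.
have c0 : 0 <= c by rewrite addr_ge0// le_max lexx.
have ccc : - c <= c by lra.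
have fphi'i : integrable_on `[- c, c] (fun t => f t * derive1 phi t).
  apply: continuous_compact_integrable; first exact: segment_compact.
  exact: continuous_subspaceT.
have cphi0 : continuous phi.
  by move=> t; apply/differentiable_continuous/derivable1_diffP.
have gphii : integrable_on `[- c, c] (fun t => g t * phi t).
  have cphic : {within `[- c, c], continuous phi} by exact: continuous_subspaceT.
  have [B _ HB] := segment_bounded _ _ _ cphic.
  apply: (eq_integrable_on _ (fun t => phi t * (g \_ V) t)) => //.
    move=> t _; rewrite patchE mulrC; case: ifPn => //; rewrite notin_setE => Vt.
    by rewrite phi0 ?mulr0// => /KV.
  apply: (integrable_onM_bounded _ B) => //.
  - exact: subspace_continuous_measurable_fun.
  - by move=> t /=; rewrite in_itv/= => /andP[]; exact: HB.
  - by apply: integrable_on_patch => //; exact: measurable_set_itv.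
have wi : integrable_on `[- c, c] w by apply: integrable_onD.
pose P x y := h y - h x = \int[lebesgue]_(t in `[x, y]) w t.
have hw : P (- c) c.
  apply: cousin => //.
    move=> x y z cx xy yz zc Pxy Pyz.
    rewrite /P (Rintegral_itv_cat x y z)//; last exact: integrable_itvS wi.
    by rewrite -Pxy -Pyz; ring.
  move=> z _; have [Vz|Vz] := pselect (V z).
    have /nbhs_ballP[d /= d0 zd] : nbhs z V by exact: open_nbhs_nbhs.
    exists d => // x y _ xz zy _ xyd.
    have xyV : `[x, y] `<=` V.
      move=> t /=; rewrite in_itv/= => /andP[xt ty]; apply: zd.
      rewrite /ball/= ltr_distlC; apply/andP; split; lra.
    have phiV : primitive_on V phi (derive1 phi) by exact: primitive_on_C1.
    by have [] := primitive_onM _ _ _ _ _ fg phiV x y (le_trans xz zy) xyV.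
  have Kz : (~` K) z by move=> /KV.
  have /nbhs_ballP[d /= d0 zd] : nbhs z (~` K) by exact: open_nbhs_nbhs.
  exists d => // x y _ xz zy _ xyd.
  have xyK t : x <= t -> t <= y -> ~ K t.
    move=> xt ty; apply: zd.
    rewrite /ball/= ltr_distlC; apply/andP; split; lra.
  have xy := le_trans xz zy.
  rewrite /P /h !phi0 ?mulr0 ?subrr; [|exact: xyK..].
  rewrite (eq_Rintegral_on _ _ (fun=> 0)); first by rewrite Rintegral_cst//= mul0r.
  move=> t; rewrite /= in_itv/= => /andP[xt ty].
  by rewrite /w phi0 ?dphi0 ?mulr0 ?addr0//; exact: xyK.
have hc t : ~ (- c < t < c) -> h t = 0 by move=> tc; rewrite /h phi0 ?mulr0// => /Kc.
move: hw; rewrite /P !hc ?ltxx ?andbF// subrr RintegralD// => /esym/eqP.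
rewrite addrC addr_eq0 => /eqP.
rewrite (Rintegral_eq_support V `[- c, c]); last 2 first.
- move=> t _; rewrite /= in_itv/= => tc; rewrite dphi0 ?mulr0// => /Kc/andP[t1 t2].
  by apply: tc; rewrite !ltW.
- by move=> t _ Vt; rewrite dphi0 ?mulr0// => /KV.
move=> ->; congr (- _); apply: Rintegral_eq_support.
- by move=> t _ Vt; rewrite phi0 ?mulr0// => /KV.
- move=> t _; rewrite /= in_itv/= => tc; rewrite phi0 ?mulr0// => /Kc/andP[t1 t2].
  by apply: tc; rewrite !ltW.
Qed.

Lemma wderivP {R : realType} (U : set R) (f : R -> R) :
  H1 U f -> L2 U (wderiv U f) /\ is_weak_derivative U f (wderiv U f).
Proof.
move=> [_ [g Hg]].
exact: (@xgetPex _ (fun=> 0) [set g | L2 U g /\ is_weak_derivative U f g]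
  (ex_intro _ g Hg)).
Qed.

Lemma ae_imply {R : realType} (P Q : R -> Prop) :
  (forall x, P x -> Q x) -> {ae @lebesgue_measure R, forall x, P x} ->
  {ae @lebesgue_measure R, forall x, Q x}.
Proof.
move=> PQ; apply: filterS; first exact: (ae_filter_ringOfSetsType lebesgue).
exact: PQ.
Qed.

(** Du Bois-Reymond: both densities integrate to the same increments of [f], and
an integrable function is almost everywhere the derivative of its integral. *)
Lemma primitive_on_unique {R : realType} (V : set R) (f g1 g2 : R -> R) :
  open V -> integrable_on V g1 -> integrable_on V g2 ->
  primitive_on V f g1 -> primitive_on V f g2 ->
  {ae lebesgue, forall x, V x -> g1 x = g2 x}.
Proof.
move=> oV g1i g2i fg1 fg2.
have mV : measurable_set V by exact: open_measurable.
pose h := (fun x => g1 x - g2 x) \_ V.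
have hi : integrable_on setT h.
  by apply: integrable_on_patch => //; exact: integrable_onB.
have hiS D : measurable_set D -> integrable_on D h.
  by move=> mD; apply: integrable_onS hi.
have hloc : locally_integrable [set: R] h.
  by apply: integrable_locally_restrict => //; exact: integrable_onB.
have := FTC1Ny (fun y => hiS _ (measurable_set_itv `]-oo, y])) hloc.
apply: ae_imply => x [_ Fx] Vx; apply/eqP; rewrite -subr_eq0; apply/eqP.
have -> : g1 x - g2 x = h x by rewrite /h patchE mem_set.
rewrite -Fx derive1E -(derive_cst
  (\int[lebesgue]_(t in `]-oo, x]) h t) x 1).
apply: near_eq_derive.
have /nbhs_ballP[d /= d0 xd] : nbhs x V by exact: open_nbhs_nbhs.
have h0 p q : p <= q -> `[p, q] `<=` V -> \int[lebesgue]_(t in `[p, q]) h t = 0.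
  move=> pq pqV; have [g1pq E1] := fg1 p q pq pqV; have [g2pq E2] := fg2 p q pq pqV.
  rewrite (eq_Rintegral_on _ _ (fun t => g1 t - g2 t)).
    by rewrite RintegralB// -E1 -E2 subrr.
  by move=> t /pqV Vt; rewrite /h patchE mem_set.
have cat p q : p <= q -> `[p, q] `<=` V ->
    \int[lebesgue]_(t in `]-oo, q]) h t = \int[lebesgue]_(t in `]-oo, p]) h t.
  move=> pq pqV.
  have := @Rintegral_itvB R h -oo%O (BRight q) p (hiS _ (measurable_set_itv _)).
  rewrite !bnd_simp => /(_ isT pq) E.
  apply/eqP; rewrite -subr_eq0 E Rintegral_itv_obnd_cbnd; first by rewrite h0.
  by apply: hiS; exact: measurable_set_itv.
apply/nbhs_ballP; exists d => // y xyd.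
have sub p q : ball x d p -> ball x d q -> `[p, q] `<=` V.
  rewrite /ball/= !ltr_distlC => /andP[p1 p2] /andP[q1 q2] t /=.
  rewrite in_itv/= => /andP[pt tq]; apply: xd; rewrite /ball/= ltr_distlC.
  by apply/andP; split; lra.
have xx : ball x d x by exact: ballxx.
by have [xy|/ltW yx] := leP x y; [apply: cat => //; exact: sub | apply/esym/cat => //; exact: sub].
Qed.

(** * Square-integrable functions *)

Definition square_integrable {R : realType} (D : set R) (f : R -> R) :=
  measurable_on D f /\ integrable_on D (fun x => f x ^+ 2).

Lemma L2P {R : realType} (U : set R) (f : R -> R) :
  measurable_set U -> L2 U f <-> square_integrable U f.
Proof.
move=> mU; rewrite /L2; split=> [fL|[mf fi]].
  have sq := Lfun2_integrable_sqr fL.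
  have mf : measurable_fun setT (f \_ U : measurableTypeR R -> R).
    by move: fL; rewrite inE => /andP[]; rewrite inE.
  split; first exact/(measurable_restrictT _ mU).
  apply: (eq_integrable_on _ (fun x => (f \_ U) x ^+ 2)) => //.
    by move=> x Ux; rewrite patchE mem_set.
  exact: integrable_onS sq.
rewrite inE; apply/andP; split; rewrite inE/=.
  exact/(measurable_restrictT _ mU).
rewrite /finite_norm unlock/= poweR_lty//.
have pi : integrable_on setT ((fun x => f x ^+ 2) \_ U).
  exact: integrable_on_patch.
have /integrableP[_ lty] := pi; apply: le_lt_trans lty.
apply: ge0_le_integral => //.
- apply/measurable_EFinP.
  apply: (measurableT_comp (measurable_powR _)); apply: measurableT_comp => //.
  exact/(measurable_restrictT _ mU).
- apply: measurableT_comp => //; apply/measurable_EFinP/(measurable_restrictT _ mU).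
  exact: measurable_funX.
move=> x _ /=; rewrite lee_fin powR_mulrn// real_normK ?num_real// !patchE.
by case: ifPn; [rewrite ger0_norm ?sqr_ge0 | rewrite expr0n/= normr0].
Qed.

Lemma square_integrableS {R : realType} (D E : set R) (f : R -> R) :
  measurable_set D -> measurable_set E -> D `<=` E ->
  square_integrable E f -> square_integrable D f.
Proof.
move=> mD mE DE [mf fi]; split; first exact: measurable_funS mf.
exact: integrable_onS fi.
Qed.

Lemma square_integrableZ {R : realType} (D : set R) (k : R) (f : R -> R) :
  measurable_set D -> square_integrable D f ->
  square_integrable D (fun x => k * f x).
Proof.
move=> mD [mf fi]; split; first exact: measurable_funM.
apply: (eq_integrable_on _ (fun x => k ^+ 2 * f x ^+ 2)) => //.
  by move=> x _; rewrite exprMn.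
exact: integrable_onZ.
Qed.

Lemma square_integrableD {R : realType} (D : set R) (f g : R -> R) :
  measurable_set D -> square_integrable D f -> square_integrable D g ->
  square_integrable D (fun x => f x + g x).
Proof.
move=> mD [mf fi] [mg gi]; split; first exact: measurable_funD.
apply: (le_integrable_on _ _ (fun x => 2 * f x ^+ 2 + 2 * g x ^+ 2)) => //.
- by apply: measurable_funX; exact: measurable_funD.
- move=> x _; rewrite ger0_norm ?sqr_ge0// -subr_ge0.
  have -> : 2 * f x ^+ 2 + 2 * g x ^+ 2 - (f x + g x) ^+ 2 = (f x - g x) ^+ 2.
    by ring.
  exact: sqr_ge0.
- by apply: integrable_onD => //; exact: integrable_onZ.
Qed.

Lemma square_integrableB {R : realType} (D : set R) (f g : R -> R) :
  measurable_set D -> square_integrable D f -> square_integrable D g ->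
  square_integrable D (fun x => f x - g x).
Proof.
move=> mD fi gi.
have := square_integrableD _ _ _ mD fi (square_integrableZ _ (-1) _ mD gi).
by under eq_fun do rewrite mulN1r.
Qed.

Lemma integrable_onM {R : realType} (D : set R) (f g : R -> R) :
  measurable_set D -> square_integrable D f -> square_integrable D g ->
  integrable_on D (fun x => f x * g x).
Proof.
move=> mD [mf fi] [mg gi].
apply: (le_integrable_on _ _ (fun x => f x ^+ 2 + g x ^+ 2)) => //.
- exact: measurable_funM.
- move=> x _; have h1 := sqr_ge0 (f x - g x); have h2 := sqr_ge0 (f x + g x).
  by rewrite ler_norml; apply/andP; split; nra.
- exact: integrable_onD.
Qed.

Lemma integrable_on_cst {R : realType} (D : set R) (c : R) :
  measurable_set D -> (lebesgue D < +oo)%E -> integrable_on D (fun=> c).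
Proof.
move=> mD Dfin; apply: measurable_bounded_integrable => //.
by exists `|c|; split=> // M cM x _; exact: ltW.
Qed.

Lemma square_integrable_cst {R : realType} (D : set R) (c : R) :
  measurable_set D -> (lebesgue D < +oo)%E -> square_integrable D (fun=> c).
Proof. by move=> mD Dfin; split=> //; exact: integrable_on_cst. Qed.

Lemma square_integrable_integrable {R : realType} (D : set R) (f : R -> R) :
  measurable_set D -> (lebesgue D < +oo)%E ->
  square_integrable D f -> integrable_on D f.
Proof.
move=> mD Dfin fi.
have := integrable_onM _ _ _ mD fi (square_integrable_cst _ 1 mD Dfin).
by under eq_fun do rewrite mulr1.
Qed.

(** The arithmetic-geometric inequality with a free parameter [k] stands in for
the Cauchy-Schwarz inequality. *)
Lemma Rintegral_norm_le {R : realType} (D : set R) (h : R -> R) (k : R) :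
  measurable_set D -> (lebesgue D < +oo)%E -> 0 < k -> square_integrable D h ->
  \int[lebesgue]_(x in D) `|h x| <=
  (k * fine (lebesgue D) + k^-1 * \int[lebesgue]_(x in D) h x ^+ 2) / 2.
Proof.
move=> mD Dfin k0 hsq; have [mh h2] := hsq.
have c1 : integrable_on D (fun=> k) by exact: integrable_on_cst.
have -> : k * fine (lebesgue D) = \int[lebesgue]_(x in D) k.
  by rewrite Rintegral_cst.
rewrite -RintegralZl// -RintegralD//; last exact: integrable_onZ.
rewrite mulrC -RintegralZl//; last by apply: integrable_onD => //; exact: integrable_onZ.
apply: le_Rintegral => //.
- by apply: integrable_norm; exact: square_integrable_integrable.
- by apply: integrable_onZ => //; apply: integrable_onD => //; exact: integrable_onZ.
move=> x _; rewrite -subr_ge0 -[h x ^+ 2](real_normK (num_real (h x))).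
have -> : 2^-1 * (k + k^-1 * `|h x| ^+ 2) - `|h x| = (k - `|h x|) ^+ 2 / (2 * k).
  by field; rewrite gt_eqF.
by rewrite divr_ge0 ?sqr_ge0// mulr_ge0// ltW.
Qed.

Lemma Rintegral_norm_geometric {R : realType} (D : set R) (h : R -> R) (n : nat) :
  measurable_set D -> (lebesgue D < +oo)%E -> square_integrable D h ->
  \int[lebesgue]_(x in D) h x ^+ 2 <= 4^-1 ^+ n ->
  \int[lebesgue]_(x in D) `|h x| <= (fine (lebesgue D) + 1) / 2 * 2^-1 ^+ n.
Proof.
move=> mD Dfin hsq hn.
have p0 : 0 < (2^-1 : R) ^+ n by rewrite exprn_gt0// invr_gt0.
apply: (le_trans (Rintegral_norm_le _ _ _ mD Dfin p0 hsq)).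
rewrite [leRHS]mulrAC ler_wpM2r ?invr_ge0//.
rewrite mulrDl mul1r [_ * fine _]mulrC lerD2l.
rewrite mulrC ler_pdivrMr// (le_trans hn)// -exprMn.
by rewrite (_ : 2^-1 * 2^-1 = 4^-1 :> R)//; field.
Qed.

Lemma Rintegral_le_of_integral {R : realType} (D : set R) (f : R -> R) (c : R) :
  measurable_set D -> measurable_on D f -> (forall x, D x -> 0 <= f x) ->
  (\int[@lebesgue_measure R]_(x in D) (f x)%:E <= c%:E)%E ->
  integrable_on D f /\ \int[lebesgue]_(x in D) f x <= c.
Proof.
move=> mD mf f0 fc.
have fi : integrable_on D f.
  apply/integrableP; split; first exact/measurable_EFinP.
  apply: le_lt_trans (ltry c); apply: le_trans fc; apply: ge0_le_integral => //.
  - by apply: measurableT_comp => //; exact/measurable_EFinP.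
  - exact/measurable_EFinP.
  - by move=> x Dx /=; rewrite ger0_norm// f0.
split=> //; rewrite -lee_fin (le_trans _ fc)// fineK//.
exact: integrable_fin_num.
Qed.

Lemma integral_EFin {R : realType} (D : set R) (f : R -> R) :
  measurable_set D -> integrable_on D f ->
  (\int[@lebesgue_measure R]_(x in D) (f x)%:E)%E =
  (\int[lebesgue]_(x in D) f x)%:E.
Proof. by move=> mD fi; rewrite fineK//; exact: integrable_fin_num. Qed.

Lemma measurable_fun_limn_einf {R : realType} (D : set R)
    (f : nat -> R -> \bar R) :
  measurable_set D -> (forall n, measurable_on D (f n)) ->
  measurable_on D (fun x => limn_einf (f ^~ x)).
Proof.
move=> mD mf.
have -> : (fun x => limn_einf (f ^~ x)) =
    (fun x => - limn_esup (fun n => - f n x))%E.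
  by apply/funext => x; rewrite limn_esupN oppeK.
apply: measurableT_comp => //; apply: measurable_fun_limn_esup => n.
exact: measurableT_comp.
Qed.

(** A sequence that is Cauchy at a geometric rate in [L^2] has a summable
telescoping series almost everywhere; Fatou's lemma turns the Cauchy estimates
into distances to the pointwise limit. *)
Lemma L2_complete {R : realType} (D : set R) (w : nat -> R -> R) :
  measurable_set D -> (lebesgue D < +oo)%E ->
  (forall n, square_integrable D (w n)) ->
  (forall k m, (k <= m)%N ->
    \int[lebesgue]_(x in D) (w k x - w m x) ^+ 2 <= 4^-1 ^+ k) ->
  exists2 f : R -> R, square_integrable D f &
    forall k, \int[lebesgue]_(x in D) (w k x - f x) ^+ 2 <= 4^-1 ^+ k.
Proof.
move=> mD Dfin wi wC.
have mw n : measurable_on D (w n) by case: (wi n).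
pose a n x := `|w n.+1 x - w n x|.
have ai n : square_integrable D (fun x => w n x - w n.+1 x).
  exact: square_integrableB.
have asi n : integrable_on D (a n).
  apply: (eq_integrable_on _ (fun x => `|w n x - w n.+1 x|)) => //.
    by move=> x _; rewrite distrC.
  by apply: integrable_norm; exact: square_integrable_integrable.
pose B := (fine (lebesgue D) + 1) / 2.
have aB n : \int[lebesgue]_(x in D) a n x <= B * 2^-1 ^+ n.
  apply: le_trans (Rintegral_norm_geometric _ _ n mD Dfin (ai n) (wC _ _ (leqnSn n))).
  rewrite le_eqVlt; apply/orP; left; apply/eqP.
  by apply: eq_Rintegral_on => x _; rewrite /a distrC.
have B0 : 0 <= B by rewrite divr_ge0// addr_ge0// fine_ge0.
pose G n x := \sum_(k < n) a k x.
have Gi n : integrable_on D (G n).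
  elim: n => [|n IH].
    apply: (eq_integrable_on _ (fun=> 0)) => //; last exact: integrable0.
    by move=> x _; rewrite /G big_ord0.
  apply: (eq_integrable_on _ (fun x => G n x + a n x)) => //.
    by move=> x _; rewrite /G big_ord_recr.
  exact: integrable_onD.
have GB n : \int[lebesgue]_(x in D) G n x <= 2 * B * (1 - 2^-1 ^+ n).
  elim: n => [|n IH].
    rewrite expr0 subrr mulr0 (eq_Rintegral_on _ _ (fun=> 0)).
      by rewrite Rintegral_cst// mul0r.
    by move=> x _; rewrite /G big_ord0.
  rewrite (eq_Rintegral_on _ _ (fun x => G n x + a n x)); last first.
    by move=> x _; rewrite /G big_ord_recr.
  rewrite RintegralD// (le_trans (lerD IH (aB n)))// le_eqVlt; apply/orP; left.
  by apply/eqP; rewrite exprS; field.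
have G2B n : \int[lebesgue]_(x in D) G n x <= 2 * B.
  apply: (le_trans (GB n)); apply: ler_piMr; first exact: mulr_ge0.
  by rewrite lerBlDr lerDl exprn_ge0.
have G0 n x : 0 <= G n x by apply: sumr_ge0 => k _; exact: normr_ge0.
have mG n : measurable_on D (G n) by exact: integrable_on_measurable.
have mEG n : measurable_on D (fun x => (G n x)%:E) by exact/measurable_EFinP.
(* Fatou's lemma makes [H] integrable, hence finite almost everywhere. *)
pose H x := limn_einf (fun n => (G n x)%:E).
have mH : measurable_on D H by exact: measurable_fun_limn_einf mD mEG.
have H0 x : (0 <= H x)%E.
  rewrite /H limn_einf_lim; apply: lime_ge; first exact: is_cvg_einfs.
  apply: nearW => n; apply: le_ereal_inf_tmp => _ [m _ <-].
  by rewrite lee_fin.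
have Hi : lebesgue.-integrable D H.
  apply/integrableP; split=> //.
  apply: le_lt_trans (ltry (2 * B)).
  have -> : (fun x => `|H x|%E) = H by apply/funext => x; rewrite gee0_abs.
  have /le_trans := @fatou _ _ R lebesgue D mD (fun n x => (G n x)%:E) mEG
    (fun n x _ => G0 n x).
  apply; rewrite limn_einf_lim; apply: lime_le; first exact: is_cvg_einfs.
  apply: nearW => n; apply: le_trans (ereal_inf_lbound _) _.
    by exists n => //=.
  by rewrite /= integral_EFin// lee_fin.
have wcvg : {ae lebesgue, forall x, D x -> cvgn (w ^~ x)}.
  have := integrable_ae mD Hi.
  apply: ae_imply => x Hx Dx; have {}Hx := Hx Dx.
  have Gnd : {homo G ^~ x : n m / (n <= m)%N >-> n <= m}.
    apply/nondecreasing_seqP => n; rewrite /G big_ord_recr/= lerDl; exact: normr_ge0.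
  have GH n : G n x <= fine (H x).
    rewrite -lee_fin fineK// /H limn_einf_lim.
    apply: lime_ge; first exact: is_cvg_einfs.
    exists n => // m /= nm; apply: le_ereal_inf_tmp => _ [p /= mp <-].
    by rewrite lee_fin; apply: Gnd; exact: leq_trans mp.
  pose u n := w n.+1 x - w n x.
  have : cvgn (series u).
    apply: (@normed_cvg R R^o); apply: nondecreasing_is_cvgn.
      apply/nondecreasing_seqP => n; rewrite /normed_series_of seriesSr lerDl.
      exact: normr_ge0.
    exists (fine (H x)) => _ [n _ <-]; apply: le_trans (GH n).
    by rewrite /normed_series_of seriesEord.
  have -> : series u = (fun n => w n x - w 0%N x).
    by apply/funext => n; rewrite /series/= telescope_sumr.
  move=> /cvg_ex[l ul]; apply/cvg_ex; exists (l + w 0%N x).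
  have -> : w ^~ x = (fun n => (w n x - w 0%N x) + w 0%N x).
    by apply/funext => n; rewrite subrK.
  by apply: cvgD => //; exact: cvg_cst.
pose f x := fine (limn_esup (fun n => (w n x)%:E)).
have mf : measurable_on D f.
  apply: (measurableT_comp (fine_measurable measurableT)).
  by apply: measurable_fun_limn_esup => n; exact/measurable_EFinP.
have fP x : cvgn (w ^~ x) -> w ^~ x @ \oo --> f x.
  move=> /cvg_ex[l wl]; suff -> : f x = l by [].
  rewrite /f limn_esup_lim (@cvg_lim _ _ _ _ _ _ l%:E)//.
  by apply: cvg_esups; apply: cvg_EFin => //; exact: nearW.
have wf k : integrable_on D (fun x => (w k x - f x) ^+ 2) /\
    \int[lebesgue]_(x in D) (w k x - f x) ^+ 2 <= 4^-1 ^+ k.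
  apply: Rintegral_le_of_integral => //.
  - by apply: measurable_funX; exact: measurable_funB.
  - by move=> x _; exact: sqr_ge0.
  have mwm m : measurable_on D (fun x => ((w k x - w m x) ^+ 2)%:E).
    by apply/measurable_EFinP/measurable_funX; exact: measurable_funB.
  rewrite (@ae_eq_integral _ _ R lebesgue D
    (fun x => limn_einf (fun m => ((w k x - w m x) ^+ 2)%:E))) //; last 3 first.
  - by apply/measurable_EFinP/measurable_funX; exact: measurable_funB.
  - exact: measurable_fun_limn_einf mD mwm.
  - move: wcvg; apply: ae_imply => x + Dx => /(_ Dx)/fP wfx.
    rewrite limn_einf_lim (@cvg_lim _ _ _ _ _ _ ((w k x - f x) ^+ 2)%:E)//.
    apply: cvg_einfs; apply: cvg_EFin; first exact: nearW.
    apply: (@continuous_cvg _ _ _ _ _ _ (fun z => (w k x - z) ^+ 2)) => //.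
    by apply: cvgM; apply: cvgB; [exact: cvg_cst | exact: cvg_id | exact: cvg_cst | exact: cvg_id].
  have /le_trans := @fatou _ _ R lebesgue D mD (fun m x => ((w k x - w m x) ^+ 2)%:E) mwm
    (fun m x _ => sqr_ge0 _).
  apply; rewrite limn_einf_lim; apply: lime_le; first exact: is_cvg_einfs.
  exists k => // m /= km; apply: le_trans (ereal_inf_lbound _) _.
    by exists m => //=.
  have [_ sqi] := square_integrableB _ _ _ mD (wi k) (wi m).
  by rewrite /= integral_EFin// lee_fin wC.
exists f; last by move=> k; case: (wf k).
have wfi : square_integrable D (fun x => w 0%N x - f x).
  by split; [exact: measurable_funB | case: (wf 0%N)].
have := square_integrableB _ _ _ mD (wi 0%N) wfi.
by under eq_fun do rewrite subKr.
Qed.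

Lemma Rintegral_sqr_midpoint {R : realType} (D : set R) (f g : R -> R) :
  measurable_set D -> square_integrable D f -> square_integrable D g ->
  \int[lebesgue]_(x in D) (f x - g x) ^+ 2 =
  2 * \int[lebesgue]_(x in D) f x ^+ 2 + 2 * \int[lebesgue]_(x in D) g x ^+ 2
  - 4 * \int[lebesgue]_(x in D) ((f x + g x) / 2) ^+ 2.
Proof.
move=> mD fi gi.
have [_ mi] : square_integrable D (fun x => (f x + g x) / 2).
  have := square_integrableZ _ 2^-1 _ mD (square_integrableD _ _ _ mD fi gi).
  by under eq_fun do rewrite mulrC.
have [_ f2] := fi; have [_ g2] := gi.
rewrite -!RintegralZl// -RintegralD//; [|exact: integrable_onZ..].
rewrite -RintegralB//; [|apply: integrable_onD => //|]; try exact: integrable_onZ.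
by apply: eq_Rintegral_on => x _; field.
Qed.

(** This plays the part of weak compactness in [L^2].  Each [C n] contains an
element whose norm is nearly minimal; the parallelogram identity makes
such elements a Cauchy sequence, because the minima increase to a finite limit
and midpoints stay in [C n].  When [C n] consists of means of the tail of
a bounded sequence, this gives means that converge strongly. *)
Lemma L2_midpoint_compact {R : realType} (D : set R) (C : nat -> set (R -> R))
    (M : R) :
  measurable_set D -> (lebesgue D < +oo)%E ->
  (forall n f, C n f -> square_integrable D f) ->
  (forall n f, C n f -> \int[lebesgue]_(x in D) f x ^+ 2 <= M) ->
  (forall n, C n !=set0) ->
  (forall n m, (n <= m)%N -> C m `<=` C n) ->
  (forall n f g, C n f -> C n g -> C n (fun x => (f x + g x) / 2)) ->
  exists (v : nat -> R -> R) (f : R -> R),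
    [/\ forall n, C n (v n), square_integrable D f &
        forall n, \int[lebesgue]_(x in D) (v n x - f x) ^+ 2 <= 4^-1 ^+ n].
Proof.
move=> mD Dfin Csq CM Cne Cdec Cmid.
have arith (a b c ek em s : R) : s - ek <= c -> a < s + ek -> b < s + em ->
    em <= ek -> 2 * a + 2 * b - 4 * c <= 8 * ek by lra.
pose I (f : R -> R) := \int[lebesgue]_(x in D) f x ^+ 2.
pose d n := inf [set I f | f in C n].
have lb n : lbound [set I f | f in C n] 0.
  by move=> _ [f _ <-]; apply: Rintegral_ge0 => x _; exact: sqr_ge0.
have hi n : has_inf [set I f | f in C n].
  by split; [have [f Cf] := Cne n; exists (I f), f | exists 0].
have dI n f : C n f -> d n <= I f.
  by move=> Cf; apply: (inf_lbound (proj2 (hi n))); exists f.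
have dM n : d n <= M.
  by have [f Cf] := Cne n; apply: le_trans (dI n f Cf) (CM n f Cf).
have dmon n m : (n <= m)%N -> d n <= d m.
  move=> nm; apply: lb_le_inf; first by case: (hi m).
  by move=> _ [f Cf <-]; apply: dI; exact: Cdec Cf.
pose l := sup (range d).
have hs : has_sup (range d) by split; [exists (d 0%N), 0%N | exists M => _ [n _ <-]].
have dl n : d n <= l by apply: (sup_upper_bound hs); exists n.
pose eta k : R := 4^-1 ^+ k / 8.
have eta0 k : 0 < eta k by rewrite divr_gt0// exprn_gt0.
have /choice[p pP] : forall k, exists q : nat * (R -> R),
    [/\ (k <= q.1)%N, C q.1 q.2, l - eta k < d q.1 & I q.2 < l + eta k].
  move=> k.
  have [_ [n _ <-] ln] := sup_adherent (eta0 k) hs.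
  pose m := maxn k n.
  have [_ [f Cf <-] fI] := inf_adherent (eta0 k) (hi m).
  exists (m, f) => /=; split=> //; first exact: leq_maxl.
    by apply: lt_le_trans ln _; apply: dmon; exact: leq_maxr.
  by apply: lt_le_trans fI _; rewrite lerD2r dl.
pose w k := (p k).2.
have wsq k : square_integrable D (w k) by have [_ /Csq] := pP k.
have wC k m : (k <= m)%N ->
    \int[lebesgue]_(x in D) (w k x - w m x) ^+ 2 <= 4^-1 ^+ k.
  move=> km; rewrite Rintegral_sqr_midpoint//.
  have [k1 Ck dk Ik] := pP k; have [m1 Cm dm Im] := pP m.
  pose q := minn (p k).1 (p m).1.
  have etakm : eta m <= eta k.
    rewrite ler_pM2r ?invr_gt0//; apply: ler_wiXn2l => //.
    by rewrite invf_le1// ler1n.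
  have Cq : C q (fun x => (w k x + w m x) / 2).
    apply: Cmid; [apply: Cdec Ck; exact: geq_minl | apply: Cdec Cm; exact: geq_minr].
  have dq : l - eta k <= d q.
    rewrite /q; case: leqP => _; first exact: ltW.
    by apply: le_trans (ltW dm); rewrite lerB.
  have mid := le_trans dq (dI q _ Cq).
  have -> : 4^-1 ^+ k = 8 * eta k by rewrite /eta; field.
  exact: arith mid Ik Im etakm.
have [f fsq fP] := L2_complete D w mD Dfin wsq wC.
exists w, f; split=> // n.
by have [np Cp _ _] := pP n; apply: Cdec Cp.
Qed.

(** * Weak convergence in H^1 *)

Lemma H1_primitive {R : realType} (V : set R) (f g : R -> R) :
  open V -> (lebesgue V < +oo)%E -> square_integrable V f ->
  square_integrable V g -> primitive_on V f g -> H1 V f.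
Proof.
move=> oV Vfin fsq gsq fg.
have mV : measurable_set V by exact: open_measurable.
split; first exact/L2P.
exists g; split; first exact/L2P.
by apply: primitive_weak_derivative => //; exact: square_integrable_integrable.
Qed.

(** Reduces the chosen weak derivative of a continuous function to the fundamental
theorem of calculus. *)
Lemma wderiv_primitive {R : realType} (V : set R) (f : R -> R) :
  open V -> (lebesgue V < +oo)%E -> (forall x, V x -> {for x, continuous f}) ->
  H1 V f -> square_integrable V (wderiv V f) /\ primitive_on V f (wderiv V f).
Proof.
move=> oV Vfin cf fH.
have mV : measurable_set V by exact: open_measurable.
have [/(L2P _ _ mV) wsq wd] := wderivP _ _ fH.
split=> //; apply: weak_derivative_primitive => // x y xyV.
apply: (integrable_onS _ V _ (measurable_set_itv _) mV xyV).
exact: square_integrable_integrable.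
Qed.

(** The chosen weak derivative in the norm may be replaced by any density, by
uniqueness almost everywhere. *)
Lemma H1norm_primitive {R : realType} (V : set R) (f g : R -> R) :
  open V -> (lebesgue V < +oo)%E -> square_integrable V f ->
  square_integrable V g -> primitive_on V f g ->
  H1norm V f = Num.sqrt (\int[lebesgue]_(x in V) f x ^+ 2 +
                         \int[lebesgue]_(x in V) g x ^+ 2).
Proof.
move=> oV Vfin fsq gsq fg.
have mV : measurable_set V by exact: open_measurable.
have fH := H1_primitive _ _ _ oV Vfin fsq gsq fg.
have [wsq fw] := wderiv_primitive _ _ oV Vfin
  (fun x => primitive_on_continuous_at _ _ _ x oV fg) fH.
have [_ f2] := fsq; have [mg g2] := gsq; have [mw w2] := wsq.
rewrite /H1norm RintegralD//; congr (Num.sqrt (_ + _)).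
congr fine; apply: (@ae_eq_integral _ (measurableTypeR R) R lebesgue V) => //.
- by apply/measurable_EFinP; exact: measurable_funX.
- by apply/measurable_EFinP; exact: measurable_funX.
have := primitive_on_unique _ _ _ _ oV (square_integrable_integrable _ _ mV Vfin wsq)
  (square_integrable_integrable _ _ mV Vfin gsq) fw fg.
by apply: ae_imply => x wg Vx; rewrite wg.
Qed.

Lemma cvg_expr_half {R : realType} : (fun n => (2^-1 : R) ^+ n) @ \oo --> 0.
Proof.
have := @cvg_geometric R 1 2^-1; rewrite ger0_norm ?invr_ge0// invf_lt1 ?ltr1n//.
move=> /(_ isT); suff -> : geometric 1 2^-1 = (fun n => (2^-1 : R) ^+ n) by [].
by apply/funext => n; rewrite /geometric/= mul1r.
Qed.

Lemma primitive_on_limit {R : realType} (V : set R) (v g : nat -> R -> R)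
    (f h : R -> R) :
  measurable_set V -> (lebesgue V < +oo)%E ->
  (forall n, square_integrable V (g n)) -> square_integrable V h ->
  (forall n, primitive_on V (v n) (g n)) ->
  (forall x, V x -> v ^~ x @ \oo --> f x) ->
  (forall n, \int[lebesgue]_(x in V) (g n x - h x) ^+ 2 <= 4^-1 ^+ n) ->
  primitive_on V f h.
Proof.
move=> mV Vfin gsq hsq vg vf gh x y xy xyV.
have Vx : V x by apply: xyV; rewrite /= in_itv/= lexx.
have Vy : V y by apply: xyV; rewrite /= in_itv/= lexx andbT.
have iS k : square_integrable V k -> integrable_on `[x, y] k.
  move=> ksq; apply: (integrable_onS _ V _ (measurable_set_itv _) mV xyV).
  exact: square_integrable_integrable.
split; first exact: iS.
have L : (fun n => v n y - v n x) @ \oo --> f y - f x by apply: cvgB; exact: vf.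
suff L' : (fun n => v n y - v n x) @ \oo --> \int[lebesgue]_(t in `[x, y]) h t.
  by rewrite -(cvg_lim (@Rhausdorff R) L) -(cvg_lim (@Rhausdorff R) L').
pose B := (fine (lebesgue V) + 1) / 2.
have B0 : 0 <= B by rewrite divr_ge0// addr_ge0// fine_ge0.
have K : (fun n => B * 2^-1 ^+ n) @ \oo --> (0 : R).
  by rewrite -(mulr0 B); apply: cvgM; [exact: cvg_cst | exact: cvg_expr_half].
apply/cvgrPdist_le => e e0.
have /cvgrPdist_le/(_ _ e0) := K; apply: filterS => n.
rewrite sub0r normrN => Kn; apply: le_trans Kn.
have [gi ->] := vg n x y xy xyV.
rewrite -RintegralB//; last exact: iS.
have dsq : square_integrable V (fun t => h t - g n t) by exact: square_integrableB.
have di := square_integrable_integrable _ _ mV Vfin dsq.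
apply: le_trans (le_normr_Rintegral _ (iS _ dsq)) _ => //.
apply: (@le_trans _ _ (\int[lebesgue]_(t in V) `|h t - g n t|)).
  by apply: Rintegral_subset_le => //; apply: integrable_norm.
apply: le_trans (ler_norm _); apply: Rintegral_norm_geometric => //.
apply: le_trans (gh n); rewrite le_eqVlt; apply/orP; left; apply/eqP.
by apply: eq_Rintegral_on => t _; rewrite -sqrrN opprB.
Qed.

Lemma Rintegral_sqr_bounded {R : realType} (D : set R) (f : R -> R) (B : R) :
  measurable_set D -> (lebesgue D < +oo)%E -> measurable_on D f ->
  (forall x, D x -> `|f x| <= B) -> square_integrable D f.
Proof.
move=> mD Dfin mf fB; split=> //.
apply: (le_integrable_on _ _ (fun=> B ^+ 2)) => //.
- exact: measurable_funX.
- move=> x Dx; rewrite ger0_norm ?sqr_ge0// -[f x ^+ 2](real_normK (num_real _)).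
  have := fB x Dx; have := normr_ge0 (f x) => h0 h1.
  by rewrite ler_pXn2r// nnegrE (le_trans h0).
- exact: integrable_on_cst.
Qed.

(** A linear class inside [H^1(V)] whose stability under means is immediate. *)
Definition ac_H1 {R : realType} (V : set R) (v : R -> R) :=
  exists g, [/\ square_integrable V v, square_integrable V g &
                primitive_on V v g].

Lemma ac_H1_H1 {R : realType} (V : set R) (v : R -> R) :
  open V -> (lebesgue V < +oo)%E -> ac_H1 V v -> H1 V v.
Proof. by move=> oV Vfin [g [vsq gsq vg]]; apply: (H1_primitive _ _ g). Qed.

Lemma ac_H1_lin {R : realType} (V : set R) (a : R) (v w : R -> R) :
  measurable_set V -> ac_H1 V v -> ac_H1 V w ->
  ac_H1 V (fun x => a * v x + w x).
Proof.
move=> mV [g [vsq gsq vg]] [h [wsq hsq wh]]; exists (fun x => a * g x + h x).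
split.
- by apply: square_integrableD => //; exact: square_integrableZ.
- by apply: square_integrableD => //; exact: square_integrableZ.
- by apply: primitive_onD => //; exact: primitive_onZ.
Qed.

(** Means of the tails of a bounded sequence converge strongly, by
[L2_midpoint_compact].  The predicate [Q] records any property that survives the
formation of means and is thus inherited by the strongly convergent sequence. *)
Lemma strongly_convergent_means {R : realType} (V : set R)
    (f_ g_ : nat -> R -> R) (f : R -> R) (B M : R) (Q : (R -> R) -> Prop) :
  open V -> (lebesgue V < +oo)%E ->
  (forall l, primitive_on V (f_ l) (g_ l)) ->
  (forall l, square_integrable V (g_ l)) ->
  (forall l, \int[lebesgue]_(x in V) g_ l x ^+ 2 <= M) ->
  (forall l x, V x -> `|f_ l x| <= B) ->
  (forall x, V x -> f_ ^~ x @ \oo --> f x) ->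
  (forall n, exists2 l, (n <= l)%N & Q (f_ l)) ->
  (forall v w, ac_H1 V v -> ac_H1 V w -> Q v -> Q w ->
     Q (fun x => (v x + w x) / 2)) ->
  exists (v : nat -> R -> R) (w : nat -> R -> R) (g : R -> R),
    [/\ forall n, Q (v n),
        forall n, [/\ primitive_on V (v n) (w n), square_integrable V (w n),
                      measurable_on V (v n) & forall x, V x -> `|v n x| <= B],
        forall x, V x -> v ^~ x @ \oo --> f x &
        square_integrable V g /\
        forall n, \int[lebesgue]_(x in V) (w n x - g x) ^+ 2 <= 4^-1 ^+ n].
Proof.
move=> oV Vfin fg gsq gM fB ff Qf Qmid.
have mV : measurable_set V by exact: open_measurable.
have mf (h k : R -> R) : primitive_on V h k -> measurable_on V h.
  exact: primitive_on_measurable.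
pose T n v w := [/\ Q v, primitive_on V v w, square_integrable V w,
  (forall x, V x -> `|v x| <= B) &
  forall x d, V x -> (forall l, (n <= l)%N -> `|f_ l x - f x| <= d) -> `|v x - f x| <= d].
pose C n := [set w | (exists v, T n v w) /\ \int[lebesgue]_(x in V) w x ^+ 2 <= M].
have TH n v w : T n v w -> ac_H1 V v.
  move=> [_ vw wsq vB _]; exists w; split=> //.
  by apply: (Rintegral_sqr_bounded _ _ B) => //; exact: (mf _ _ vw).
have [||n|||w [g [wC gsq' wg]]] := L2_midpoint_compact V C M mV Vfin.
- by move=> n w [[v []]].
- by move=> n w [].
- have [l nl Ql] := Qf n; exists (g_ l); split; last exact: gM.
  exists (f_ l); split=> //; first exact: fB.
  by move=> x d Vx; apply.
- move=> n m nm w [[v [Qv vw wsq vB vd]] wM]; split=> //; exists v; split=> // x d Vx fd.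
  by apply: vd => // l ml; apply: fd; exact: (leq_trans nm ml).
- move=> n w1 w2 [[v1 T1] M1] [[v2 T2] M2]; split.
    exists (fun x => (v1 x + v2 x) / 2).
    have [Q1 p1 s1 B1 d1] := T1; have [Q2 p2 s2 B2 d2] := T2; split.
    + by apply: Qmid => //; [exact: (TH _ _ _ T1) | exact: (TH _ _ _ T2)].
    + have := primitive_onZ _ 2^-1 _ _ (primitive_onD _ _ _ _ _ p1 p2).
      by apply: primitive_on_eq => x _; rewrite mulrC.
    + have := square_integrableZ _ 2^-1 _ mV (square_integrableD _ _ _ mV s1 s2).
      by under eq_fun do rewrite mulrC.
    + move=> x Vx; have := B1 x Vx; have := B2 x Vx; rewrite !ler_norml.
      by move=> /andP[? ?] /andP[? ?]; apply/andP; split; lra.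
    + move=> x d Vx fd; have := d1 x d Vx fd; have := d2 x d Vx fd; rewrite !ler_norml.
      by move=> /andP[? ?] /andP[? ?]; apply/andP; split; lra.
  have [_ _ s1 _ _] := T1; have [_ _ s2 _ _] := T2.
  have := Rintegral_sqr_midpoint _ _ _ mV s1 s2.
  have : 0 <= \int[lebesgue]_(x in V) (w1 x - w2 x) ^+ 2.
    by apply: Rintegral_ge0 => x _; exact: sqr_ge0.
  move: M1 M2; set a := Rintegral _ _ _; set b := Rintegral _ _ _.
  set c := Rintegral _ _ _; set d := Rintegral _ _ _; lra.
have /choice[v vT] : forall n, exists v, T n v (w n) by move=> n; have [] := wC n.
exists v, w, g; split=> //.
- by move=> n; have [] := vT n.
- by move=> n; have [Qv vw wsq vB _] := vT n; split=> //; exact: (mf _ _ vw).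
move=> x Vx; apply/cvgrPdist_le => e e0.
have /cvgrPdist_le/(_ _ e0)[n _ fn] := ff x Vx.
exists n => // m /= nm; rewrite distrC.
have [_ _ _ _] := vT m; apply => // l ml; rewrite distrC; apply: fn => /=.
exact: (leq_trans nm ml).
Qed.

Lemma limit_norm_le {R : realType} (u : nat -> R) (l B : R) :
  u @ \oo --> l -> (forall n, `|u n| <= B) -> `|l| <= B.
Proof.
move=> ul uB; apply/ler_addgt0Pr => e e0.
have /cvgrPdist_le/(_ _ e0)[n _ /(_ n (leqnn n)) un] := ul.
by rewrite -[l](subrK (u n)) addrC (le_trans (ler_normD _ _))// lerD.
Qed.

Lemma H1_limit {R : realType} (V : set R) (f_ g_ : nat -> R -> R) (f : R -> R)
    (B M : R) :
  open V -> (lebesgue V < +oo)%E ->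
  (forall l, primitive_on V (f_ l) (g_ l)) ->
  (forall l, square_integrable V (g_ l)) ->
  (forall l, \int[lebesgue]_(x in V) g_ l x ^+ 2 <= M) ->
  (forall l x, V x -> `|f_ l x| <= B) ->
  (forall x, V x -> f_ ^~ x @ \oo --> f x) ->
  exists g, [/\ square_integrable V g, primitive_on V f g & H1 V f].
Proof.
move=> oV Vfin fg gsq gM fB ff.
have mV : measurable_set V by exact: open_measurable.
have [||v [w [g [_ vw vf [gsq' wg]]]]] := strongly_convergent_means V f_ g_ f B M (fun=> True)
  oV Vfin fg gsq gM fB ff => //.
  by move=> n; exists n.
have fg' : primitive_on V f g.
  by apply: (primitive_on_limit V v w) => // n; have [] := vw n.
exists g; split=> //; apply: (H1_primitive _ _ _ oV Vfin _ gsq' fg').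
apply: (Rintegral_sqr_bounded _ _ B) => //.
  by apply: (measurable_fun_cvg _ vf) => n; have [] := vw n.
by move=> x Vx; apply: limit_norm_le (ff x Vx) _ => l; exact: fB.
Qed.

(** A functional that stayed away from its limit value along a subsequence would
stay away from it along means of that subsequence, which converge strongly. *)
Lemma H1_weak_cvg_bounded {R : realType} (V : set R) (f_ g_ : nat -> R -> R)
    (f : R -> R) (B M : R) :
  open V -> (lebesgue V < +oo)%E ->
  (forall l, primitive_on V (f_ l) (g_ l)) ->
  (forall l, square_integrable V (g_ l)) ->
  (forall l, \int[lebesgue]_(x in V) g_ l x ^+ 2 <= M) ->
  (forall l x, V x -> `|f_ l x| <= B) ->
  (forall x, V x -> f_ ^~ x @ \oo --> f x) ->
  H1_weak_cvg V f_ f.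
Proof.
move=> oV Vfin fg gsq gM fB ff.
have mV : measurable_set V by exact: open_measurable.
have [g0 [_ _ fH]] := H1_limit V f_ g_ f B M oV Vfin fg gsq gM fB ff.
have f_H l : H1 V (f_ l).
  apply: (H1_primitive _ _ _ oV Vfin _ (gsq l) (fg l)).
  apply: (Rintegral_sqr_bounded _ _ B) => //; last exact: fB.
  exact: (primitive_on_measurable _ _ _ oV (fg l)).
split=> //; first exact: nearW.
have half (F : (R -> R) -> R) (e : R) : H1_dual V F -> 0 < e ->
    \forall l \near \oo, F (f_ l) < F f + e.
  move=> [Flin [C FC]] e0; apply: contrapT => nF.
  have often n : exists2 l, (n <= l)%N & F f + e <= F (f_ l).
    apply: contrapT => nl; apply: nF; exists n => // l /= nl'.
    by rewrite ltNge; apply/negP => H; apply: nl; exists l.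
  have [|v [w [g [vQ vw vf [gsq' wg]]]]] := strongly_convergent_means V f_ g_ f B M
    (fun v => F f + e <= F v) oV Vfin fg gsq gM fB ff often.
    move=> v w vH wH vF wF.
    have dH : H1 V (fun x => -1 * w x + v x).
      by apply: (ac_H1_H1 _ _ oV Vfin); exact: ac_H1_lin.
    have -> : (fun x => (v x + w x) / 2) =
        (fun x => 2^-1 * (-1 * w x + v x) + w x) by apply/funext => x; field.
    have {}vH := ac_H1_H1 _ _ oV Vfin vH; have {}wH := ac_H1_H1 _ _ oV Vfin wH.
    rewrite Flin// Flin//; lra.
  (* The means converge to [f] in the norm of H^1, yet [F] sends them at distance
     at least [e] from [F f]. *)
  have vsq n : square_integrable V (v n).
    by have [_ _ mv vB] := vw n; apply: (Rintegral_sqr_bounded _ _ B).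
  have fg' : primitive_on V f g.
    by apply: (primitive_on_limit V v w) => // n; have [] := vw n.
  have [/(L2P _ _ mV) fsq _] := fH.
  have vH n : H1 V (v n).
    by have [vp wsq _ _] := vw n; apply: (H1_primitive _ _ _ oV Vfin _ wsq vp).
  pose u n := fun x => -1 * f x + v n x.
  have usq n : square_integrable V (u n).
    by apply: square_integrableD => //; exact: square_integrableZ.
  have up n : primitive_on V (u n) (fun x => -1 * g x + w n x).
    have [vp _ _ _] := vw n; apply: primitive_onD => //.
    exact: primitive_onZ.
  have udsq n : square_integrable V (fun x => -1 * g x + w n x).
    have [_ wsq _ _] := vw n; apply: square_integrableD => //.
    exact: square_integrableZ.
  pose N n := \int[lebesgue]_(x in V) u n x ^+ 2 +
              \int[lebesgue]_(x in V) (-1 * g x + w n x) ^+ 2.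
  have FN n : e <= C * Num.sqrt (N n).
    rewrite -(H1norm_primitive _ _ _ oV Vfin (usq n) (udsq n) (up n)).
    have uH : H1 V (u n) by apply: (H1_primitive _ _ _ oV Vfin (usq n) (udsq n) (up n)).
    apply: le_trans (FC _ uH); apply: le_trans (ler_norm _).
    by rewrite /u Flin// mulN1r addrC lerBrDl; exact: vQ.
  have N0 : N @ \oo --> (0 : R).
    rewrite -[0](addr0 (0 : R)); apply: cvgD.
      rewrite -(_ : \int[lebesgue]_(x in V) (0 : R) = 0); last first.
        by rewrite Rintegral_cst// mul0r.
      apply: (Rintegral_dominated_cvg _ _ _ (fun=> (B + B) ^+ 2)) => //.
      + by move=> n; have [mu_ _] := usq n; exact: measurable_funX.
      + move=> x Vx; rewrite -(_ : (-1 * f x + f x) ^+ 2 = 0); last by ring.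
        have L : u ^~ x @ \oo --> -1 * f x + f x.
          by apply: cvgD; [exact: cvg_cst | exact: vf].
        by apply: cvgM.
      + exact: integrable_on_cst.
      + move=> n x Vx; rewrite ger0_norm ?sqr_ge0// -[u n x ^+ 2](real_normK (num_real _)).
        have uB : `|u n x| <= B + B.
          rewrite /u mulN1r (le_trans (ler_normD _ _))// normrN lerD//.
            by apply: limit_norm_le (ff x Vx) _ => l; exact: fB.
          by have [_ _ _] := vw n; apply.
        by rewrite ler_pXn2r// nnegrE (le_trans _ uB).
    apply: (@squeeze_cvgr _ _ _ _ (fun=> 0) (fun n => 4^-1 ^+ n)); last 2 first.
    - exact: cvg_cst.
    - have := @cvg_geometric R 1 4^-1; rewrite ger0_norm ?invr_ge0// invf_lt1 ?ltr1n//.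
      move=> /(_ isT); suff -> : geometric 1 4^-1 = (fun n => (4^-1 : R) ^+ n) by [].
      by apply/funext => n; rewrite /geometric/= mul1r.
    apply: nearW => n; apply/andP; split.
      by apply: Rintegral_ge0 => x _; exact: sqr_ge0.
    rewrite (le_trans _ (wg n))// le_eqVlt; apply/orP; left; apply/eqP.
    by apply: eq_Rintegral_on => x _; ring.
  have sN : (fun n => C * Num.sqrt (N n)) @ \oo --> (0 : R).
    rewrite -(mulr0 C) -[in X in _ --> X](@sqrtr0 R); apply: cvgM; first exact: cvg_cst.
    by apply: (continuous_cvg _ (@sqrt_continuous R 0)).
  have e2 : 0 < e / 2 by rewrite divr_gt0.
  have /cvgrPdist_le/(_ _ e2)[n _ /(_ n (leqnn n))] := sN.
  rewrite sub0r normrN => H; have := FN n; have := ler_norm (C * Num.sqrt (N n)).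
  move: H e0; set a := _ * Num.sqrt _; move: a => a; lra.
move=> F [Flin [C FC]]; apply/cvgrPdist_lt => e e0.
have h1 := half F e (conj Flin (ex_intro _ C FC)) e0.
have dN : H1_dual V (fun v => - F v).
  split; first by move=> a h k hH kH; rewrite Flin//; ring.
  by exists C => h hH; rewrite normrN; exact: FC.
have h2 := half _ e dN e0.
apply: filterS2 h1 h2 => l h1 h2.
by rewrite ltr_norml; apply/andP; split; lra.
Qed.

(** * Extraction of a sequence *)

(** Along an ultrafilter every bounded function converges, so countably many of
them converge together; a sequence that follows the ultrafilter closely
enough inherits the limits. *)
Lemma diagonal_extraction {R : realType} (T : Type) (K : countType)
    (F : set_system T) (a : K -> T -> R) (B : K -> R) (P : nat -> set T) :
  ProperFilter F -> (forall k, F [set t | `|a k t| <= B k]) ->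
  (forall n, F (P n)) ->
  exists (e : nat -> T) (A : K -> R),
    (forall n, P n (e n)) /\ forall k, (fun n => a k (e n)) @ \oo --> A k.
Proof.
move=> FF aB FP; have [G [GU FG]] := ultraFilterLemma FF.
have GF : ProperFilter G by exact: ultra_proper.
have /choice[A aA] : forall k, exists l : R, a k @ G --> l.
  move=> k; have Gk : (a k @ G) `[- B k, B k]%classic.
    by apply: FG; apply: filterS (aB k) => t /=; rewrite in_itv/= -ler_norml.
  have [l [_ kl]] := @segment_compact R (- B k) (B k) (a k @ G) _ Gk.
  exists l => V lV; have [//|nV] := in_ultra_setVsetC (a k @^-1` V) GU.
  by have [x [nVx Vx]] := kl (~` V) V nV lV.
have near_all n : G [set t | P n t /\
    forall k, (pickle k <= n)%N -> `|A k - a k t| <= n.+1%:R^-1].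
  apply: filterI; first exact/FG/FP.
  have close k : G [set t | `|A k - a k t| <= n.+1%:R^-1].
    have n0 : 0 < (n.+1%:R : R)^-1 by rewrite invr_gt0.
    by have /cvgrPdist_le/(_ _ n0) := aA k.
  suff H m : G [set t | forall k, (pickle k < m)%N -> `|A k - a k t| <= n.+1%:R^-1].
    exact: H n.+1.
  elim: m => [|m IH]; first by apply: filterS filterT => t.
  pose S := [set t | forall k, pickle k = m -> `|A k - a k t| <= n.+1%:R^-1].
  have GS : G S.
    have [[k km]|nk] := pselect (exists k : K, pickle k = m).
      by apply: filterS (close k) => t kt k' k'm; rewrite (pcan_inj pickleK (etrans k'm (esym km))).
    by apply: filterS filterT => t _ k km; exfalso; apply: nk; exists k.
  apply: filterS2 IH GS => t IHt St k; rewrite ltnS leq_eqVlt => /predU1P[/St//|/IHt].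
  by [].
have /choice[e eP] : forall n, exists t, P n t /\
    forall k, (pickle k <= n)%N -> `|A k - a k t| <= n.+1%:R^-1.
  by move=> n; exact: filter_ex (near_all n).
exists e, A; split=> [n|k]; first by case: (eP n).
apply/cvgrPdist_le => r r0; near=> n.
have [_ /(_ k)] := eP n; move=> /(_ _)/le_trans; apply.
  by near: n; exact: nbhs_infty_ge.
rewrite invf_ple ?posrE//; apply: (@le_trans _ _ n%:R); last by rewrite ler_nat.
by apply: ltW; near: n; exact: nbhs_infty_gtr.
Unshelve. all: by end_near. Qed.

(** * The energy and the modulus *)

Lemma lebesgue_itv01 {R : realType} : @lebesgue_measure R `]0, 1[ = 1%E.
Proof. by rewrite lebesgue_measure_itv/= lte_fin ltr01 oppr0 adde0. Qed.

Lemma sub_itv01 {R : realType} (V : set R) : open V -> V `<=` `]0, 1[ ->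
  (lebesgue V < +oo)%E.
Proof.
move=> oV V01; apply: (@le_lt_trans _ _ (@lebesgue_measure R `]0%R, 1%R[)).
  by apply: le_measure => //; rewrite inE; [exact: open_measurable | exact: measurable_itv].
by rewrite lebesgue_itv01 ltry.
Qed.

(** The integrand of the energy, for given derivatives [p1] and [p2]. *)
Definition density {R : realType} (L : R) (N : nat) (eps : R)
    (u1 u2 p1 p2 : R -> R) (x : R) : R :=
  eps / 2 * (p1 x ^+ 2 + p2 x ^+ 2)
  + (4 * eps)^-1 * (u1 x ^+ 2 + u2 x ^+ 2 - 1) ^+ 2
  + L / 2 * (u1 x * p2 x - u2 x * p1 x - 2 * pi * N%:R) ^+ 2.

Lemma density_ge0 {R : realType} (L : R) N (eps : R) (u1 u2 p1 p2 : R -> R) x :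
  0 < L -> 0 < eps -> 0 <= density L N eps u1 u2 p1 p2 x.
Proof.
move=> L0 e0; rewrite /density !addr_ge0// mulr_ge0 ?sqr_ge0//.
- by rewrite divr_ge0// ltW.
- by rewrite addr_ge0// sqr_ge0.
- by rewrite invr_ge0 mulr_ge0// ltW.
- by rewrite divr_ge0// ltW.
Qed.

Lemma enorm_sqr {R : realType} (z : R * R) : enorm z ^+ 2 = z.1 ^+ 2 + z.2 ^+ 2.
Proof. by rewrite /enorm sqr_sqrtr// addr_ge0// sqr_ge0. Qed.

Lemma admissible_energy {R : realType} (L : R) (N : nat) (alpha eps C0 : R)
    (u : R -> R * R) :
  0 < L -> 0 < eps -> admissible alpha u -> (energy L N eps u <= C0%:E)%E ->
  exists p1 p2 : R -> R,
    let u1 := fun x => (u x).1 in let u2 := fun x => (u x).2 in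
    [/\ primitive_on `]0, 1[ u1 p1 /\ primitive_on `]0, 1[ u2 p2,
        square_integrable `]0, 1[ p1 /\ square_integrable `]0, 1[ p2,
        integrable_on `]0, 1[ (density L N eps u1 u2 p1 p2) &
        \int[lebesgue]_(x in `]0, 1[) density L N eps u1 u2 p1 p2 x <= C0].
Proof.
move=> L0 e0 [[H1u H2u] cu _ _] EC.
pose u1 := fun x => (u x).1; pose u2 := fun x => (u x).2.
have oI : open (`]0, 1[%classic : set R) by exact: interval_open.
have mI : measurable_set (`]0, 1[ : set R) by exact: measurable_set_itv.
have Ifin : (@lebesgue_measure R `]0%R, 1%R[ < +oo)%E by rewrite lebesgue_itv01 ltry.
have cu' x : `]0, 1[%classic x -> {for x, continuous u}.
  move=> Ix; have : {within `]0, 1[, continuous u}.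
    by apply: continuous_subspaceW cu; exact: subset_itv_oo_cc.
  by rewrite continuous_open_subspace//; apply; rewrite inE.
have c1 x : `]0, 1[%classic x -> {for x, continuous u1}.
  by move=> Ix; apply: continuous_comp; [exact: cu' | exact: cvg_fst].
have c2 x : `]0, 1[%classic x -> {for x, continuous u2}.
  by move=> Ix; apply: continuous_comp; [exact: cu' | exact: cvg_snd].
have [s1 P1] := wderiv_primitive _ _ oI Ifin c1 H1u.
have [s2 P2] := wderiv_primitive _ _ oI Ifin c2 H2u.
exists (wderiv `]0, 1[ u1), (wderiv `]0, 1[ u2) => /=.
have m1 : measurable_on `]0, 1[ u1.
  by apply: open_continuous_measurable_fun => // x; rewrite inE; exact: c1.
have m2 : measurable_on `]0, 1[ u2.
  by apply: open_continuous_measurable_fun => // x; rewrite inE; exact: c2.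
have [mp1 _] := s1; have [mp2 _] := s2.
have mcst (c : R) : measurable_on `]0, 1[ (fun=> c) by exact: measurable_cst.
have [|||di dC] := Rintegral_le_of_integral `]0, 1[
    (density L N eps u1 u2 (wderiv `]0, 1[ u1) (wderiv `]0, 1[ u2)) C0 mI.
- apply: measurable_funD; first apply: measurable_funD.
  + apply: measurable_funM => //.
    by apply: measurable_funD; exact: measurable_funX.
  + apply: measurable_funM => //; apply: measurable_funX.
    by apply: measurable_funB => //; apply: measurable_funD; exact: measurable_funX.
  + apply: measurable_funM => //; apply: measurable_funX.
    by apply: measurable_funB => //; apply: measurable_funB; exact: measurable_funM.
- by move=> x _; exact: density_ge0.
- move: EC; rewrite /energy/=; under eq_integral do rewrite enorm_sqr; exact.
split; [exact: (conj P1 P2) | exact: (conj s1 s2) | exact: di | exact: dC].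
Qed.

(** The shape of [well] is dictated by [well_density]: its derivative vanishes at 1
like [1 - s] and decays fast enough to absorb the factor [|u|] in [(|u|^2)'];
it is moreover smooth on the whole line. *)
Definition well {R : realType} (s : R) : R := s / (1 + s ^+ 2).

Definition well' {R : realType} (s : R) : R := (1 - s ^+ 2) / (1 + s ^+ 2) ^+ 2.

Lemma is_derive_well {R : realType} (s : R) : is_derive s 1 well (well' s).
Proof.
have s0 : 1 + s ^+ 2 != 0 by rewrite gt_eqF// ltr_wpDr// sqr_ge0.
have d2 : is_derive s 1 (fun x : R => 1 + x ^+ 2) (2 * s).
  apply: (is_derive_quadratic _ _ _ 1) => // y; rewrite le_eqVlt; apply/orP; left.
  rewrite mul1r -[X in _ == X]ger0_norm ?sqr_ge0//; apply/eqP; congr `|_|; ring.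
have dV := @is_deriveV R (fun x => 1 + x ^+ 2) s _ _ s0 d2.
have d1 : is_derive s 1 (id : R -> R) 1 by exact: is_derive_id.
have dM := is_deriveM d1 dV.
have -> : well' s = s *: (- (1 + s ^+ 2) ^- 2 *: (2 * s)) + (1 + s ^+ 2)^-1 *: 1.
  by rewrite /well' /GRing.scale/=; field.
exact: dM.
Qed.

Lemma continuous_well' {R : realType} : continuous (@well' R).
Proof.
move=> s; have s0 : 1 + s ^+ 2 != 0 by rewrite gt_eqF// ltr_wpDr// sqr_ge0.
have sq : (fun x : R => x ^+ 2) @ s --> s ^+ 2 by exact: exprn_continuous.
apply: cvgM; first by apply: cvgB => //; exact: cvg_cst.
apply: cvgV; first by rewrite expf_neq0.
have c1 : (fun x : R => 1 + x ^+ 2) @ s --> 1 + s ^+ 2.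
  by apply: cvgD => //; exact: cvg_cst.
by under eq_fun do rewrite expr2; rewrite expr2; apply: cvgM.
Qed.

(** The Modica-Mortola inequality: with [s = |u|^2], the derivative of [well s] is at
most a multiple of [|1 - s| |u'|], a product that the two terms of the energy
density bound by the arithmetic-geometric inequality. *)
Lemma well_density {R : realType} (eps a b p q : R) : 0 < eps ->
  `|well' (a * a + b * b) * (p * a + a * p + (q * b + b * q))| <=
  4 * (eps / 2 * (p ^+ 2 + q ^+ 2)
       + (4 * eps)^-1 * (a ^+ 2 + b ^+ 2 - 1) ^+ 2).
Proof.
move=> e0.
pose s := a ^+ 2 + b ^+ 2; pose P := p ^+ 2 + q ^+ 2; pose A := p * a + q * b.
have s0 : 0 <= s by rewrite addr_ge0// sqr_ge0.
have P0 : 0 <= P by rewrite addr_ge0// sqr_ge0.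
have AP : A ^+ 2 <= s * P.
  rewrite -subr_ge0; have -> : s * P - A ^+ 2 = (a * q - b * p) ^+ 2.
    by rewrite /s /P /A; ring.
  exact: sqr_ge0.
pose t := 1 + s ^+ 2.
have t1 : 1 <= t by rewrite lerDl sqr_ge0.
have t0 : 0 < t by exact: lt_le_trans t1.
pose c := (1 + s) / t ^+ 2.
have sc : s * c ^+ 2 <= 1.
  rewrite /c expr_div_n mulrA ler_pdivrMr ?mul1r; last by rewrite exprn_gt0// exprn_gt0.
  have h1 : 2 * s <= t by rewrite /t; have := sqr_ge0 (s - 1); nra.
  have h2 : (1 + s) ^+ 2 <= 2 * t by rewrite /t; have := sqr_ge0 (s - 1); nra.
  have h3 : s * (1 + s) ^+ 2 <= t ^+ 2 by have := sqr_ge0 (1 + s); nra.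
  apply: (le_trans h3); rewrite -exprM; apply: ler_weXn2l => //.
have Ac : (A * c) ^+ 2 <= P.
  rewrite exprMn; apply: (@le_trans _ _ (s * P * c ^+ 2)).
    by rewrite ler_wpM2r// sqr_ge0.
  by rewrite mulrAC ler_piMl.
have -> : well' (a * a + b * b) * (p * a + a * p + (q * b + b * q)) =
    2 * (A * c) * (1 - s).
  have -> : a * a + b * b = s by rewrite /s; ring.
  rewrite /well' -/t /A /c; field; exact: lt0r_neq0.
have -> : 4 * (eps / 2 * (p ^+ 2 + q ^+ 2) +
    (4 * eps)^-1 * (a ^+ 2 + b ^+ 2 - 1) ^+ 2) = 2 * eps * P + (s - 1) ^+ 2 / eps.
  by rewrite -/s -/P; field; exact: lt0r_neq0.
have h : `|2 * (A * c) * (1 - s)| <= eps * (A * c) ^+ 2 + (s - 1) ^+ 2 / eps.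
  have e := lt0r_neq0 e0.
  rewrite ler_norml; apply/andP; split; rewrite -subr_ge0.
    have -> : 2 * (A * c) * (1 - s) - - (eps * (A * c) ^+ 2 + (s - 1) ^+ 2 / eps) =
      (eps * (A * c) + (1 - s)) ^+ 2 / eps by field.
    by rewrite divr_ge0 ?sqr_ge0// ltW.
  have -> : eps * (A * c) ^+ 2 + (s - 1) ^+ 2 / eps - 2 * (A * c) * (1 - s) =
      (eps * (A * c) - (1 - s)) ^+ 2 / eps by field.
  by rewrite divr_ge0 ?sqr_ge0// ltW.
apply: (le_trans h); rewrite lerD2r.
apply: (@le_trans _ _ (eps * P)); first by rewrite ler_wpM2l// ltW.
by rewrite ler_wpM2r// ler_peMl ?ler1n// ltW.
Qed.

Lemma well_variation {R : realType} (L : R) N (eps : R) (u1 u2 p1 p2 : R -> R)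
    (a b : R) :
  0 < L -> 0 < eps -> a <= b ->
  primitive_on `[a, b] u1 p1 -> primitive_on `[a, b] u2 p2 ->
  integrable_on `[a, b] (density L N eps u1 u2 p1 p2) ->
  `|well (u1 b ^+ 2 + u2 b ^+ 2) - well (u1 a ^+ 2 + u2 a ^+ 2)| <=
  4 * \int[lebesgue]_(x in `[a, b]) density L N eps u1 u2 p1 p2 x.
Proof.
move=> L0 e0 ab P1 P2 di.
have S := primitive_onD _ _ _ _ _ (primitive_onM _ _ _ _ _ P1 P1)
  (primitive_onM _ _ _ _ _ P2 P2).
have [wi E] := primitive_on_comp _ _ _ _ _ is_derive_well continuous_well' S a b ab
  (@subset_refl _ _).
rewrite !expr2 E; apply: le_trans (le_normr_Rintegral _ wi) _ => //.
rewrite -RintegralZl//; apply: le_Rintegral => //.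
- exact: integrable_norm.
- exact: integrable_onZ.
move=> x _; apply: (le_trans (well_density eps _ _ _ _ e0)).
apply: ler_wpM2l => //; rewrite /density lerDl; apply: mulr_ge0; last exact: sqr_ge0.
by rewrite divr_ge0// ltW.
Qed.

(** Because of the potential, [s = |u|^2] cannot stay at distance 1/2 from 1 on the
whole segment.  At a point where it is closer than that, [well s >= 2 / 5]; by
[well_variation] this drops by less than 1/8 on the segment, hence stays above
[well (1 / 4) = 4 / 17]. *)
Lemma modulus_gap {R : realType} (L : R) N (eps : R) (u1 u2 p1 p2 : R -> R)
    (a b : R) :
  0 < L -> 0 < eps -> a < b -> eps <= 2 * (b - a) ->
  primitive_on `[a, b] u1 p1 -> primitive_on `[a, b] u2 p2 ->
  integrable_on `[a, b] (density L N eps u1 u2 p1 p2) ->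
  \int[lebesgue]_(x in `[a, b]) density L N eps u1 u2 p1 p2 x < 32^-1 ->
  forall x, a <= x -> x <= b -> 4^-1 < u1 x ^+ 2 + u2 x ^+ 2.
Proof.
move=> L0 e0 ab eab P1 P2 di d32.
pose s x := u1 x ^+ 2 + u2 x ^+ 2.
have [z [az zb sz]] : exists z, [/\ a <= z, z <= b & `|s z - 1| <= 2^-1].
  apply: contrapT => nz.
  have : \int[lebesgue]_(x in `[a, b]) ((16 * eps)^-1) <=
      \int[lebesgue]_(x in `[a, b]) density L N eps u1 u2 p1 p2 x.
    apply: le_Rintegral => //.
      apply: integrable_on_cst => //.
      by rewrite lebesgue_measure_itv/= lte_fin ab -EFinB ltry.
    move=> x /=; rewrite in_itv/= => /andP[ax xb].
    have sx : 2^-1 < `|s x - 1|.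
      by rewrite ltNge; apply/negP => H; apply: nz; exists x.
    have sx2 : 4^-1 <= (s x - 1) ^+ 2.
      rewrite -[_ ^+ 2](real_normK (num_real _)) (_ : 4^-1 = 2^-1 ^+ 2 :> R); last by field.
      by rewrite ler_pXn2r ?nnegrE// ltW.
    rewrite /density -/(s x).
    apply: (@le_trans _ _ ((4 * eps)^-1 * (s x - 1) ^+ 2)).
      rewrite (_ : (16 * eps)^-1 = (4 * eps)^-1 * 4^-1); last by field; exact: lt0r_neq0.
      by rewrite ler_wpM2l// invr_ge0 mulr_ge0// ltW.
    have h1 : 0 <= eps / 2 * (p1 x ^+ 2 + p2 x ^+ 2).
      by rewrite mulr_ge0// ?divr_ge0// ?addr_ge0 ?sqr_ge0// ltW.
    have h2 : 0 <= L / 2 * (u1 x * p2 x - u2 x * p1 x - 2 * pi * N%:R) ^+ 2.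
      by apply: mulr_ge0; [rewrite divr_ge0// ltW | exact: sqr_ge0].
    lra.
  rewrite Rintegral_cst//= lebesgue_measure_itv/= lte_fin ab/= => H.
  have := le_lt_trans H d32.
  rewrite mulrC ltr_pdivrMr ?mulr_gt0//; lra.
move=> x ax xb.
have sP t : a <= t -> t <= b -> `|well (s z) - well (s t)| < 8^-1.
  move=> at_ tb.
  have part p q : a <= p -> p <= q -> q <= b ->
      `|well (s q) - well (s p)| < 8^-1.
    move=> ap pq qb; have sub := subset_itvcc _ _ _ _ ap qb.
    have di' := integrable_itvS _ _ _ _ _ ap qb di.
    apply: (le_lt_trans (well_variation L N eps _ _ _ _ p q L0 e0 pq
      (primitive_onS _ _ _ _ sub P1) (primitive_onS _ _ _ _ sub P2) di')).
    rewrite (_ : 8^-1 = 4 * 32^-1); last by field.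
    rewrite ltr_pM2l//; apply: le_lt_trans d32.
    by apply: Rintegral_subset_le => // y _; exact: density_ge0.
  have [tz|/ltW zt] := leP t z; first exact: part.
  by rewrite distrC; exact: part.
have := sP x ax xb.
have wz : 2 / 5 <= well (s z).
  rewrite /well ler_pdivlMr ?ltr_wpDr ?sqr_ge0//.
  move: sz; rewrite ler_norml => /andP[z1 z2].
  nra.
move=> /ltr_normlW H.
have wx : 11 / 40 < well (s x) by lra.
have t0 : 0 < 1 + s x ^+ 2 by rewrite ltr_wpDr// sqr_ge0.
move: wx; rewrite /well ltr_pdivlMr// => wx.
rewrite -/(s x) ltNge; apply/negP => sx; have := sqr_ge0 (s x); lra.
Qed.

Lemma primitive_on_integral {R : realType} (a b : R) (f : R -> R) :
  integrable_on `[a, b] f ->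
  primitive_on `[a, b] (fun x => \int[lebesgue]_(t in `[a, x]) f t) f.
Proof.
move=> fi x y xy xyab.
have /andP[ax _] : a <= x <= b by have := xyab x; rewrite /= !in_itv/= lexx xy; exact.
have /andP[_ yb] : a <= y <= b by have := xyab y; rewrite /= !in_itv/= lexx xy; exact.
split; first exact: integrable_itvS fi.
rewrite (Rintegral_itv_cat a x y)//; last exact: integrable_itvS fi.
by rewrite addrAC subrr add0r.
Qed.

Lemma primitive_on_constant {R : realType} (a b : R) (F : R -> R) :
  primitive_on `[a, b] F (fun=> 0) ->
  forall x y, a <= x -> x <= b -> a <= y -> y <= b -> F x = F y.
Proof.
move=> F0.
have H x y : a <= x -> x <= y -> y <= b -> F y = F x.
  move=> ax xy yb; have [_] := F0 x y xy (subset_itvcc _ _ _ _ ax yb).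
  by rewrite Rintegral_cst// mul0r => /eqP; rewrite subr_eq0 => /eqP.
move=> x y ax xb ay yb; have [xy|/ltW yx] := leP x y; first by rewrite (H x y).
exact: H.
Qed.

(** On a segment where [u] does not vanish, [u' = (kappa + i omega) u] with
[kappa = Re (u' / u)] and [omega = Im (u' / u)]; hence the product of [u] with
[exp (- int kappa - i int omega)] has zero derivative. *)
Lemma polar_transport {R : realType} (a b : R) (u1 u2 p1 p2 Th om : R -> R) :
  a <= b -> primitive_on `[a, b] u1 p1 -> primitive_on `[a, b] u2 p2 ->
  primitive_on `[a, b] Th om ->
  (forall x, a <= x -> x <= b -> 0 < u1 x ^+ 2 + u2 x ^+ 2) ->
  (forall x, a <= x -> x <= b ->
     (u1 x ^+ 2 + u2 x ^+ 2) * om x = u1 x * p2 x - u2 x * p1 x) ->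
  forall x y, a <= x -> x <= b -> a <= y -> y <= b -> exists2 r, 0 < r &
    u1 y = r * (u1 x * cos (Th y - Th x) - u2 x * sin (Th y - Th x)) /\
    u2 y = r * (u1 x * sin (Th y - Th x) + u2 x * cos (Th y - Th x)).
Proof.
move=> ab P1 P2 PT s0 som.
pose s x := u1 x ^+ 2 + u2 x ^+ 2.
have c1 := primitive_on_continuous _ _ _ _ ab P1.
have c2 := primitive_on_continuous _ _ _ _ ab P2.
have ratio_integrable (v p : R -> R) : {within `[a, b], continuous v} ->
    integrable_on `[a, b] p -> integrable_on `[a, b] (fun x => v x / s x * p x).
  move=> cv pi'.
  have cr : {within `[a, b], continuous (fun x => v x / s x)}.
    apply/subspace_continuousP => x abx.
    have /subspace_continuousP/(_ x abx) cvx := cv.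
    have /subspace_continuousP/(_ x abx) c1x := c1.
    have /subspace_continuousP/(_ x abx) c2x := c2.
    apply: cvgM => //; apply: cvgV.
      by move: abx; rewrite /= in_itv/= => /andP[ax xb]; rewrite gt_eqF// s0.
    by rewrite /s; apply: cvgD; under eq_fun do rewrite expr2; rewrite expr2; apply: cvgM.
  have [M _ HM] := segment_bounded _ _ _ cr.
  apply: (integrable_onM_bounded _ M) => //.
    exact: subspace_continuous_measurable_fun.
  by move=> x /=; rewrite in_itv/= => /andP[]; exact: HM.
have [p1i _] := P1 a b ab (@subset_refl _ _).
have [p2i _] := P2 a b ab (@subset_refl _ _).
have ki : integrable_on `[a, b] (fun x => u1 x / s x * p1 x + u2 x / s x * p2 x).
  by apply: integrable_onD => //; exact: ratio_integrable.
have PK := primitive_on_integral _ _ _ ki.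
set k := (fun x => \int[lebesgue]_(t in `[a, x]) _) in PK.
have dexp (t : R) : is_derive t 1 (expR : R -> R) (expR t) by exact: is_derive_expR.
have cexp : continuous (expR : R -> R) by exact: continuous_expR.
have PE := primitive_on_comp _ _ _ _ _ dexp cexp (primitive_onZ _ (-1) _ _ PK).
have dcos (t : R) : is_derive t 1 (cos : R -> R) (- sin t) by exact: is_derive_cos.
have dsin (t : R) : is_derive t 1 (sin : R -> R) (cos t) by exact: is_derive_sin.
have cNsin : continuous (fun t : R => - sin t).
  by move=> t; apply: cvgN; exact: continuous_sin.
have PC := primitive_on_comp _ _ _ _ _ dcos cNsin PT.
have PS := primitive_on_comp _ _ _ _ _ dsin (@continuous_cos R) PT.
have alg x : a <= x -> x <= b ->
    let kap := u1 x / s x * p1 x + u2 x / s x * p2 x in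
    p1 x = kap * u1 x - om x * u2 x /\ p2 x = kap * u2 x + om x * u1 x.
  move=> ax xb kap; have sn0 := lt0r_neq0 (s0 x ax xb).
  have -> : om x = (u1 x * p2 x - u2 x * p1 x) / s x.
    by rewrite -som// mulrC mulKf.
  by split; rewrite /kap /s; field.
pose W1 x := expR (-1 * k x) * (u1 x * cos (Th x) + u2 x * sin (Th x)).
pose W2 x := expR (-1 * k x) * (u2 x * cos (Th x) - u1 x * sin (Th x)).
have PW1 : primitive_on `[a, b] W1 (fun=> 0).
  have := primitive_onM _ _ _ _ _ PE (primitive_onD _ _ _ _ _
    (primitive_onM _ _ _ _ _ P1 PC) (primitive_onM _ _ _ _ _ P2 PS)).
  apply: primitive_on_eq => // x; rewrite /= in_itv/= => /andP[ax xb].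
  move: (alg x ax xb); cbv zeta.
  by move: (u1 x / s x * p1 x + u2 x / s x * p2 x) => kap [-> ->]; ring.
have PW2 : primitive_on `[a, b] W2 (fun=> 0).
  have := primitive_onM _ _ _ _ _ PE (primitive_onB _ _ _ _ _
    (primitive_onM _ _ _ _ _ P2 PC) (primitive_onM _ _ _ _ _ P1 PS)).
  apply: primitive_on_eq => // x; rewrite /= in_itv/= => /andP[ax xb].
  move: (alg x ax xb); cbv zeta.
  by move: (u1 x / s x * p1 x + u2 x / s x * p2 x) => kap [-> ->]; ring.
move=> x y ax xb ay yb.
have E1 := primitive_on_constant _ _ _ PW1 x y ax xb ay yb.
have E2 := primitive_on_constant _ _ _ PW2 x y ax xb ay yb.
have back t : u1 t = expR (k t) * (W1 t * cos (Th t) - W2 t * sin (Th t)) /\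
    u2 t = expR (k t) * (W1 t * sin (Th t) + W2 t * cos (Th t)).
  have ee : expR (k t) * expR (-1 * k t) = 1.
    by rewrite mulN1r expRN divff// gt_eqF// expR_gt0.
  have cs := cos2Dsin2 (Th t).
  split; rewrite /W1 /W2.
    transitivity (expR (k t) * expR (-1 * k t) * u1 t * (cos (Th t) ^+ 2 + sin (Th t) ^+ 2)).
      by rewrite ee cs mulr1 mul1r.
    ring.
  transitivity (expR (k t) * expR (-1 * k t) * u2 t * (cos (Th t) ^+ 2 + sin (Th t) ^+ 2)).
    by rewrite ee cs mulr1 mul1r.
  ring.
exists (expR (k y) * expR (-1 * k x)); first by rewrite mulr_gt0// expR_gt0.
have [-> ->] := back y; rewrite -E1 -E2 cosB sinB /W1 /W2; split; ring.
Qed.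

Lemma polar_form {R : realType} (z : R * R) :
  exists t, `|t| <= pi /\ z = (enorm z * cos t, enorm z * sin t).
Proof.
have n0 : 0 <= enorm z by exact: sqrtr_ge0.
have := enorm_sqr z; case: z n0 => a b n0; set n := enorm _ in n0 * => /= En.
have [nz|nz] := eqVneq n 0.
  have a0 : a = 0 by have := sqr_ge0 a; have := sqr_ge0 b; apply: contra_eqP => aN; nra.
  exists 0; rewrite normr0 pi_ge0 nz !mul0r; split=> //; congr pair => //.
  by apply/eqP; rewrite -sqrf_eq0; apply/eqP; rewrite nz a0 in En; nra.
have np : 0 < n by rewrite lt_neqAle eq_sym nz.
pose c := a / n.
have c1 : -1 <= c <= 1.
  rewrite ler_pdivlMr// ler_pdivrMr// mulN1r mul1r -ler_norml.
  rewrite -(@ler_pXn2r _ 2) ?nnegrE// real_normK ?num_real// En lerDl sqr_ge0//.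
have s2 : sin (acos c) = `|b| / n.
  rewrite sin_acos// -[RHS]ger0_norm ?divr_ge0// -sqrtr_sqr; congr Num.sqrt.
  rewrite /c !expr_div_n real_normK ?num_real// En; field.
  by rewrite -En expf_neq0.
have ac0 := acos_ge0 c1; have acpi := acos_lepi c1.
have [b0|b0] := leP 0 b.
  exists (acos c); rewrite ger0_norm// acosK// s2 ger0_norm//; split=> //.
  by rewrite /c; congr pair; field.
exists (- acos c); rewrite normrN ger0_norm// cosN sinN acosK// s2 ltr0_norm//.
by split=> //; rewrite /c; congr pair; field.
Qed.

Lemma compact_eventually {R : realType} (K : set R) (Q : nat -> R -> Prop) :
  compact K ->
  (forall x, K x -> exists2 d : R, 0 < d & exists n, forall l, (n <= l)%N ->
     forall y, `|x - y| < d -> Q l y) ->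
  exists n, forall l, (n <= l)%N -> forall y, K y -> Q l y.
Proof.
move=> /compact_near_coveringP cK Qloc.
have [|n _ nP] := cK nat \oo (fun l y => Q l y) _; last first.
  by exists n => l nl; exact: nP.
move=> x Kx; have [d d0 [n nQ]] := Qloc x Kx.
exists (ball x d, [set l | (n <= l)%N]); first by split; [exact: nbhsx_ballx | exists n].
by move=> [y l] [/= xy nl]; exact: nQ.
Qed.

(** Points around which every rational interval carries at least [c] of
a bounded amount of mass are finite in number: rationals chosen between
consecutive such points cut out disjoint intervals. *)
Lemma finite_concentration {R : realType} (A : rat -> R) (c C : R) :
  0 < c -> (forall p q, A q - A p <= C) ->
  finite_set [set x : R | 0 < x < 1 /\ forall p q : rat,
    0 < (ratr p : R) -> ratr p < x -> x < ratr q -> (ratr q : R) < 1 ->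
    c <= A q - A p].
Proof.
move=> c0 AC; set J := [set x | _].
have chain (s : seq R) (q0 : rat) : 0 < (ratr q0 : R) < 1 ->
    path <%R (ratr q0) s -> (forall x, x \in s -> J x) ->
    exists q1, c * (size s)%:R <= A q1 - A q0.
  elim: s q0 => [|x s IH] q0 q01; first by exists q0; rewrite subrr mulr0.
  move=> /= /andP[q0x xs] sJ.
  have [/andP[x0 x1] xJ] := sJ x (mem_head _ _).
  have [q [xq q1 qs]] : exists q : rat, [/\ x < ratr q, (ratr q : R) < 1 & path <%R (ratr q) s].
    case: s xs sJ {IH} => [_ _|y s /= /andP[xy ys] sJ].
      by have [q] := rat_in_itvoo x1; rewrite in_itv/= => /andP[? ?]; exists q.
    have [/andP[_ y1] _] : J y by apply: sJ; rewrite !inE eqxx orbT.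
    have [q] := rat_in_itvoo xy; rewrite in_itv/= => /andP[xq qy].
    by exists q; split=> //; [exact: lt_trans y1 | rewrite /= qy].
  have [q1' Hq1] : exists q1, c * (size s)%:R <= A q1 - A q.
    apply: IH => //; first by rewrite q1 (lt_trans x0).
    by move=> y ys; apply: sJ; rewrite inE ys orbT.
  exists q1'; have := xJ q0 q; case/andP: q01 => q00 _ => /(_ q00 q0x xq q1) H.
  rewrite -natr1 mulrDr mulr1; lra.
apply: contrapT => Jinf.
have C0 : 0 <= C by rewrite -(subrr (A 0)) AC.
pose n := Num.bound (C / c).
have nC : C < c * n%:R.
  by rewrite mulrC -ltr_pdivrMr// archi_boundP// divr_ge0// ltW.
have [B BJ nB] := infinite_set_fset n Jinf.
pose s := sort <=%R (finmap.enum_fset B).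
have ss : sorted <%R s by rewrite sort_lt_sorted finmap.fset_uniq.
have sJ x : x \in s -> J x by rewrite mem_sort => xB; exact: BJ.
have ns : (n <= size s)%N by rewrite size_sort.
have [q1 [q0]] : exists q1 q0, c * (size s)%:R <= A q1 - A q0.
  case: s ss sJ ns => [_ _ _|x s /= xs sJ _]; first by exists 0, 0; rewrite mulr0 subrr.
  have [/andP[x0 x1] _] := sJ x (mem_head _ _).
  have [q0] := rat_in_itvoo x0; rewrite in_itv/= => /andP[q00 q0x].
  have [||//|q1 Hq1] := chain (x :: s) q0; first by rewrite q00 (lt_trans q0x).
    by rewrite /= q0x.
  by exists q1, q0.
apply/negP; rewrite -ltNge; apply: le_lt_trans (AC _ _) _; apply: lt_le_trans nC _.
by rewrite ler_wpM2l ?ler_nat// ltW.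
Qed.

(** * Components of an open set *)

(** Being in the same component of [U], for points of the line. *)
Definition joined {R : realType} (U : set R) (x y : R) : Prop :=
  forall t, Num.min x y <= t -> t <= Num.max x y -> U t.

Lemma joinedC {R : realType} (U : set R) (x y : R) : joined U x y -> joined U y x.
Proof. by move=> xy t; rewrite minC maxC; exact: xy. Qed.

Lemma joined_trans {R : realType} (U : set R) (x y z : R) :
  joined U x y -> joined U y z -> joined U x z.
Proof.
move=> xy yz t; rewrite ge_min le_max => h1 h2.
have [ty|yt] := leP t y.
  have [xt|tx] := leP x t.
    by apply: xy; rewrite ?ge_min ?le_max ?xt ?ty ?orbT.
  case/orP: h1 => [|zt]; first by rewrite leNgt tx.
  by apply: yz; rewrite ?ge_min ?le_max ?zt ?ty ?orbT.
have {}yt := ltW yt.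
have [tx|xt] := leP t x.
  by apply: xy; rewrite ?ge_min ?le_max ?yt ?tx ?orbT.
case/orP: h2 => [|tz]; first by rewrite leNgt xt.
by apply: yz; rewrite ?ge_min ?le_max ?yt ?tz ?orbT.
Qed.

Lemma joined_itv {R : realType} (U : set R) (x y : R) :
  x <= y -> `[x, y] `<=` U -> joined U x y.
Proof.
move=> xy xyU t; rewrite (min_idPl xy) (max_idPr xy) => xt ty.
by apply: xyU; rewrite /= in_itv/= xt.
Qed.

(** A base point of the component of [x].  It depends on the component only, so
constants attached to it are locally constant; and being rational, it takes
countably many values known before [U] is. *)
Definition anchor {R : realType} (U : set R) (x : R) : rat :=
  xget 0 [set q : rat | joined U x (ratr q)].

Lemma anchor_joined {R : realType} (U : set R) (x : R) :
  open U -> U x -> joined U x (ratr (anchor U x)).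
Proof.
move=> oU Ux; rewrite /anchor; set S := [set q | _].
have [q Sq] : exists q, S q.
  have /nbhs_ballP[d /= d0 xd] : nbhs x U by exact: open_nbhs_nbhs.
  have xdx : x < x + d by rewrite ltrDl.
  have [q] := rat_in_itvoo xdx; rewrite in_itv/= => /andP[xq qd].
  exists q; apply: joined_itv; first exact: ltW.
  move=> t /=; rewrite in_itv/= => /andP[xt tq]; apply: xd.
  by rewrite /ball/= ltr_distlC (le_lt_trans tq qd) andbT (lt_le_trans _ xt)// gtrDl oppr_lt0.
by apply: (xgetPex _ (ex_intro _ q Sq)).
Qed.

Lemma anchor_eq {R : realType} (U : set R) (x y : R) :
  joined U x y -> anchor U x = anchor U y.
Proof.
move=> xy; rewrite /anchor; congr xget; apply/seteqP; split=> q /=.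
  exact: (joined_trans _ _ _ _ (joinedC _ _ _ xy)).
exact: (joined_trans _ _ _ _ xy).
Qed.

(** * The angular velocity *)

(** [Im (u' / u)], with the modulus truncated from below so that it makes sense
and is square-integrable everywhere. *)
Definition angular_velocity {R : realType} (u1 u2 p1 p2 : R -> R) (x : R) : R :=
  (u1 x * p2 x - u2 x * p1 x) / Num.max (u1 x ^+ 2 + u2 x ^+ 2) 4^-1.

Lemma angular_velocityE {R : realType} (u1 u2 p1 p2 : R -> R) (x : R) :
  4^-1 < u1 x ^+ 2 + u2 x ^+ 2 ->
  (u1 x ^+ 2 + u2 x ^+ 2) * angular_velocity u1 u2 p1 p2 x =
  u1 x * p2 x - u2 x * p1 x.
Proof.
move=> s4; rewrite /angular_velocity (max_idPl (ltW s4)) mulrC divfK//.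
by rewrite gt_eqF// (lt_trans _ s4)// invr_gt0.
Qed.

(** The momentum is within an [L^2]-bounded distance of the constant [2 pi N]. *)
Lemma angular_velocity_sqr {R : realType} (L : R) N (eps : R)
    (u1 u2 p1 p2 : R -> R) (x : R) : 0 < L -> 0 < eps ->
  angular_velocity u1 u2 p1 p2 x ^+ 2 <=
  64 / L * density L N eps u1 u2 p1 p2 x + 32 * (2 * pi * N%:R) ^+ 2.
Proof.
move=> L0 e0; rewrite /angular_velocity /density.
set X := u1 x * p2 x - u2 x * p1 x; set c := 2 * pi * N%:R.
set m := Num.max _ _; set P := p1 x ^+ 2 + p2 x ^+ 2; set s1 := (_ - 1) ^+ 2.
have m4 : 4^-1 <= m by rewrite le_max lexx orbT.
have m0 : 0 < m by apply: lt_le_trans m4; rewrite invr_gt0.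
have P0 : 0 <= P by rewrite addr_ge0// sqr_ge0.
have h1 : (X / m) ^+ 2 <= 16 * X ^+ 2.
  rewrite expr_div_n ler_pdivrMr ?exprn_gt0//.
  have m16 : 1 <= 16 * m ^+ 2 by nra.
  by rewrite mulrAC ler_peMl// sqr_ge0.
have h2 : 64 / L * (eps / 2 * P + (4 * eps)^-1 * s1 + L / 2 * (X - c) ^+ 2) >=
    32 * (X - c) ^+ 2.
  have -> : 32 * (X - c) ^+ 2 = 64 / L * (L / 2 * (X - c) ^+ 2).
    by field; exact: lt0r_neq0.
  rewrite ler_pM2l ?divr_gt0// lerDr addr_ge0// mulr_ge0//.
  - by rewrite divr_ge0// ltW.
  - by rewrite invr_ge0 mulr_ge0// ltW.
  - exact: sqr_ge0.
have h3 : 16 * X ^+ 2 <= 32 * (X - c) ^+ 2 + 32 * c ^+ 2.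
  have := sqr_ge0 (X - 2 * c); lra.
lra.
Qed.

Lemma angular_velocity_bound {R : realType} (L : R) N (eps C0 : R)
    (u1 u2 p1 p2 : R -> R) : 0 < L -> 0 < eps ->
  primitive_on `]0, 1[ u1 p1 -> primitive_on `]0, 1[ u2 p2 ->
  square_integrable `]0, 1[ p1 -> square_integrable `]0, 1[ p2 ->
  integrable_on `]0, 1[ (density L N eps u1 u2 p1 p2) ->
  \int[lebesgue]_(x in `]0, 1[) density L N eps u1 u2 p1 p2 x <= C0 ->
  square_integrable `]0, 1[ (angular_velocity u1 u2 p1 p2) /\
  \int[lebesgue]_(x in `]0, 1[) angular_velocity u1 u2 p1 p2 x ^+ 2 <=
    64 / L * C0 + 32 * (2 * pi * N%:R) ^+ 2.
Proof.
move=> L0 e0 P1 P2 [mp1 _] [mp2 _] di dC.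
have oI : open (`]0, 1[%classic : set R) by exact: interval_open.
have mI : measurable_set (`]0, 1[ : set R) by exact: measurable_set_itv.
have Ifin : (@lebesgue_measure R `]0%R, 1%R[ < +oo)%E by rewrite lebesgue_itv01 ltry.
have c1 x : `]0, 1[%classic x -> {for x, continuous u1}.
  by move=> Ix; exact: (primitive_on_continuous_at _ _ _ _ oI P1 Ix).
have c2 x : `]0, 1[%classic x -> {for x, continuous u2}.
  by move=> Ix; exact: (primitive_on_continuous_at _ _ _ _ oI P2 Ix).
have m1 := primitive_on_measurable _ _ _ oI P1.
have m2 := primitive_on_measurable _ _ _ oI P2.
have mo : measurable_on `]0, 1[ (angular_velocity u1 u2 p1 p2).
  apply: measurable_funM.
    by apply: measurable_funB; exact: measurable_funM.
  apply: open_continuous_measurable_fun => // x; rewrite inE => Ix.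
  have cm : {for x, continuous (fun y => Num.max (u1 y ^+ 2 + u2 y ^+ 2) (4^-1 : R))}.
    apply: (@continuous_max _ _ (fun y => u1 y ^+ 2 + u2 y ^+ 2) (fun=> 4^-1)).
      apply: cvgD; under eq_fun do rewrite expr2; rewrite expr2; apply: cvgM.
      - exact: c1.
      - exact: c1.
      - exact: c2.
      - exact: c2.
    exact: cvg_cst.
  apply: cvgV; last exact: cm.
  by rewrite gt_eqF// lt_max invr_gt0 ltr0n orbT.
pose b x := 64 / L * density L N eps u1 u2 p1 p2 x + 32 * (2 * pi * N%:R) ^+ 2.
have cst_i : integrable_on `]0, 1[ (fun=> 32 * (2 * pi * N%:R) ^+ 2 : R).
  exact: integrable_on_cst.
have bi : integrable_on `]0, 1[ b.
  by apply: integrable_onD => //; exact: integrable_onZ.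
have osq : square_integrable `]0, 1[ (angular_velocity u1 u2 p1 p2).
  split=> //; apply: (le_integrable_on _ _ b) => //.
    exact: measurable_funX.
  by move=> x _; rewrite ger0_norm ?sqr_ge0//; exact: angular_velocity_sqr.
split=> //; have [_ o2] := osq.
apply: (@le_trans _ _ (\int[lebesgue]_(x in `]0, 1[) b x)).
  by apply: le_Rintegral => // x _; exact: angular_velocity_sqr.
rewrite /b RintegralD//; last exact: integrable_onZ.
rewrite Rintegral_cst// RintegralZl//= lebesgue_itv01 mulr1 lerD2r.
by rewrite ler_wpM2l// divr_ge0// ltW.
Qed.

(** Integrating from 0, outside [`]0, 1[], gives one primitive for all components. *)
Definition cumul {R : realType} (g : R -> R) (x : R) : R :=
  \int[lebesgue]_(t in `[0, x]) (g \_ `]0, 1[) t.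

Lemma cumul_primitive {R : realType} (g : R -> R) :
  integrable_on `]0, 1[ g -> primitive_on `]0, 1[ (cumul g) g.
Proof.
move=> gi x y xy xyI.
have gpi z : integrable_on `[0, z] (g \_ `]0, 1[).
  by apply: integrable_on_patch => //; exact: measurable_set_itv.
have x0 : 0 <= x.
  by have /= := xyI x; rewrite !in_itv/= lexx xy => /(_ isT)/andP[/ltW].
split; first exact: (integrable_onS _ _ _ (measurable_set_itv _) (measurable_set_itv _) xyI gi).
have [|_ ->] := primitive_on_integral _ _ _ (gpi y) x y xy.
  exact: subset_itvcc.
by apply: eq_Rintegral_on => t /xyI It; rewrite patchE mem_set.
Qed.

Lemma cumul_bound {R : realType} (g : R -> R) (x : R) :
  integrable_on `]0, 1[ g ->
  `|cumul g x| <= \int[lebesgue]_(t in `]0, 1[) `|g t|.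
Proof.
move=> gi.
have gpT : integrable_on setT (g \_ `]0, 1[).
  by apply: integrable_on_patch => //; exact: measurable_set_itv.
have gpi : integrable_on `[0, x] (g \_ `]0, 1[).
  by apply: integrable_onS gpT => //; exact: measurable_set_itv.
apply: le_trans (le_normr_Rintegral _ gpi) _ => //.
have E : (fun t => `|(g \_ `]0, 1[) t|) = (fun t => `|g t|) \_ `]0, 1[.
  by apply/funext => t; rewrite !patchE; case: ifPn => // _; rewrite normr0.
rewrite [leRHS]Rintegral_mkcond -E; apply: Rintegral_subset_le => //.
exact: integrable_norm.
Qed.

Lemma cumul_le {R : realType} (g : R -> R) (x y : R) :
  integrable_on `]0, 1[ g -> (forall t, `]0, 1[%classic t -> 0 <= g t) ->
  cumul g y - cumul g x <= \int[lebesgue]_(t in `]0, 1[) g t.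
Proof.
move=> gi g0; apply: (@le_trans _ _ (cumul g y)).
  rewrite lerBlDr lerDl; apply: Rintegral_ge0 => t _; rewrite patchE.
  by case: ifPn => //; rewrite inE; exact: g0.
apply: le_trans (ler_norm _) _; apply: (le_trans (cumul_bound _ _ gi)).
rewrite le_eqVlt; apply/orP; left; apply/eqP; apply: eq_Rintegral_on => t It.
by rewrite ger0_norm// g0.
Qed.

Lemma cumul_modulus {R : realType} (g : R -> R) (M k x y : R) :
  square_integrable `]0, 1[ g ->
  \int[lebesgue]_(t in `]0, 1[) g t ^+ 2 <= M -> 0 < k ->
  `]0, 1[%classic x -> `]0, 1[%classic y ->
  `|cumul g y - cumul g x| <= (k * `|y - x| + k^-1 * M) / 2.
Proof.
move=> gsq gM k0; wlog xy : x y / x <= y.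
  move=> H Ix Iy; have [|/ltW yx] := leP x y; first by move=> xy; exact: H.
  by rewrite distrC [`|y - x|]distrC; exact: H.
move=> Ix Iy.
have mI : measurable_set (`]0, 1[ : set R) by exact: measurable_set_itv.
have Ifin : (@lebesgue_measure R `]0%R, 1%R[ < +oo)%E by rewrite lebesgue_itv01 ltry.
have gi := square_integrable_integrable _ _ mI Ifin gsq.
have sub : `[x, y] `<=` `]0, 1[.
  move=> t; move: Ix Iy; rewrite /= !in_itv/= => /andP[x0 _] /andP[_ y1] /andP[xt ty].
  by rewrite (lt_le_trans x0 xt) (le_lt_trans ty y1).
have mxy : measurable_set (`[x, y] : set R) by exact: measurable_set_itv.
have gxy : square_integrable `[x, y] g by exact: square_integrableS sub gsq.
have mul : @lebesgue_measure R `[x, y] = (y - x)%:E.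
  rewrite lebesgue_measure_itv/= lte_fin.
  by move: xy; rewrite le_eqVlt => /predU1P[->|->//]; rewrite ltxx subrr.
have xyfin : (@lebesgue_measure R `[x, y] < +oo)%E by rewrite mul ltry.
have [gixy ->] := cumul_primitive _ gi x y xy sub.
apply: le_trans (le_normr_Rintegral _ gixy) _ => //.
apply: (le_trans (Rintegral_norm_le _ _ _ mxy xyfin k0 gxy)).
rewrite mul /= (ger0_norm (x := y - x)) ?subr_ge0//.
rewrite ler_pM2r ?invr_gt0// lerD2l ler_pM2l ?invr_gt0//.
apply: le_trans gM; have [_ g2] := gsq.
by apply: Rintegral_subset_le => // t _; exact: sqr_ge0.
Qed.

(** Square-integrable densities make their primitives equicontinuous, so that
pointwise convergence on the rationals is convergence everywhere. *)
Lemma cumul_cvg {R : realType} (g_ : nat -> R -> R) (M : R) (A : rat -> R) (x : R) :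
  (forall l, square_integrable `]0, 1[ (g_ l)) ->
  (forall l, \int[lebesgue]_(t in `]0, 1[) g_ l t ^+ 2 <= M) ->
  (forall q : rat, (fun l => cumul (g_ l) (ratr q)) @ \oo --> A q) ->
  `]0, 1[%classic x -> cvgn (fun l => cumul (g_ l) x).
Proof.
move=> gsq gM gA Ix.
have M0 : 0 <= M by apply: le_trans (gM 0%N); apply: Rintegral_ge0 => t _; exact: sqr_ge0.
apply/cauchy_cvgP/cauchy_exP => e e0.
pose k := 2 * (M + 1) / e.
have k0 : 0 < k by rewrite divr_gt0// mulr_gt0// ltr_wpDl.
have kM : k^-1 * M <= e / 2.
  rewrite /k invf_div mulrAC ler_pdivrMr ?mulr_gt0// ?ltr_wpDl//.
  nra.
have : x < Num.min 1 (x + e / (4 * k)).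
  by move: Ix; rewrite /= in_itv/= lt_min ltrDl => /andP[_ ->]; rewrite divr_gt0// mulr_gt0.
move=> /rat_in_itvoo[q]; rewrite in_itv/= lt_min => /andP[xq /andP[q1 qx]].
have Iq : `]0, 1[%classic (ratr q : R).
  by move: Ix; rewrite /= !in_itv/= => /andP[x0 _]; rewrite (lt_trans x0 xq).
have close l : `|cumul (g_ l) x - cumul (g_ l) (ratr q)| <= 3 * e / 8.
  apply: (le_trans (cumul_modulus _ M k _ _ (gsq l) (gM l) k0 Iq Ix)).
  have : k * `|x - ratr q| <= e / 4.
    rewrite distrC ger0_norm ?subr_ge0; last exact: ltW.
    have : ratr q - x <= e / (4 * k) by lra.
    rewrite -(ler_pM2l k0) => /le_trans; apply.
    by rewrite le_eqVlt; apply/orP; left; apply/eqP; field; exact: lt0r_neq0.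
  lra.
have e8 : 0 < e / 8 by rewrite divr_gt0.
exists (A q); have /cvgrPdist_le/(_ _ e8) := gA q.
apply: filterS => l lA; rewrite /ball/=.
have := close l; move: lA; rewrite ltr_norml !ler_norml => /andP[? ?] /andP[? ?].
by apply/andP; split; lra.
Qed.

(** * Distance to the limit map *)

(** Used where no phase is available: up to a term controlled by the potential, the
distance to the unit circle is bounded by a constant. *)
Lemma dist_circle {R : realType} (a b v : R) :
  (a - cos v) ^+ 2 + (b - sin v) ^+ 2 <= 2 * (a ^+ 2 + b ^+ 2 - 1) ^+ 2 + 9 / 2.
Proof.
have cs := cos2Dsin2 v; set s := a ^+ 2 + b ^+ 2.
have h1 : (a - cos v) ^+ 2 + (b - sin v) ^+ 2 <= 2 * s + 2.
  rewrite /s -subr_ge0; move: cs => /(congr1 (fun z => 2 * z)) cs.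
  have -> : 2 * (a ^+ 2 + b ^+ 2) + 2 - ((a - cos v) ^+ 2 + (b - sin v) ^+ 2) =
    (a + cos v) ^+ 2 + (b + sin v) ^+ 2 + (2 * 1 - 2 * (cos v ^+ 2 + sin v ^+ 2)) by ring.
  by rewrite cs subrr addr0 addr_ge0// sqr_ge0.
have := sqr_ge0 (s - 3 / 2); lra.
Qed.

(** Used where a phase is available: up to a term controlled by the potential, the
distance is that of the phases. *)
Lemma dist_circle_polar {R : realType} (n t v : R) : 0 <= n ->
  (n * cos t - cos v) ^+ 2 + (n * sin t - sin v) ^+ 2 <=
  2 * ((n * cos t) ^+ 2 + (n * sin t) ^+ 2 - 1) ^+ 2
  + 2 * ((cos t - cos v) ^+ 2 + (sin t - sin v) ^+ 2).
Proof.
move=> n0; have cs := cos2Dsin2 t.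
have -> : (n * cos t) ^+ 2 + (n * sin t) ^+ 2 = n ^+ 2.
  by rewrite !exprMn -mulrDr cs mulr1.
have h1 : (n - 1) ^+ 2 <= (n ^+ 2 - 1) ^+ 2.
  have -> : (n ^+ 2 - 1) ^+ 2 = (n - 1) ^+ 2 * (n + 1) ^+ 2 by ring.
  rewrite ler_peMr ?sqr_ge0//; nra.
have h2 (p q : R) : (n * p - q) ^+ 2 <= 2 * ((n - 1) ^+ 2 * p ^+ 2) + 2 * (p - q) ^+ 2.
  have := sqr_ge0 ((n - 1) * p - (p - q)); nra.
have := h2 (cos t) (cos v); have := h2 (sin t) (sin v).
have : (n - 1) ^+ 2 * cos t ^+ 2 + (n - 1) ^+ 2 * sin t ^+ 2 = (n - 1) ^+ 2.
  by rewrite -mulrDr cs mulr1.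
lra.
Qed.

(** * Compactness *)

Definition energy_data {R : realType} (L : R) (N : nat) (C0 eps : R)
    (u : R -> R * R) (p : (R -> R) * (R -> R)) : Prop :=
  let u1 := fun x => (u x).1 in let u2 := fun x => (u x).2 in
  [/\ 0 < eps,
      primitive_on `]0, 1[ u1 p.1 /\ primitive_on `]0, 1[ u2 p.2,
      square_integrable `]0, 1[ p.1 /\ square_integrable `]0, 1[ p.2,
      integrable_on `]0, 1[ (density L N eps u1 u2 p.1 p.2) &
      \int[lebesgue]_(x in `]0, 1[) density L N eps u1 u2 p.1 p.2 x <= C0].

Definition dens {R : realType} (L : R) (N : nat) (eps : R) (u : R -> R * R)
    (p : (R -> R) * (R -> R)) : R -> R :=
  density L N eps (fun x => (u x).1) (fun x => (u x).2) p.1 p.2.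

Definition angvel {R : realType} (u : R -> R * R) (p : (R -> R) * (R -> R)) :
    R -> R :=
  angular_velocity (fun x => (u x).1) (fun x => (u x).2) p.1 p.2.

(** Energies of a fixed rational interval converge, so a limit energy below 1/32 is
below 1/32 from some rank on and [modulus_gap] applies. *)
Lemma gap_near {R : realType} (L : R) (N : nat) (C0 : R) (eps : nat -> R)
    (u_ : nat -> R -> R * R) (p_ : nat -> (R -> R) * (R -> R))
    (A : rat -> R) (x : R) (p q : rat) :
  0 < L -> (forall l, energy_data L N C0 (eps l) (u_ l) (p_ l)) ->
  eps @ \oo --> 0 ->
  (forall r : rat, (fun l => cumul (dens L N (eps l) (u_ l) (p_ l)) (ratr r))
     @ \oo --> A r) ->
  0 < (ratr p : R) -> ratr p < x -> x < ratr q -> (ratr q : R) < 1 ->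
  A q - A p < 32^-1 ->
  exists2 d : R, 0 < d & exists n, forall l, (n <= l)%N -> forall y,
    `|x - y| < d -> 4^-1 < enorm (u_ l y) ^+ 2.
Proof.
move=> L0 data eps0 cA p0 px xq q1 Apq.
exists (Num.min (x - ratr p) (ratr q - x)); first by rewrite lt_min !subr_gt0 px.
have pq : (ratr p : R) < ratr q by exact: lt_trans xq.
have sub : `[ratr p, ratr q] `<=` (`]0, 1[%classic : set R).
  move=> t; rewrite /= !in_itv/= => /andP[pt tq].
  by rewrite (lt_le_trans p0 pt) (le_lt_trans tq q1).
pose m l (r : rat) := cumul (dens L N (eps l) (u_ l) (p_ l)) (ratr r).
have cD : (fun l => m l q - m l p) @ \oo --> A q - A p.
  by apply: cvgB; exact: cA.
have g0 : 0 < 32^-1 - (A q - A p) by rewrite subr_gt0.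
have d0 : 0 < 2 * (ratr q - ratr p) :> R by rewrite mulr_gt0// subr_gt0.
have /cvgrPdist_lt/(_ _ g0)[n1 _ H1] := cD.
have /cvgrPdist_lt/(_ _ d0)[n2 _ H2] := eps0.
exists (maxn n1 n2) => l; rewrite geq_max => /andP[nl1 nl2] y.
rewrite lt_min => /andP[yp yq].
have [e0 [P1 P2] _ di _] := data l.
have := H2 l nl2; rewrite /= sub0r normrN gtr0_norm// => el.
have := H1 l nl1; rewrite /= ltr_norml => /andP[H1a _].
rewrite enorm_sqr; apply: (modulus_gap L N (eps l) (fun x => (u_ l x).1)
  (fun x => (u_ l x).2) (p_ l).1 (p_ l).2 (ratr p) (ratr q)) => //.
- exact: ltW.
- exact: primitive_onS sub P1.
- exact: primitive_onS sub P2.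
- exact: (integrable_onS _ _ _ (measurable_set_itv _) (measurable_set_itv _) sub di).
- have [_ <-] := cumul_primitive _ di _ _ (ltW pq) sub.
  move: H1a; rewrite /m /dens; lra.
- move: yp; rewrite ltr_norml => /andP[? ?]; lra.
- move: yq; rewrite ltr_norml => /andP[? ?]; lra.
Qed.

(** The phase obtained by integrating the angular velocity [om] from the base point of
the component, where it takes the value prescribed by [tau]. *)
Definition lifted_phase {R : realType} (U : set R) (tau : rat -> R) (om : R -> R)
    (x : R) : R :=
  tau (anchor U x) + (cumul om x - cumul om (ratr (anchor U x))).

Lemma lifted_phase_primitive {R : realType} (U : set R) (tau : rat -> R)
    (om : R -> R) :
  U `<=` `]0, 1[ -> integrable_on `]0, 1[ om ->
  primitive_on U (lifted_phase U tau om) om.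
Proof.
move=> UI oi x y xy xyU.
have [oxy E] := cumul_primitive _ oi x y xy (subset_trans xyU UI).
split=> //; rewrite /lifted_phase (anchor_eq U x y); last exact: joined_itv.
by rewrite -E; ring.
Qed.

(** From some rank on, the modulus stays above 1/2 on a compact segment that contains
both a neighbourhood of [x] and the base point of its component; there
[polar_transport] carries the polar form from the base point. *)
Lemma lift_near {R : realType} (L : R) (N : nat) (C0 : R) (eps : nat -> R)
    (u_ : nat -> R -> R * R) (p_ : nat -> (R -> R) * (R -> R))
    (tau_ : nat -> rat -> R) (U : set R) (x : R) :
  0 < L -> (forall l, energy_data L N C0 (eps l) (u_ l) (p_ l)) ->
  open U -> U `<=` `]0, 1[ ->
  (forall z, U z -> exists2 d : R, 0 < d & exists n, forall l, (n <= l)%N ->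
     forall y, `|z - y| < d -> 4^-1 < enorm (u_ l y) ^+ 2) ->
  (forall l q, u_ l (ratr q) = (enorm (u_ l (ratr q)) * cos (tau_ l q),
                                enorm (u_ l (ratr q)) * sin (tau_ l q))) ->
  U x ->
  exists2 d : R, 0 < d & exists n, forall l, (n <= l)%N -> forall y,
    `|x - y| < d ->
    let th := lifted_phase U (tau_ l) (angvel (u_ l) (p_ l)) y in
    0 < enorm (u_ l y) /\
    u_ l y = (enorm (u_ l y) * cos th, enorm (u_ l y) * sin th).
Proof.
move=> L0 data oU UI gap tauP Ux.
have /nbhs_ballP[d0 /= d00 xd0] : nbhs x U by exact: open_nbhs_nbhs.
pose r : R := ratr (anchor U x).
have xr : joined U x r by exact: anchor_joined.
have xball y : `|x - y| < d0 -> joined U x y.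
  move=> xy t tmin tmax; apply: xd0; rewrite /ball/=.
  move: tmin tmax xy; rewrite ge_min le_max !ltr_norml.
  by move=> /orP[?|?] /orP[?|?] /andP[? ?]; apply/andP; split; lra.
pose a := Num.min r (x - d0 / 2); pose b := Num.max r (x + d0 / 2).
have xa : joined U x a.
  rewrite /a; case: leP => // _; apply: xball.
  rewrite opprB addrCA subrr addr0 gtr0_norm; lra.
have xb : joined U x b.
  rewrite /b; case: leP => // _; apply: xball.
  rewrite opprD addrA subrr add0r normrN gtr0_norm; lra.
have ax : a <= x - d0 / 2 by rewrite ge_min lexx orbT.
have bx : x + d0 / 2 <= b by rewrite le_max lexx orbT.
have ar : a <= r by rewrite ge_min lexx.
have rb : r <= b by rewrite le_max lexx.
have ab : a <= b by exact: le_trans rb.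
have abU : `[a, b] `<=` U.
  move=> t; rewrite /= in_itv/= => /andP[at_ tb].
  apply: (joined_trans _ _ _ _ (joinedC _ _ _ xa) xb).
    by rewrite (min_idPl ab).
  by rewrite (max_idPr ab).
have [n nP] := compact_eventually `[a, b] (fun l y => 4^-1 < enorm (u_ l y) ^+ 2)
  (@segment_compact R a b) (fun z zab => gap z (abU z zab)).
exists (d0 / 2); first by rewrite divr_gt0.
exists n => l nl y xy; cbv zeta; set th := lifted_phase _ _ _ y.
have [e0 [P1 P2] [s1 s2] di dC] := data l.
have [osq _] := angular_velocity_bound L N _ C0 _ _ _ _ L0 e0 P1 P2 s1 s2 di dC.
have mI : measurable_set (`]0, 1[ : set R) by exact: measurable_set_itv.
have Ifin : (@lebesgue_measure R `]0%R, 1%R[ < +oo)%E by rewrite lebesgue_itv01 ltry.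
have oi := square_integrable_integrable _ _ mI Ifin osq.
have sub := subset_trans abU UI.
have s4 t : a <= t -> t <= b -> 4^-1 < (u_ l t).1 ^+ 2 + (u_ l t).2 ^+ 2.
  by move=> at_ tb; rewrite -enorm_sqr; apply: nP => //; rewrite /= in_itv/= at_.
have /andP[ay yb] : a <= y <= b.
  by move: xy; rewrite ltr_norml => /andP[? ?]; apply/andP; split; lra.
have [|t at_ tb|rr rr0 [E1 E2]] := polar_transport a b _ _ _ _ _ _ ab
    (primitive_onS _ _ _ _ sub P1) (primitive_onS _ _ _ _ sub P2)
    (primitive_onS _ _ _ _ sub (cumul_primitive _ oi)) _ _ r y ar rb ay yb.
- by move=> t at_ tb; apply: lt_trans (s4 t at_ tb); rewrite invr_gt0.
- by rewrite angular_velocityE//; exact: s4.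
have rho0 : 0 < enorm (u_ l r).
  rewrite lt0r sqrtr_ge0 andbT; have := s4 r ar rb; rewrite -enorm_sqr.
  by apply: contraTneq => ->; rewrite expr0n/= -leNgt invr_ge0.
have ay' : anchor U y = anchor U x.
  by apply: anchor_eq; apply: joinedC; apply: xball; lra.
have := tauP l (anchor U x); rewrite -/r; set rho := enorm _ in rho0 * => ur.
move: E1 E2; rewrite ur /=; set D := cumul _ y - cumul _ r => E1 E2.
have thE : th = tau_ l (anchor U x) + D by rewrite /th /lifted_phase ay'.
have F1 : (u_ l y).1 = rr * rho * cos th by rewrite E1 thE cosD; ring.
have F2 : (u_ l y).2 = rr * rho * sin th by rewrite E2 thE sinD; ring.
have nu : enorm (u_ l y) = rr * rho.
  rewrite /enorm F1 F2 !exprMn -mulrDr cos2Dsin2 mulr1 -exprMn sqrtr_sqr.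
  by rewrite gtr0_norm// mulr_gt0.
rewrite nu; split; first by rewrite mulr_gt0.
by rewrite -F1 -F2; case: (u_ l y).
Qed.

Lemma square_integrableM_bounded {R : realType} (D : set R) (M : R)
    (h f : R -> R) :
  measurable_set D -> measurable_on D h -> (forall x, D x -> `|h x| <= M) ->
  square_integrable D f -> square_integrable D (fun x => h x * f x).
Proof.
move=> mD mh hM [mf f2]; split; first exact: measurable_funM.
apply: (eq_integrable_on _ (fun x => h x ^+ 2 * f x ^+ 2)) => //.
  by move=> x _; rewrite exprMn.
apply: (integrable_onM_bounded _ (M ^+ 2)) => //; first exact: measurable_funX.
move=> x Dx; rewrite ger0_norm ?sqr_ge0// -[_ ^+ 2](real_normK (num_real _)).
by have hx := hM x Dx; rewrite ler_pXn2r// nnegrE (le_trans _ hx).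
Qed.

Lemma measurable_enorm_sqr {R : realType} (D : set R) (u : R -> R * R) :
  measurable_on D (fun x => (u x).1) -> measurable_on D (fun x => (u x).2) ->
  measurable_on D (fun x => enorm (u x) ^+ 2).
Proof.
move=> m1 m2; under eq_fun do rewrite enorm_sqr.
by apply: measurable_funD; exact: measurable_funX.
Qed.

Lemma finite_measurable {R : realType} (J : set R) :
  finite_set J -> measurable_set J.
Proof.
move=> Jfin; apply: countable_measurable; last exact: finite_set_countable.
by move=> t; exact: measurable_set1.
Qed.

Lemma finite_measurable_fun {R : realType} (J : set R) (f : R -> R) :
  finite_set J -> measurable_on J f.
Proof.
move=> Jfin _ Y mY; apply: finite_measurable.
by apply: sub_finite_set Jfin; exact: subIsetl.
Qed.

Lemma potential_bound {R : realType} (L : R) (N : nat) (C0 eps : R)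
    (u : R -> R * R) (p : (R -> R) * (R -> R)) :
  0 < L -> energy_data L N C0 eps u p ->
  integrable_on `]0, 1[ (fun x => (enorm (u x) ^+ 2 - 1) ^+ 2) /\
  \int[lebesgue]_(x in `]0, 1[) (enorm (u x) ^+ 2 - 1) ^+ 2 <= 4 * eps * C0.
Proof.
move=> L0 [e0 [P1 P2] _ di dC].
have mI : measurable_set (`]0, 1[ : set R) by exact: measurable_set_itv.
have oI : open (`]0, 1[%classic : set R) by exact: interval_open.
have le x : (enorm (u x) ^+ 2 - 1) ^+ 2 <= 4 * eps * dens L N eps u p x.
  rewrite enorm_sqr /dens /density.
  set s := (_ - 1) ^+ 2; set P := _ + _ ^+ 2; set X := (_ - _ * N%:R) ^+ 2.
  have P0 : 0 <= P by rewrite addr_ge0// sqr_ge0.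
  have X0 : 0 <= X by exact: sqr_ge0.
  have -> : 4 * eps * (eps / 2 * P + (4 * eps)^-1 * s + L / 2 * X) =
      s + (2 * eps ^+ 2 * P + 2 * eps * L * X) by field; exact: lt0r_neq0.
  rewrite lerDl addr_ge0// mulr_ge0// ?mulr_ge0// ?exprn_ge0// ltW//.
have si : integrable_on `]0, 1[ (fun x => (enorm (u x) ^+ 2 - 1) ^+ 2).
  apply: (le_integrable_on _ _ (fun x => 4 * eps * dens L N eps u p x)) => //.
  - apply: measurable_funX; apply: measurable_funB => //.
    by apply: measurable_enorm_sqr; [exact: (primitive_on_measurable _ _ _ oI P1) |
      exact: (primitive_on_measurable _ _ _ oI P2)].
  - by move=> x _; rewrite ger0_norm ?sqr_ge0.
  - exact: integrable_onZ.
split=> //.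
apply: (@le_trans _ _ (\int[lebesgue]_(x in `]0, 1[) (4 * eps * dens L N eps u p x))).
  by apply: le_Rintegral => //; exact: integrable_onZ.
by rewrite RintegralZl// ler_wpM2l// mulr_ge0// ltW.
Qed.

(** The squared distance is at most twice the potential, which tends to 0 in [L^1], plus
a remainder [b] that is bounded by [dist_circle] and tends to 0 pointwise by
[dist_circle_polar]. *)
Lemma L2_limit {R : realType} (L : R) (N : nat) (C0 : R) (eps : nat -> R)
    (u_ : nat -> R -> R * R) (p_ : nat -> (R -> R) * (R -> R)) (J : set R)
    (theta_ : nat -> R -> R) (theta : R -> R) :
  let U := `]0, 1[ `\` J in
  0 < L -> (forall l, energy_data L N C0 (eps l) (u_ l) (p_ l)) ->
  eps @ \oo --> 0 -> finite_set J -> open U ->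
  (forall x, U x -> theta_ ^~ x @ \oo --> theta x) ->
  (forall x, U x -> {for x, continuous theta}) ->
  (forall x, U x -> \forall l \near \oo, u_ l x =
     (enorm (u_ l x) * cos (theta_ l x), enorm (u_ l x) * sin (theta_ l x))) ->
  L2_cvg01 u_ (fun x => expi (theta x)).
Proof.
move=> U L0 data eps0 Jfin oU thc cth lift.
have mI : measurable_set (`]0, 1[ : set R) by exact: measurable_set_itv.
have oI : open (`]0, 1[%classic : set R) by exact: interval_open.
have mU : measurable_set U by exact: open_measurable.
have UI : U `<=` `]0, 1[ by move=> x [].
have Ufin := sub_itv01 U oU UI.
have m1 l : measurable_on `]0, 1[ (fun x => (u_ l x).1).
  have [_ [P1 _] _ _ _] := data l.
  exact: (primitive_on_measurable _ _ _ oI P1).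
have m2 l : measurable_on `]0, 1[ (fun x => (u_ l x).2).
  have [_ [_ P2] _ _ _] := data l.
  exact: (primitive_on_measurable _ _ _ oI P2).
have mc : measurable_on U (fun x => cos (theta x)).
  apply: open_continuous_measurable_fun => // x; rewrite inE => Ux.
  by apply: continuous_comp; [exact: cth | exact: continuous_cos].
have ms : measurable_on U (fun x => sin (theta x)).
  apply: open_continuous_measurable_fun => // x; rewrite inE => Ux.
  by apply: continuous_comp; [exact: cth | exact: continuous_sin].
pose d l x := ((u_ l x).1 - cos (theta x)) ^+ 2 + ((u_ l x).2 - sin (theta x)) ^+ 2.
pose w l x := (enorm (u_ l x) ^+ 2 - 1) ^+ 2.
pose b l x := Num.max 0 (d l x - 2 * w l x).
have mw l : measurable_on U (w l).
  apply: measurable_funX; apply: measurable_funB => //.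
  by apply: measurable_enorm_sqr; exact: (measurable_funS mI UI).
have md l : measurable_on U (d l).
  by apply: measurable_funD; apply: measurable_funX; apply: measurable_funB => //;
    exact: (measurable_funS mI UI).
have mb l : measurable_on U (b l).
  by apply: measurable_maxr => //; apply: measurable_funB => //; exact: measurable_funM.
have b0 l x : 0 <= b l x by rewrite /b le_max lexx.
have b92 l x : b l x <= 9 / 2.
  rewrite /b ge_max; apply/andP; split; first by lra.
  rewrite /d /w enorm_sqr; have := dist_circle (u_ l x).1 (u_ l x).2 (theta x); lra.
have bcvg x : U x -> b ^~ x @ \oo --> 0.
  move=> Ux.
  pose g l := 2 * ((cos (theta_ l x) - cos (theta x)) ^+ 2 +
                   (sin (theta_ l x) - sin (theta x)) ^+ 2).
  have g0 : g @ \oo --> 0.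
    have Cc : (fun l => cos (theta_ l x) - cos (theta x)) @ \oo --> 0.
      rewrite -(subrr (cos (theta x))); apply: cvgB; last exact: cvg_cst.
      by apply: (continuous_cvg _ (@continuous_cos R _)); exact: thc.
    have Cs : (fun l => sin (theta_ l x) - sin (theta x)) @ \oo --> 0.
      rewrite -(subrr (sin (theta x))); apply: cvgB; last exact: cvg_cst.
      by apply: (continuous_cvg _ (@continuous_sin R _)); exact: thc.
    rewrite (_ : 0 = 2 * (0 * 0 + 0 * 0)); last by ring.
    by apply: cvgM; [exact: cvg_cst | apply: cvgD; apply: cvgM].
  apply: (@squeeze_cvgr _ _ _ _ (fun=> 0) g) => //; last exact: cvg_cst.
  apply: filterS (lift x Ux) => l ul; rewrite b0/= /b ge_max; apply/andP; split.
    by rewrite mulr_ge0// addr_ge0// sqr_ge0.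
  have n0 : 0 <= enorm (u_ l x) by exact: sqrtr_ge0.
  have := dist_circle_polar (enorm (u_ l x)) (theta_ l x) (theta x) n0.
  have -> : enorm (u_ l x) * cos (theta_ l x) = (u_ l x).1 by rewrite [in RHS]ul.
  have -> : enorm (u_ l x) * sin (theta_ l x) = (u_ l x).2 by rewrite [in RHS]ul.
  rewrite -enorm_sqr -/(d l x) -/(w l x) /g; lra.
have Ib : (fun l => \int[lebesgue]_(x in U) b l x) @ \oo --> 0.
  rewrite -(_ : \int[lebesgue]_(x in U) (0 : R) = 0); last first.
    by rewrite Rintegral_cst// mul0r.
  apply: (Rintegral_dominated_cvg _ _ _ (fun=> 9 / 2)) => //.
    exact: integrable_on_cst.
  by move=> l x _; rewrite ger0_norm.
have bi l : integrable_on U (b l).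
  apply: (le_integrable_on _ _ (fun=> 9 / 2)) => //; last exact: integrable_on_cst.
  by move=> x _; rewrite ger0_norm.
have wi l : integrable_on U (w l).
  by have [wI _] := potential_bound L N C0 _ _ _ L0 (data l); exact: integrable_onS wI.
have wB l : \int[lebesgue]_(x in U) w l x <= 4 * eps l * C0.
  have [wI wB] := potential_bound L N C0 _ _ _ L0 (data l).
  by apply: le_trans wB; apply: Rintegral_subset_le => // x _; exact: sqr_ge0.
have dle l x : d l x <= 2 * w l x + b l x.
  by rewrite -lerBlDl /b le_max lexx orbT.
pose Z l := 2 * (4 * eps l * C0) + \int[lebesgue]_(x in U) b l x.
have Z0 : Z @ \oo --> 0.
  rewrite (_ : 0 = 2 * (4 * 0 * C0) + 0); last by ring.
  apply: cvgD => //; apply: cvgM; first exact: cvg_cst.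
  by apply: cvgM; [apply: cvgM; [exact: cvg_cst | exact: eps0] | exact: cvg_cst].
rewrite /L2_cvg01.
apply: (@squeeze_cvge _ _ _ _ (fun=> 0%E) _ (fun l => (Z l)%:E)); last 2 first.
- exact: cvg_cst.
- by apply: cvg_EFin; [exact: nearW | exact: Z0].
apply: nearW => l; apply/andP; split.
  by apply: integral_ge0 => x _; rewrite lee_fin sqr_ge0.
have -> : (\int[@lebesgue_measure R]_(x in `]0%R, 1%R[)
    (enorm (u_ l x - expi (theta x)) ^+ 2)%:E =
  \int[@lebesgue_measure R]_(x in `]0%R, 1%R[)
    (((u_ l x).1 - cos (theta x)) ^+ 2 + ((u_ l x).2 - sin (theta x)) ^+ 2)%R%:E)%E.
  by apply: eq_integral => x _; rewrite enorm_sqr.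
have mJ : measurable_set J by exact: finite_measurable.
have mdI : measurable_on `]0, 1[ (d l).
  have -> : `]0, 1[%classic = U `|` (`]0, 1[ `&` J).
    apply/seteqP; split=> [x Ix|x [[]|[]]//].
    by have [Jx|Jx] := pselect (J x); [right | left].
  apply/measurable_funU => //; first exact: measurableI.
  split; first exact: md.
  by apply: finite_measurable_fun; apply: sub_finite_set Jfin; exact: subIsetr.
rewrite (ge0_negligible_integral mJ mI); last 3 first.
- exact/measurable_EFinP.
- by move=> x _; rewrite lee_fin addr_ge0// sqr_ge0.
- by apply: countable_lebesgue_measure0; exact: finite_set_countable.
apply: (@le_trans _ _ (\int[@lebesgue_measure R]_(x in U) (2 * w l x + b l x)%:E)%E).
  apply: ge0_le_integral => //.
  - by move=> x _; rewrite lee_fin addr_ge0// sqr_ge0.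
  - by apply/measurable_EFinP; exact: (md l).
  - by apply/measurable_EFinP; apply: measurable_funD => //; exact: measurable_funM.
  - by move=> x _; rewrite lee_fin; exact: dle.
rewrite integral_EFin//; last by apply: integrable_onD => //; exact: integrable_onZ.
rewrite lee_fin RintegralD//; last exact: integrable_onZ.
by rewrite RintegralZl// lerD2r ler_wpM2l.
Qed.

Lemma eventually_small {R : realType} (eps : nat -> R) (n : nat) :
  (forall l, 0 < eps l) ->
  exists2 e0 : R, 0 < e0 & forall l, eps l < e0 -> (n <= l)%N.
Proof.
move=> eps0; elim: n => [|n [e0 e00 H]]; first by exists 1.
exists (Num.min e0 (eps n)); first by rewrite lt_min e00 eps0.
move=> l; rewrite lt_min => /andP[le0 ln].
have := H l le0; rewrite leq_eqVlt => /predU1P[nl|//].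
by move: ln; rewrite nl ltxx.
Qed.

Theorem theorem3p2 (R : realType) (L : R) (N : nat) (alpha C0 : R)
    (u_ : R -> R -> R * R) :
  0 < L -> (0 < N)%N -> 0 <= alpha < 2 * pi ->
  (forall e : R, 0 < e -> admissible alpha (u_ e)) ->
  (\forall e \near 0^'+, (energy L N e (u_ e) <= C0%:E)%E) ->
  exists (J : set R) (u : R -> R * R) (eps : nat -> R),
    let U := `]0, 1[ `\` J in
    [/\ finite_set J /\ J `<=` `]0, 1[,
        H1_S1 U u,
        (forall l, 0 < eps l) /\ eps @ \oo --> 0,
        L2_cvg01 (fun l => u_ (eps l)) u
      & exists (theta : R -> R) (theta_ : nat -> R -> R),
        [/\ H1 U theta,
            {in U, continuous theta},
            forall x, U x -> u x = expi (theta x),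
            forall K : set R, compact K -> K `<=` U ->
              exists2 e0 : R, 0 < e0 & forall l, eps l < e0 ->
                [/\ forall x, K x -> 0 < enorm (u_ (eps l) x),
                    {within K, continuous (theta_ l)}
                  & forall x, K x ->
                      u_ (eps l) x =
                        (enorm (u_ (eps l) x) * cos (theta_ l x),
                         enorm (u_ (eps l) x) * sin (theta_ l x))]
          & H1loc_weak_cvg U theta_ theta]].
Proof.
move=> L0 _ _ adm; rewrite near_withinE => /nbhs_ballP[e1 /= e10 He1].
have energy_e e : 0 < e -> e < e1 -> (energy L N e (u_ e) <= C0%:E)%E.
  by move=> e0 ee1; apply: He1 => //; rewrite /ball/= sub0r normrN gtr0_norm.
have /choice[p pP] : forall e : R, exists p : (R -> R) * (R -> R),
    0 < e -> e < e1 -> energy_data L N C0 e (u_ e) p.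
  move=> e; have [[e0 ee1]|ne] := pselect (0 < e /\ e < e1); last first.
    by exists (fun=> 0, fun=> 0) => e0 ee1; exfalso; exact: ne.
  have [p1 [p2 [P s di dC]]] :=
    admissible_energy L N alpha e C0 (u_ e) L0 e0 (adm e e0) (energy_e e e0 ee1).
  by exists (p1, p2).
have /choice[tau tauP] : forall eq : R * rat, exists t, `|t| <= pi /\
    u_ eq.1 (ratr eq.2) = (enorm (u_ eq.1 (ratr eq.2)) * cos t,
                           enorm (u_ eq.1 (ratr eq.2)) * sin t).
  by move=> [e q]; exact: polar_form.
pose M := 64 / L * C0 + 32 * (2 * pi * N%:R) ^+ 2.
have mI : measurable_set (`]0, 1[ : set R) by exact: measurable_set_itv.
have oI : open (`]0, 1[%classic : set R) by exact: interval_open.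
have Ifin : (@lebesgue_measure R `]0%R, 1%R[ < +oo)%E by rewrite lebesgue_itv01 ltry.
have om_data e q : energy_data L N C0 e (u_ e) q ->
    square_integrable `]0, 1[ (angvel (u_ e) q) /\
    \int[lebesgue]_(x in `]0, 1[) angvel (u_ e) q x ^+ 2 <= M.
  move=> [e0 [P1 P2] [s1 s2] di dC].
  exact: (angular_velocity_bound L N e C0).
pose BT := (1 + M) / 2.
have cumul_om e q x : energy_data L N C0 e (u_ e) q ->
    `|cumul (angvel (u_ e) q) x| <= BT.
  move=> /om_data[osq oM].
  have oi := square_integrable_integrable _ _ mI Ifin osq.
  apply: (le_trans (cumul_bound _ _ oi)).
  apply: (le_trans (Rintegral_norm_le _ _ 1 mI Ifin ltr01 osq)).
  by rewrite lebesgue_itv01/= mul1r invr1 mul1r ler_pM2r ?invr_gt0// lerD2l.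
(* The countably many quantities that have to converge: the energies and the
   integrals of the angular velocity up to a rational point, and the phases
   at the rational points. *)
pose a (k : rat + (rat + rat)) (e : R) : R := match k with
  | inl q => cumul (dens L N e (u_ e) (p e)) (ratr q)
  | inr (inl q) => cumul (angvel (u_ e) (p e)) (ratr q)
  | inr (inr q) => tau (e, q)
  end.
pose B (k : rat + (rat + rat)) : R := match k with
  | inl _ => C0 | inr (inl _) => BT | inr (inr _) => pi
  end.
have small (r : R) : 0 < r -> \forall e \near (0 : R)^'+, 0 < e /\ e < r.
  move=> r0; near=> e; split; first by near: e; exact: nbhs_right_gt.
  by near: e; exact: nbhs_right_lt.
have aB k : \forall e \near (0 : R)^'+, `|a k e| <= B k.
  apply: filterS (small _ e10) => e [e0 ee1]; have data := pP e e0 ee1.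
  case: k => [q|[q|q]] /=.
  - have [_ _ _ di dC] := data; apply: (le_trans (cumul_bound _ _ di)).
    apply: le_trans dC; rewrite le_eqVlt; apply/orP; left; apply/eqP.
    by apply: eq_Rintegral_on => x _; rewrite ger0_norm// density_ge0.
  - exact: cumul_om.
  - by have [] := tauP (e, q).
pose P (n : nat) := [set e : R | (0 < e /\ e < e1) /\ (0 < e /\ e < n.+1%:R^-1)].
have PP n : (0 : R)^'+ (P n) by apply: filterI; apply: small; rewrite // invr_gt0.
have [eps [A [epsP epsA]]] := diagonal_extraction _ _ ((0 : R)^'+) a B P _ aB PP.
have eps_gt0 l : 0 < eps l by have [[]] := epsP l.
have eps_cvg : eps @ \oo --> 0.
  apply: (@squeeze_cvgr _ _ _ _ (fun=> 0) (@harmonic R)); last 2 first.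
  - exact: cvg_cst.
  - exact: cvg_harmonic.
  by apply: nearW => l; have [_ [? ?]] := epsP l; rewrite !ltW.
pose v l := u_ (eps l); pose q l := p (eps l).
have data l : energy_data L N C0 (eps l) (v l) (q l).
  by have [[? ?] _] := epsP l; exact: pP.
(* Concentration points of the energy at the threshold of [modulus_gap]; around any
   other point the modulus stays away from 0. *)
pose m (r : rat) := A (inl r).
have m_cvg (r : rat) : (fun l => cumul (dens L N (eps l) (v l) (q l)) (ratr r))
    @ \oo --> m r := epsA (inl r).
pose J := [set x : R | 0 < x < 1 /\ forall r s : rat,
  0 < (ratr r : R) -> ratr r < x -> x < ratr s -> (ratr s : R) < 1 ->
  32^-1 <= m s - m r].
have Jfin : finite_set J.
  apply: (finite_concentration m 32^-1 C0) => [|r s]; first by rewrite invr_gt0.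
  have cD : (fun l => cumul (dens L N (eps l) (v l) (q l)) (ratr s) -
      cumul (dens L N (eps l) (v l) (q l)) (ratr r)) @ \oo --> m s - m r.
    by apply: cvgB; exact: m_cvg.
  rewrite -(cvg_lim (@Rhausdorff R) cD); apply: limr_le.
    by apply/cvg_ex; exists (m s - m r).
  apply: nearW => l; have [e0 _ _ di dC] := data l.
  apply: le_trans dC; apply: cumul_le => // x _; exact: density_ge0.
pose U := `]0, 1[%classic `\` J.
have oU : open U.
  rewrite /U setDE; apply: openI => //; apply: closed_openC.
  by apply: (accessible_finite_set_closed.1 _ _ Jfin); exact/hausdorff_accessible/Rhausdorff.
have UI : U `<=` `]0, 1[ by move=> x [].
have gap z : U z -> exists2 d : R, 0 < d & exists n, forall l, (n <= l)%N ->
    forall y, `|z - y| < d -> 4^-1 < enorm (v l y) ^+ 2.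
  move=> [Iz Jz]; apply: contrapT => ngap; apply: Jz; split.
    by move: Iz; rewrite /= in_itv.
  move=> r s r0 rz zs s1; rewrite leNgt; apply/negP => ms; apply: ngap.
  exact: (gap_near L N C0 eps v q m z r s).
pose om l := angvel (v l) (q l).
pose ta l r := tau (eps l, r).
have osq l : square_integrable `]0, 1[ (om l) by have [] := om_data _ _ (data l).
have oM l : \int[lebesgue]_(x in `]0, 1[) om l x ^+ 2 <= M.
  by have [] := om_data _ _ (data l).
have oi l : integrable_on `]0, 1[ (om l) by exact: square_integrable_integrable.
pose theta_ l := lifted_phase U (ta l) (om l).
have theta_prim l : primitive_on U (theta_ l) (om l).
  by apply: lifted_phase_primitive.
pose Th x := limn (fun l => cumul (om l) x).
have Th_cvg x : `]0, 1[%classic x -> (fun l => cumul (om l) x) @ \oo --> Th x.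
  exact: (cumul_cvg om M (fun r => A (inr (inl r))) x osq oM
    (fun r => epsA (inr (inl r)))).
pose theta x := A (inr (inr (anchor U x))) + (Th x - Th (ratr (anchor U x))).
have theta_cvg x : U x -> theta_ ^~ x @ \oo --> theta x.
  move=> Ux; apply: cvgD; first exact: (epsA (inr (inr _))).
  apply: cvgB; apply: Th_cvg; apply: UI => //.
  by apply: (anchor_joined U x oU Ux); rewrite ?ge_min ?le_max lexx orbT.
pose Bt := pi + (BT + BT).
have theta_bound l x : U x -> `|theta_ l x| <= Bt.
  move=> _; rewrite (le_trans (ler_normD _ _))// lerD//.
    by have [] := tauP (eps l, anchor U x).
  rewrite (le_trans (ler_normB _ _))// lerD//; exact: cumul_om.
have Ufin := sub_itv01 U oU UI.
have omS V : open V -> V `<=` U -> (forall l, square_integrable V (om l)) /\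
    forall l, \int[lebesgue]_(x in V) om l x ^+ 2 <= M.
  move=> oV VU; have VI := subset_trans VU UI.
  have mV : measurable_set V by exact: open_measurable.
  split=> l; first exact: square_integrableS VI (osq l).
  apply: le_trans (oM l); have [_ o2] := osq l.
  by apply: Rintegral_subset_le => // x _; exact: sqr_ge0.
have [osqU oMU] := omS U oU (@subset_refl _ _).
have [g [gsq theta_g thetaH1]] := H1_limit U theta_ om theta Bt M oU Ufin theta_prim
  osqU oMU theta_bound theta_cvg.
have theta_cont x : U x -> {for x, continuous theta}.
  by move=> Ux; exact: (primitive_on_continuous_at _ _ _ _ oU theta_g Ux).
have mU : measurable_set U by exact: open_measurable.
have lift x : U x -> exists2 d : R, 0 < d & exists n, forall l, (n <= l)%N ->
    forall y, `|x - y| < d -> 0 < enorm (v l y) /\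
    v l y = (enorm (v l y) * cos (theta_ l y), enorm (v l y) * sin (theta_ l y)).
  apply: (lift_near L N C0 eps v q ta U x) => // l r.
  by have [] := tauP (eps l, r).
have circle_H1 (c c' : R -> R) : (forall t : R, is_derive t 1 c (c' t)) ->
    continuous c' -> (forall t, `|c t| <= 1) -> (forall t, `|c' t| <= 1) ->
    H1 U (fun x => c (theta x)).
  move=> dc cc' c1 c1'.
  have P1 := primitive_on_comp _ _ _ _ _ dc cc' theta_g.
  have cc : continuous c.
    by move=> t; apply/differentiable_continuous/derivable1_diffP; case: (dc t).
  have meas (h : R -> R) : continuous h -> measurable_on U (fun x => h (theta x)).
    move=> ch; apply: open_continuous_measurable_fun => // x; rewrite inE => Ux.
    by apply: continuous_comp; [exact: theta_cont | exact: ch].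
  apply: (H1_primitive _ _ _ oU Ufin _ _ P1).
    by apply: (Rintegral_sqr_bounded _ _ 1) => //; exact: meas.
  by apply: (square_integrableM_bounded _ 1) => //; exact: meas.
exists J, (fun x => expi (theta x)), eps; cbv zeta; rewrite -/U; split.
- by split=> // x [].
- split; first split.
  + apply: (circle_H1 cos (fun t => - sin t)).
    * by move=> t; apply: cvgN; exact: continuous_sin.
    * by move=> t; rewrite ler_norml cos_geN1 cos_le1.
    * by move=> t; rewrite normrN ler_norml sin_geN1 sin_le1.
  + apply: (circle_H1 sin cos).
    * exact: continuous_cos.
    * by move=> t; rewrite ler_norml sin_geN1 sin_le1.
    * by move=> t; rewrite ler_norml cos_geN1 cos_le1.
  + by move=> x _; rewrite /enorm /expi/= cos2Dsin2 sqrtr1.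
- by [].
- apply: (L2_limit L N C0 eps v q J theta_ theta) => //.
  move=> x Ux; have [d d0 [n nP]] := lift x Ux.
  exists n => // l /= nl; have [] := nP l nl x => //.
  by rewrite subrr normr0.
exists theta, theta_; split=> //.
- by move=> x; rewrite inE; exact: theta_cont.
- move=> K cK KU.
  have [n nP] := compact_eventually K (fun l y => 0 < enorm (v l y) /\
    v l y = (enorm (v l y) * cos (theta_ l y), enorm (v l y) * sin (theta_ l y)))
    cK (fun x Kx => lift x (KU x Kx)).
  have [e0 e00 He0] := eventually_small eps n eps_gt0.
  exists e0 => // l le0; have nl := He0 l le0; split.
  + by move=> x Kx; have [] := nP l nl x Kx.
  + apply: continuous_in_subspaceT => x; rewrite inE => /KU Ux.
    exact: (primitive_on_continuous_at _ _ _ _ oU (theta_prim l) Ux).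
  + by move=> x Kx; have [] := nP l nl x Kx.
move=> V oV cV VU.
have VU' : V `<=` U by apply: subset_trans VU; exact: subset_closure.
have [osqV oMV] := omS V oV VU'.
apply: (H1_weak_cvg_bounded V theta_ om theta Bt M) => //.
- exact: sub_itv01 (subset_trans VU' UI).
- by move=> l; exact: primitive_onS VU' (theta_prim l).
- by move=> l x /VU'; exact: theta_bound.
- by move=> x /VU'; exact: theta_cvg.
Unshelve. all: by end_near. Qed.
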